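(* Let $N\ge2$ be an integer, $s\in(0,1)$, $\lambda\in(0,\Lambda_{N,s})$ and $p\in\left(1+\frac{2s}{N-\mu(\lambda)+2-2s},\,1+\frac{2s}{\mu(\lambda)}\right)$. Then there exists $\delta>0$ with $\lambda+\delta<\Lambda_{N,s}$ such that for every $\delta_1\in(0,\delta)$ there is $\lambda_1\in(\lambda,\lambda+\delta)$ with the following property. If $f$ is a measurable, non-negative, non-trivial function on $\mathbb{R}^{N+1}$ such that $f(x,t)=0$ a.e. in $\mathbb{R}^N\times(-\infty,0)$ and, for $t>0$, $$f(x,t)\le\delta_1(1+t)^{\frac{\mu(\lambda_1)}{2}-\frac{s}{p-1}}|x|^{-\mu(\lambda_1)-2s}e^{-\frac{|x|^2}{4(1+t)}},$$ then the problem $$H^s(w)=\frac{\lambda}{|x|^{2s}}w+w^p+f\ \text{ in }\mathbb{R}^N\times(0,\infty),\qquad w=0\ \text{ in }\mathbb{R}^N\times(-\infty,0]$$ has a non-negative, non-trivial very weak solution $w\in L^1_{loc}(\mathbb{R}^{N+1})$.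
   Context: $\Lambda_{N,s}=2^{2s}\frac{\Gamma^2(\frac{N+2s}{4})}{\Gamma^2(\frac{N-2s}{4})}$. The function $\Upsilon:[0,\frac{N-2s}{2})\to(0,\Lambda_{N,s}]$, $\Upsilon(\alpha)=2^{2s}\frac{\Gamma(\frac{N+2s+2\alpha}{4})\Gamma(\frac{N+2s-2\alpha}{4})}{\Gamma(\frac{N-2s-2\alpha}{4})\Gamma(\frac{N-2s+2\alpha}{4})}$, is a continuous decreasing bijection, and $\mu(\lambda):=\frac{N-2s}{2}-\Upsilon^{-1}(\lambda)$. $H^s=(\partial_t-\Delta)^s$ is the fractional heat operator, the Fourier multiplier on $\mathbb{R}^{N+1}$ with symbol $(i\theta+|\xi|^2)^s$. For $q\in[1,2]$ and $g\in L^q(\mathbb{R}^N\times(-\infty,T))$ for all $T\in\mathbb{R}$, $$J_sg(x,t):=\frac{1}{\Gamma(s)(4\pi)^{N/2}}\int_0^\infty\int_{\mathbb{R}^N}\frac{e^{-|z|^2/(4\tau)}}{\tau^{\frac N2+1-s}}g(x-z,t-\tau)\,dz\,d\tau$$ (the inverse of $H^s$). A non-negative $w$ is a very weak solution of the problem above if, for some $q\in[1,2]$, $g:=\frac{\lambda}{|x|^{2s}}w+w^p+f$ belongs to $L^q(\mathbb{R}^N\times(-\infty,T))$ for all $T\in\mathbb{R}$, $g=0$ a.e. for $t<0$, $w\in L^q_{loc}(\mathbb{R}^{N+1})$ and $w=J_s(g)$ a.e. in $\mathbb{R}^{N+1}$. *)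

(* Defs.v *)
From HB Require Import structures.
From mathcomp Require Import all_boot all_order all_algebra.
From mathcomp Require Import all_classical all_reals all_analysis.
From mathcomp Require Import measurable_realfun.

Set Implicit Arguments.
Unset Strict Implicit.
Unset Printing Implicit Defensive.

Import Order.TTheory GRing.Theory Num.Theory.
Import numFieldNormedType.Exports.

Local Open Scope classical_set_scope.
Local Open Scope ring_scope.

(* R^N, with the Borel sigma-algebra (generated by the coordinates), and
   R^N x R, whose points are pairs (x, t). *)
Notation euclid R N := (N.-tuple (measurableTypeR R)).
Notation spacetime R N := (euclid R N * measurableTypeR R)%type.

Section tuple_lebesgue_step.
Context {R : realType} (n : nat).
Variable m : {sigma_finite_measure set (euclid R n) -> \bar R}.

Definition tuple_cons (z : measurableTypeR R * euclid R n) : euclid R n.+1 :=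
  [tuple of z.1 :: z.2].

Lemma measurable_tuple_cons : measurable_fun [set: measurableTypeR R * euclid R n] tuple_cons.
Proof. exact: measurable_cons. Qed.

Definition tuple_lebesgue_step : set (euclid R n.+1) -> \bar R :=
  pushforward (@lebesgue_measure R \x m)%E tuple_cons.

Let step0 : tuple_lebesgue_step set0 = 0%E.
Proof. by rewrite /tuple_lebesgue_step /pushforward preimage_set0 measure0. Qed.

Let step_ge0 A : (0 <= tuple_lebesgue_step A)%E.
Proof. exact: (measure_ge0 (@lebesgue_measure R \x m)%E). Qed.

Let step_sigma_additive : semi_sigma_additive tuple_lebesgue_step.
Proof.
move=> F mF tF mUF; rewrite /tuple_lebesgue_step /pushforward preimage_bigcup.
apply: measure_semi_sigma_additive.
- by move=> k; rewrite -[X in measurable X]setTI; exact: measurable_tuple_cons.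
- apply/trivIsetP => /= i j _ _ ij; rewrite -preimage_setI.
  by move/trivIsetP : tF => /(_ _ _ _ _ ij) ->//; rewrite preimage_set0.
- rewrite -preimage_bigcup -[X in measurable X]setTI.
  exact: measurable_tuple_cons.
Qed.

HB.instance Definition _ := isMeasure.Build _ _ _
  tuple_lebesgue_step step0 step_ge0 step_sigma_additive.

Let step_sigma_finite : sigma_finite setT tuple_lebesgue_step.
Proof.
have /sigma_finiteP[F [TF ndF Foo]] := sigma_finiteT (@lebesgue_measure R).
have /sigma_finiteP[G [TG ndG Goo]] := sigma_finiteT m.
pose uncons (v : euclid R n.+1) : measurableTypeR R * euclid R n :=
  (thead v, [tuple of behead v]).
have muncons : measurable_fun setT uncons.
  apply/measurable_fun_pairP; split; first exact: measurable_tnth.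
  exact: measurable_behead.
have consK z : uncons (tuple_cons z) = z.
  by case: z => a v; congr pair; apply: val_inj.
exists (fun k => uncons @^-1` (F k `*` G k)).
  apply/seteqP; split=> // v _.
  have [i _ Fi] : (\bigcup_i F i) (uncons v).1 by rewrite -TF.
  have [j _ Gj] : (\bigcup_j G j) (uncons v).2 by rewrite -TG.
  exists (maxn i j) => //; split.
    by move: Fi; exact/subsetPset/ndF/leq_maxl.
  by move: Gj; exact/subsetPset/ndG/leq_maxr.
move=> k; have [mF Fk] := Foo k; have [mG Gk] := Goo k; split.
  by rewrite -[X in measurable X]setTI; apply: muncons => //; exact: measurableX.
rewrite /tuple_lebesgue_step /pushforward -comp_preimage.
rewrite (_ : uncons \o tuple_cons = id); last by apply/funext => z /=.
by rewrite preimage_id product_measure1E// lte_mul_pinfty// ge0_fin_numE.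
Qed.

HB.instance Definition _ := Measure_isSigmaFinite.Build _ _ _
  tuple_lebesgue_step step_sigma_finite.

End tuple_lebesgue_step.

Section tuple_lebesgue.
Context {R : realType}.

(* Lebesgue measure on R^n: the n-fold product of the one-dimensional one. *)
Fixpoint tuple_lebesgue (n : nat) :
    {sigma_finite_measure set (euclid R n) -> \bar R} :=
  match n with
  | 0 => \d_ [tuple]
  | n'.+1 => tuple_lebesgue_step (tuple_lebesgue n')
  end.

Definition spacetime_lebesgue (N : nat) :
    {measure set (spacetime R N) -> \bar R} :=
  (tuple_lebesgue N \x @lebesgue_measure R)%E.

End tuple_lebesgue.

Section lebesgue_spaces.
Context {R : realType}.

(* Measurability with respect to the completion of [mu]. *)
Definition complete_measurable_fun d (T : measurableType d)
    (mu : {measure set T -> \bar R}) (D : set T) (f : T -> R) : Prop :=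
  forall Y : set R, measurable Y ->
    completed_algebra_gen mu (D `&` f @^-1` Y).

Definition in_Lq d (T : measurableType d) (mu : {measure set T -> \bar R})
    (q : R) (D : set T) (f : T -> R) : Prop :=
  complete_measurable_fun mu D f /\ finite_norm mu q%:E (f \_ D).

(* Tuples carry no topology in the library, hence the detour through row
   vectors to speak of the compact subsets of R^N x R. *)
Definition spacetime_rV (N : nat) (z : spacetime R N) : 'rV[R]_N * R :=
  (\row_i (tnth z.1 i : R), z.2 : R).

Definition in_Lq_loc (N : nat) (q : R) (f : spacetime R N -> R) : Prop :=
  complete_measurable_fun (spacetime_lebesgue N) setT f /\
  forall K : set ('rV[R]_N * R), compact K ->
    finite_norm (spacetime_lebesgue N) q%:E (f \_ (@spacetime_rV N @^-1` K)).

End lebesgue_spaces.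

Section fractional_heat.
Context {R : realType}.

Definition Gamma (a : R) : R :=
  \int[@lebesgue_measure R]_(t in `]0, +oo[) (t `^ (a - 1) * expR (- t)).

Definition enorm (N : nat) (x : euclid R N) : R :=
  Num.sqrt (\sum_(i < N) (tnth x i : R) ^+ 2).

Definition esub (N : nat) (x y : euclid R N) : euclid R N :=
  [tuple ((tnth x i : R) - (tnth y i : R) : R) | i < N].

Variables (N : nat) (s : R).

(* Lambda_{N,s} *)
Definition hardy_const : R :=
  2 `^ (2 * s) *
  (Gamma ((N%:R + 2 * s) / 4) ^+ 2 / Gamma ((N%:R - 2 * s) / 4) ^+ 2).

Definition Upsilon (alpha : R) : R :=
  2 `^ (2 * s) *
  ((Gamma ((N%:R + 2 * s + 2 * alpha) / 4) *
    Gamma ((N%:R + 2 * s - 2 * alpha) / 4)) /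
   (Gamma ((N%:R - 2 * s - 2 * alpha) / 4) *
    Gamma ((N%:R - 2 * s + 2 * alpha) / 4))).

(* [pinv A f] is the inverse of [f] restricted to [A]. *)
Definition hardy_mu (lambda : R) : R :=
  (N%:R - 2 * s) / 2 - pinv `[0, (N%:R - 2 * s) / 2[ Upsilon lambda.

Local Open Scope ereal_scope.

Definition J (g : spacetime R N -> R) (z : spacetime R N) : \bar R :=
  ((Gamma s * (4 * pi) `^ (N%:R / 2))^-1)%R%:E *
  \int[@lebesgue_measure R]_(tau in `]0%R, +oo[)
    \int[tuple_lebesgue N]_y
      (expR (- (enorm y ^+ 2 / (4 * tau))) / tau `^ (N%:R / 2 + 1 - s) *
       g (esub z.1 y, (z.2 : R) - (tau : R)))%R%:E.

Local Close Scope ereal_scope.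

Variables (lambda p : R) (f : spacetime R N -> R).

Definition heat_rhs (w : spacetime R N -> R) (z : spacetime R N) : R :=
  lambda / enorm z.1 `^ (2 * s) * w z + w z `^ p + f z.

(* Very weak solutions of H^s w = lambda |x|^(-2s) w + w^p + f for t > 0, with
   w = 0 for t <= 0; J is the inverse of H^s = (d/dt - Laplacian)^s. *)
Definition very_weak_solution (w : spacetime R N -> R) : Prop :=
  (forall z, 0 <= w z) /\
  exists2 q : R, 1 <= q <= 2 &
    [/\ forall T : R, in_Lq (spacetime_lebesgue N) q
          [set z : spacetime R N | (z.2 : R) < T] (heat_rhs w),
        {ae spacetime_lebesgue N, forall z : spacetime R N,
          (z.2 : R) < 0 -> heat_rhs w z = 0},
        in_Lq_loc q w &
        {ae spacetime_lebesgue N, forall z : spacetime R N,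
          (w z)%:E = J (heat_rhs w) z}].

End fractional_heat.

(* Main.v *)
Require Import Defs.
From HB Require Import structures.
From mathcomp Require Import all_boot all_order all_algebra.
From mathcomp Require Import all_classical all_reals all_analysis.
From mathcomp Require Import measurable_realfun ring lra.
Import Order.TTheory GRing.Theory Num.Theory.
Import numFieldNormedType.Exports.
Local Open Scope classical_set_scope.
Local Open Scope ring_scope.

(** The solution is found between 0 and an explicit supersolution [V = C W].
    Put [L = 1 + t] and, for t > 0,
      [W = L^a |x|^-m exp (- sg |x|^2 / (4 L))],   [a = m/2 - s/(p-1)],
    continued by 0 to t <= 0 ([profile a m sg]); the exponent [a] is the one
    that makes [|x|^-2s W] and [W^p] scale in the same way. Write
    [m = (N-2s)/2 - al].

    Linear part. For a pure power, J (|x|^-(m+2s)) = |x|^-m / Upsilon al; the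
    claim is that the profile loses nothing:
    J (|x|^-2s W) <= W / Upsilon al ([J_profile_le], [Upsilon_riesz_const]).
    The power is a superposition of Gaussians exp (- h |x|^2), and convolving
    these with the heat kernel at time tau is explicit. After rescaling h, a
    change of the variable tau maps the outcome to the integral of the pure
    power, and the Jacobian pays for the ratio of the weights at times t - tau
    and t provided that [a + k >= 0] and [a + sg k >= 0], where
    [k = N/2 - m - s + 1] ([time_change_weight]). The lower bound on p says
    precisely that [a + k > 0] when m is mu(lambda); this persists for m a
    little larger, and then sg < 1 can be chosen as well.

    Upsilon is a constant divided by B(s,X) B(s,Y) with X + Y fixed, and the
    Beta function is log-convex in its second argument. Convexity yields that
    Upsilon does not increase, that it decreases strictly once it is below its
    value at 0, and that it takes all values between 0 and that value
    ([Upsilon_nonincreasing], [Upsilon_decreasing], [Upsilon_surj]). Hence a value m slightly above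
    mu(lambda) has [Upsilon al > lambda].

    Nonlinear part. The upper bound on p gives m (p-1) <= 2s for m close
    to mu(lambda), so that W^p is at most a multiple of |x|^-2s W, the Gaussian
    absorbing a power of |x|^2 / L ([profile_pow_le]). In the same way the bound imposed on f,
    whose Gaussian is stronger than that of W because sg < 1, is at most a
    multiple of |x|^-2s W for every exponent mu(lambda_1) <= m
    ([profile_source_le]); this inequality holds if lambda_1 < Upsilon al.
    The gap [Upsilon al - lambda] accommodates (C W)^p for C small, and f for
    delta small, whence J (lambda |x|^-2s V + V^p + f) <= V.

    Iterating w |-> J (lambda |x|^-2s w + w^p + f) from 0 then gives an
    increasing sequence below V, and monotone convergence shows that its limit
    is a fixed point ([picard_fixed_point]). It is integrable because m + 2s < N,
    so q = 1 works. If it vanished almost everywhere, then J of a nonnegative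
    function that dominates f would vanish at arbitrarily late times, which
    forces f to vanish ([J_eq0]). *)

Set Implicit Arguments.
Unset Strict Implicit.
Unset Printing Implicit Defensive.

(** * Integrals of nonnegative functions that need not be measurable *)

Section integral_any.
Local Open Scope ereal_scope.
Context d (T : measurableType d) (R : realType).
Variable mu : {measure set T -> \bar R}.
Import HBNNSimple.

(** The integral of a nonnegative function is a supremum over the simple
    functions below it, so it is monotone for arbitrary functions. This spares
    measurability proofs for the many integrands that are only compared. *)
Lemma le_integral_any (D : set T) (f g : T -> \bar R) :
  (forall x, D x -> 0 <= f x) -> (forall x, D x -> f x <= g x) ->
  \int[mu]_(x in D) f x <= \int[mu]_(x in D) g x.
Proof.
move=> f0 fg.
have g0 x : D x -> 0 <= g x by move=> Dx; exact: le_trans (f0 _ Dx) (fg _ Dx).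
rewrite !ge0_integralE//; apply: ereal_sup_le => _ [h hf <-].
exists h => // x.
apply: le_trans (hf x) _; rewrite !patchE; case: ifPn => //.
by rewrite inE => /fg.
Qed.

(** A simple function below [f] stays below [g] once it is set to 0 on the
    exceptional null set, and this does not change its integral. *)
Lemma ae_le_integral_any (D : set T) (f g : T -> \bar R) :
  (forall x, D x -> 0 <= f x) -> (forall x, D x -> 0 <= g x) ->
  {ae mu, forall x, D x -> f x <= g x} ->
  \int[mu]_(x in D) f x <= \int[mu]_(x in D) g x.
Proof.
move=> f0 g0 [N [mN muN fgN]].
rewrite !ge0_integralE//; apply: ge_ereal_sup => _ [h hf <-].
have mNC := measurableC mN.
pose k : {nnsfun T >-> R} := proj_nnsfun h mNC.
have -> : sintegral mu h = sintegral mu k.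
  rewrite -!integralT_nnsfun; apply: ge0_ae_eq_integral => //.
  - by apply/measurable_EFinP.
  - by apply/measurable_EFinP.
  - by move=> x _; rewrite lee_fin.
  - by move=> x _; rewrite lee_fin.
  exists N; split => // x /= /not_implyP[_ hk]; apply: contrapT => nNx; apply: hk.
  by rewrite /= mindicE mem_set//= mulr1.
apply: ereal_sup_ubound; exists k => // x /=.
rewrite mindicE; have [xN|xN] := pselect (N x).
  rewrite memNset; last by move=> /(_ xN).
  by rewrite mulr0 patchE; case: ifPn => //; rewrite inE => /g0.
rewrite mem_set//= mulr1; apply: le_trans (hf x) _; rewrite !patchE.
case: ifPn => //; rewrite inE => Dx.
by apply: contrapT => nfg; apply: xN; apply: fgN => /=; apply/not_implyP; split.
Qed.

Lemma ae_eq_integral_any (D : set T) (f g : T -> \bar R) :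
  (forall x, D x -> 0 <= f x) -> (forall x, D x -> 0 <= g x) ->
  {ae mu, forall x, D x -> f x = g x} ->
  \int[mu]_(x in D) f x = \int[mu]_(x in D) g x.
Proof.
move=> f0 g0 fg; apply/eqP; rewrite eq_le; apply/andP; split.
  by apply: ae_le_integral_any => //; apply: filterS fg => x /[apply] ->.
by apply: ae_le_integral_any => //; apply: filterS fg => x /[apply] ->.
Qed.
End integral_any.

Section tonelli_in.
Local Open Scope ereal_scope.
Context d1 d2 (T1 : measurableType d1) (T2 : measurableType d2) (R : realType).
Variables (m1 : {sigma_finite_measure set T1 -> \bar R})
  (m2 : {sigma_finite_measure set T2 -> \bar R}).
Variables (D1 : set T1) (D2 : set T2).
Hypotheses (mD1 : measurable D1) (mD2 : measurable D2).

Lemma tonelli_in (f : T1 -> T2 -> \bar R) :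
  measurable_fun setT (fun z => f z.1 z.2) -> (forall x y, 0 <= f x y) ->
  \int[m1]_(x in D1) \int[m2]_(y in D2) f x y =
  \int[m2]_(y in D2) \int[m1]_(x in D1) f x y.
Proof.
move=> mf f0.
pose h := (fun z => f z.1 z.2) \_ (D1 `*` D2).
have hE x y : h (x, y) = ((f x \_ D2) y) * (\1_D1 x)%:E.
  rewrite /h !patchE indicE; case: (boolP (x \in D1)) => xD; case: (boolP (y \in D2)) => yD.
  - by rewrite ifT ?mule1// inE/=; split; rewrite -inE.
  - by rewrite ifF ?mul0e//; apply/negP; rewrite inE => -[_ /=]; rewrite -inE (negbTE yD).
  - by rewrite ifF ?mule0//; apply/negP; rewrite inE => -[/=]; rewrite -inE (negbTE xD).
  - by rewrite ifF ?mul0e//; apply/negP; rewrite inE => -[/=]; rewrite -inE (negbTE xD).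
have mh : measurable_fun setT h.
  by apply/(measurable_restrictT _ (measurableX mD1 mD2)); exact: measurable_funTS.
have h0 z : 0 <= h z by apply: erestrict_ge0.
transitivity (\int[m1]_x \int[m2]_y h (x, y)).
  rewrite integral_mkcond; apply: eq_integral => x _; rewrite patchE.
  case: ifPn => xD.
    rewrite integral_mkcond; apply: eq_integral => y _.
    by rewrite hE indicE xD mule1.
  by rewrite integral0_eq// => y _; rewrite hE indicE (negbTE xD) mule0.
rewrite (fubini_tonelli h)//.
rewrite [RHS]integral_mkcond; apply: eq_integral => y _; rewrite patchE.
case: ifPn => yD.
  rewrite [RHS]integral_mkcond; apply: eq_integral => x _.
  by rewrite hE !patchE yD indicE; case: (x \in D1); rewrite ?mule1 ?mule0.
by rewrite integral0_eq// => x _; rewrite hE patchE (negbTE yD) mul0e.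
Qed.

Lemma measurable_integral_in (f : T1 -> T2 -> \bar R) :
  measurable_fun setT (fun z => f z.1 z.2) -> (forall x y, 0 <= f x y) ->
  measurable_fun setT (fun x => \int[m2]_(y in D2) f x y).
Proof.
move=> mf f0.
pose h := (fun z => f z.1 z.2) \_ (setT `*` D2).
have mh : measurable_fun setT h.
  by apply/(measurable_restrictT _ (measurableX measurableT mD2)); exact: measurable_funTS.
have h0 z : 0 <= h z by apply: erestrict_ge0.
have := @measurable_fun_fubini_tonelli_F _ _ _ _ _ m2 h mh h0.
congr measurable_fun; apply/funext => x; rewrite /fubini_F [RHS]integral_mkcond.
apply: eq_integral => y _; rewrite /h !patchE.
by congr (if _ then _ else _); apply/idP/idP; rewrite !inE/= => // -[].
Qed.
End tonelli_in.

(** * Measurability up to null sets, and affine changes of variable *)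

Section completion.
Context d (T : measurableType d) (R : realType).
Variable mu : {measure set T -> \bar R}.

Lemma complete_measurable_ae_eq (D : set T) (f g : T -> R) :
  measurable D -> measurable_fun setT g -> {ae mu, forall x, f x = g x} ->
  complete_measurable_fun mu D f.
Proof.
move=> mD mg [M [mM muM fgM]] Y mY.
have fg x : ~ M x -> f x = g x by move=> nM; apply: contrapT => ?; apply/nM/fgM.
exists ((D `&` g @^-1` Y) `&` ~` M).
  apply: measurableI; last exact: measurableC.
  by apply: measurableI => //; rewrite -[X in measurable X]setTI; exact: mg.
exists ((D `&` f @^-1` Y) `&` M).
  by exists M; split => // x [].
apply/seteqP; split => x.
  by case=> [[[Dx /= gx] nM]|[]//]; split=> //=; rewrite fg.
move=> [Dx /= fx]; have [Mx|nM] := pselect (M x); first by right.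
by left; split=> //; split=> //=; rewrite -fg.
Qed.

(** Countably many sets determine [f] up to a null set: each
    [f < r] with [r] rational is a measurable set up to a null set, and
    outside the union of these null sets [f] is recovered from them. *)
Lemma complete_measurable_repr (f : T -> R) :
  complete_measurable_fun mu setT f ->
  exists2 g : T -> R, measurable_fun setT g & {ae mu, forall x, f x = g x}.
Proof.
move=> cf.
(* An enumeration of the rationals. *)
pose r n : R := ratr (odflt 0%Q (unpickle n)).
have /choice[AM AMP] n : exists AM : set T * set T,
    [/\ measurable AM.1, measurable AM.2, mu AM.2 = 0%E &
        forall x, ~ AM.2 x -> (f x < r n <-> AM.1 x)].
  have [A mA [N [M [mM muM NM]] AN]] := cf _ (measurable_itv `]-oo, r n[).
  exists (A, M); split => //= x nMx.
  have -> : f x < r n <-> (setT `&` f @^-1` `]-oo, r n[) x.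
    by rewrite setTI /= in_itv.
  by rewrite -AN; split=> [[//|/NM]|]; last by left.
pose M := \bigcup_n (AM n).2.
have mM : measurable M by apply: bigcup_measurable => n _; have [] := AMP n.
have muM : mu M = 0%E.
  apply/negligibleP => //; apply: negligible_bigcup => n.
  by have [_ m2 m0 _] := AMP n; exact/negligibleP.
exists (f \_ (~` M)).
  apply/(measurable_restrictT _ (measurableC mM)).
  move=> mMC; apply: (measurability _ (RGenInftyO.measurableE R)) => // _ [_ [y ->] <-].
  rewrite (_ : _ `&` _ = \bigcup_n (if r n < y then (AM n).1 `&` ~` M else set0)).
    apply: bigcup_measurable => n _; case: ifPn => // _.
    by apply: measurableI; [have [] := AMP n|exact: measurableC].
  apply/seteqP; split=> x.
    move=> [nM]; rewrite /= in_itv/= => fy.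
    have [q] := rat_in_itvoo fy; rewrite in_itv/= => /andP[fq qy].
    exists (pickle q) => //; have rq : r (pickle q) = ratr q by rewrite /r pickleK.
    rewrite rq qy; split=> //; have [_ _ _ <-] := AMP (pickle q); first by rewrite rq.
    by move=> ?; apply: nM; exists (pickle q).
  move=> [n _]; case: ifPn => // ry [An nM]; split => //; rewrite /= in_itv/=.
  apply: lt_trans ry; have [_ _ _ ->//] := AMP n.
  by move=> ?; apply: nM; exists n.
exists M; split => // x /=; apply: contra_notP => nM.
by rewrite patchE mem_set.
Qed.

End completion.

Section affine_change.
Local Open Scope ereal_scope.
Context (R : realType).
Notation mu := (@lebesgue_measure R).

(** Lebesgue measure is determined by its values on intervals, and the
    image measure rescaled by [c] has these values. *)
Lemma lebesgue_measure_scale (c : R) (A : set R) : (0 < c)%R -> measurable A ->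
  pushforward mu (fun x : measurableTypeR R => (c * x)%R : measurableTypeR R) A = c^-1%:E * mu A.
Proof.
move=> c0 mA.
have mc : measurable_fun setT (fun x : measurableTypeR R => (c * x)%R : measurableTypeR R).
  exact: measurable_funM.
pose phi := (fun x : measurableTypeR R => (c * x)%R : measurableTypeR R).
have c0' : (0 <= c)%R by exact: ltW.
pose m := mscale (NngNum c0') (pushforward mu phi).
have mE : mu A = m mc A.
  apply: lebesgue_measure_unique => // _ [[a b]] _ <-.
  rewrite -[RHS]/(c%:E * mu (phi @^-1` `]a, b]%classic)) (_ : _ @^-1` _ = `](a / c)%R, (b / c)%R]%classic).
    rewrite !lebesgue_measure_itv/= !lte_fin ltr_pM2r ?invr_gt0//.
    case: ifPn => _; last by rewrite mule0.
    by rewrite -!EFinD -EFinM -mulrBl mulrCA divff ?gt_eqF// mulr1.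
  apply/seteqP; split=> x /=; rewrite !in_itv/= ltr_pdivrMr// ler_pdivlMr//;
    by rewrite ![(x * c)%R]mulrC.
rewrite mE -[m mc A]/(c%:E * mu (phi @^-1` A)) muleA -EFinM mulVf ?gt_eqF// mul1e//.
Qed.

Lemma lebesgue_measure_shift (c : R) (A : set R) : measurable A ->
  pushforward mu (fun x : measurableTypeR R => (c - x)%R : measurableTypeR R) A = mu A.
Proof.
move=> mA.
have mc : measurable_fun setT (fun x : measurableTypeR R => (c - x)%R : measurableTypeR R).
  exact: measurable_funB.
pose phi := (fun x : measurableTypeR R => (c - x)%R : measurableTypeR R).
apply/esym; apply: (@lebesgue_measure_unique _ (pushforward mu phi)) => // _ [[a b]] _ <-.
rewrite -[RHS]/(mu (phi @^-1` `]a, b]%classic)) (_ : _ @^-1` _ = `[(c - b)%R, (c - a)%R[%classic).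
  rewrite !lebesgue_measure_itv/= !lte_fin ltrD2l ltrN2.
  by case: ifPn => // _; rewrite -!EFinD; congr _%:E; lra.
apply/seteqP; split=> x; rewrite /phi /= !in_itv/=; lra.
Qed.

Lemma ge0_integral_scale (c : R) (f : R -> \bar R) : (0 < c)%R ->
  measurable_fun setT f -> (forall x, 0 <= f x) ->
  \int[mu]_(x in `]0%R, +oo[) f (c * x)%R = c^-1%:E * \int[mu]_(x in `]0%R, +oo[) f x.
Proof.
move=> c0 mf f0.
have c0' : (0 <= c^-1)%R by rewrite invr_ge0 ltW.
have mc : measurable_fun setT (fun x : measurableTypeR R => (c * x)%R : measurableTypeR R).
  exact: measurable_funM.
have -> : `]0%R, +oo[%classic =
   (fun x : measurableTypeR R => (c * x)%R : measurableTypeR R) @^-1` `]0%R, +oo[.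
  by apply/seteqP; split=> x /=; rewrite !in_itv/= !andbT pmulr_rgt0.
rewrite -[LHS]/(\int[mu]_(x in _) (f \o (fun x : measurableTypeR R => (c * x)%R : measurableTypeR R)) x).
rewrite -ge0_integral_pushforward//; last exact: measurable_funTS.
have -> : (fun x : measurableTypeR R => (c * x)%R : measurableTypeR R) @^-1` `]0%R, +oo[
   = `]0%R, +oo[%classic.
  by apply/seteqP; split=> x /=; rewrite !in_itv/= !andbT pmulr_rgt0.
rewrite -[c^-1%R]/((NngNum c0')%:num)%R -ge0_integral_mscale//; last exact: measurable_funTS.
by apply: eq_measure_integral => //= A mA _; exact: lebesgue_measure_scale.
Qed.

Lemma ge0_integral_shift (c : R) (f : R -> \bar R) :
  measurable_fun setT f -> (forall x, 0 <= f x) ->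
  \int[mu]_x f (c - x)%R = \int[mu]_x f x.
Proof.
move=> mf f0.
have mc : measurable_fun setT (fun x : measurableTypeR R => (c - x)%R : measurableTypeR R).
  exact: measurable_funB.
rewrite -[LHS]/(\int[mu]_(x in setT) (f \o (fun x : measurableTypeR R => (c - x)%R : measurableTypeR R)) x).
rewrite -(preimage_setT (fun x : measurableTypeR R => (c - x)%R : measurableTypeR R)).
rewrite -ge0_integral_pushforward// ?preimage_setT.
by apply: eq_measure_integral => //= A mA _; exact: lebesgue_measure_shift.
Qed.

End affine_change.

(** * Powers, exponentials and the measurability of explicit formulas *)

Section powers.
Context (R : realType).

Lemma powR_expln (x r : R) : 0 < x -> x `^ r = expR (r * ln x).
Proof. by move=> x0; rewrite /powR gt_eqF. Qed.

Lemma powRDp (x r t : R) : 0 < x -> x `^ (r + t) = x `^ r * x `^ t.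
Proof. by move=> x0; rewrite !powR_expln// mulrDl expRD. Qed.

Lemma measurable_invr : measurable_fun [set: R] (fun x : R => x^-1).
Proof.
rewrite (_ : (fun _ => _) = (fun x => x * (x ^+ 2) `^ (-1))).
  apply: measurable_funM => //.
  exact: (measurableT_comp (measurable_powR (-1)) (exprn_measurable 2)).
apply/funext => x; rewrite powR_inv1 ?sqr_ge0//.
have [->|x0] := eqVneq x 0; first by rewrite invr0 mul0r.
by rewrite expr2 invfM mulrA divff// mul1r.
Qed.

Lemma ln_le_linear (k x : R) : 0 < k -> 0 < x -> ln x <= x / k - 1 + ln k.
Proof.
move=> k0 x0; have xk : 0 < x / k by rewrite divr_gt0.
have -> : ln x = ln (x / k) + ln k by rewrite -lnM ?posrE// divfK ?gt_eqF.
rewrite lerD2r; have := @le_ln1Dx _ (x / k - 1).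
by rewrite addrCA subrr addr0 ltrBrDl subrr; exact.
Qed.

(** The maximum is attained at [x = e / c], and the tangent of the logarithm at
    that point ([ln_le_linear]) gives the bound. *)
Lemma powR_expR_bounded (e c : R) : 0 <= e -> 0 < c ->
  exists2 M : R, 0 < M & forall x, 0 < x -> x `^ e * expR (- (c * x)) <= M.
Proof.
move=> e0 c0; have [->|en0] := eqVneq e 0.
  exists 1 => // x x0; rewrite powRr0 mul1r -expR0 ler_expR oppr_le0.
  by rewrite ltW// mulr_gt0.
have {}e0 : 0 < e by rewrite lt_neqAle eq_sym en0.
exists (expR (e * ln (e / c) - e)); first exact: expR_gt0.
move=> x x0; rewrite powR_expln// -expRD ler_expR.
have := ln_le_linear (divr_gt0 e0 c0) x0.
rewrite -(ler_pM2l e0) => /le_trans h.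
have -> : e * ln (e / c) - e = e * (x / (e / c) - 1 + ln (e / c)) - c * x.
  by field; rewrite !gt_eqF.
by rewrite lerD2r; exact: h.
Qed.

End powers.

Section measurability.
Context d (T : measurableType d) (R : realType) (D : set T).
Implicit Types f g : T -> R.

Lemma measurable_fun_mul f g : measurable_fun D f -> measurable_fun D g ->
  measurable_fun D (fun x => f x * g x).
Proof. exact: measurable_funM. Qed.

Lemma measurable_fun_add f g : measurable_fun D f -> measurable_fun D g ->
  measurable_fun D (fun x => f x + g x).
Proof. exact: measurable_funD. Qed.

Lemma measurable_fun_oppr f : measurable_fun D f -> measurable_fun D (fun x => - f x).
Proof. exact: measurableT_comp. Qed.

Lemma measurable_fun_power f r : measurable_fun D f -> measurable_fun D (fun x => f x `^ r).
Proof. by move=> mf; exact: (measurableT_comp (measurable_powR r) mf). Qed.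

Lemma measurable_fun_exp f : measurable_fun D f -> measurable_fun D (fun x => expR (f x)).
Proof. by move=> mf; exact: (measurableT_comp (@measurable_expR R) mf). Qed.

Lemma measurable_fun_invr f : measurable_fun D f -> measurable_fun D (fun x => (f x)^-1).
Proof. by move=> mf; exact: (measurableT_comp (@measurable_invr R) mf). Qed.

Lemma measurable_fun_EFin f : measurable_fun D f -> measurable_fun D (fun x => (f x)%:E).
Proof. by move=> mf; apply/measurable_EFinP. Qed.

End measurability.

Lemma measurable_enorm (R : realType) n : measurable_fun setT (fun x : euclid R n => enorm x).
Proof.
rewrite (_ : (fun _ => _) = (fun x : euclid R n => (\sum_(i < n) (tnth x i : R) ^+ 2) `^ (2^-1))).
  apply: measurable_fun_power; apply: measurable_sum => i; apply: measurable_funX.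
  exact: measurable_tnth.
by apply/funext => x; rewrite powR12_sqrt// sumr_ge0// => i _; rewrite sqr_ge0.
Qed.

Lemma measurable_fun_enorm d (T : measurableType d) (R : realType) n (g : T -> euclid R n) :
  measurable_fun setT g -> measurable_fun setT (fun x => enorm (g x)).
Proof. by move=> mg; apply: (measurableT_comp (@measurable_enorm _ n) mg). Qed.

Lemma measurable_fun_esub d (T : measurableType d) (R : realType) n (g h : T -> euclid R n) :
  measurable_fun setT g -> measurable_fun setT h ->
  measurable_fun setT (fun x => esub (g x) (h x)).
Proof.
move=> mg mh; apply/measurable_fun_tnthP => i.
rewrite (_ : _ \o _ = fun x => (tnth (g x) i : R) - (tnth (h x) i : R)).
  apply: measurable_fun_add; first exact: (measurableT_comp (measurable_tnth i) mg).
  by apply: measurable_fun_oppr; exact: (measurableT_comp (measurable_tnth i) mh).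
by apply/funext => x /=; rewrite tnth_mktuple.
Qed.

(** Measurability of the explicit formulas below, by recursion on the
    expression; hence the pointwise form of the preceding lemmas. *)
Ltac meas := repeat lazymatch goal with
  | |- measurable_fun _ (fun _ => ?c) => exact: measurable_cst
  | |- measurable_fun _ (fun x => x) => exact: measurable_id
  | |- measurable_fun _ (fun x => EFin _) => apply: measurable_fun_EFin
  | |- measurable_fun _ (fun x => GRing.mul _ _) => apply: measurable_fun_mul
  | |- measurable_fun _ (fun x => Algebra.add _ _) => apply: measurable_fun_add
  | |- measurable_fun _ (fun x => Algebra.opp _) => apply: measurable_fun_oppr
  | |- measurable_fun _ (fun x => powR _ _) => apply: measurable_fun_power
  | |- measurable_fun _ (fun x => expR _) => apply: measurable_fun_exp
  | |- measurable_fun _ (fun x => GRing.inv _) => apply: measurable_fun_invr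
  | |- measurable_fun _ (fun x => GRing.exp _ _) => apply: measurable_funX
  | |- measurable_fun _ (fun x => enorm _) => apply: measurable_fun_enorm
  | |- measurable_fun _ (fun x => esub _ _) => apply: measurable_fun_esub
  | |- measurable_fun _ (@enorm _ _) => exact: measurable_enorm
  | |- measurable_fun _ (@esub _ _ _) => apply: measurable_fun_esub
  | |- _ => first [ assumption | exact: measurable_id | exact: measurable_fst
     | exact: measurable_snd | exact: measurable_cst
     | apply: measurable_fun_EFin | apply: measurable_fun_mul
     | apply: measurable_fun_add | apply: measurable_fun_oppr
     | apply: measurable_fun_power | apply: measurable_fun_exp
     | apply: measurable_fun_invr | apply: measurable_funX
     | apply: (measurableT_comp measurable_fst)
     | apply: (measurableT_comp measurable_snd) ]
  end.

Section positivity.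
Local Open Scope ereal_scope.
Context d (T : measurableType d) (R : realType).
Variable mu : {measure set T -> \bar R}.

Lemma integral_eq0_ae (D : set T) (f : T -> \bar R) : measurable D ->
  measurable_fun D f -> (forall x, D x -> 0 <= f x) ->
  \int[mu]_(x in D) f x = 0 -> {ae mu, forall x, D x -> f x = 0}.
Proof.
move=> mD mf f0 int0; apply/(ae_eq_integral_abs mu mD mf).
by rewrite -[RHS]int0; apply: eq_integral => x; rewrite inE => /f0 /gee0_abs.
Qed.

Lemma integral_gt0 (D : set T) (f : T -> \bar R) : measurable D ->
  measurable_fun D f -> (forall x, D x -> 0 < f x) -> 0 < mu D ->
  0 < \int[mu]_(x in D) f x.
Proof.
move=> mD mf f0 muD; rewrite lt_neqAle integral_ge0 ?andbT; last by move=> x /f0/ltW.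
apply/eqP => /esym int0.
have [|N [mN muN DN]] := integral_eq0_ae mD mf _ int0; first by move=> x /f0/ltW.
have : mu D <= mu N.
  apply: le_measure; rewrite ?inE// => x Dx; apply: DN => /= /(_ Dx) fx0.
  by have := f0 _ Dx; rewrite fx0 ltxx.
by rewrite muN leNgt muD.
Qed.

End positivity.

Section gamma.
Context (R : realType).
Notation mu := (@lebesgue_measure R).
Local Notation Ipos := (`]0%R, +oo[%classic).

Lemma lebesgue_pos_itvoy : (0 < mu Ipos)%E.
Proof. by rewrite lebesgue_measure_itv/= ltry oppr0 adde0 ltry. Qed.

Lemma integral_expR (c : R) : 0 < c ->
  (\int[mu]_(x in Ipos) (expR (- (c * x)))%:E = (c^-1)%:E)%E.
Proof.
move=> c0.
have : (\int[mu]_(x in `[0%R, +oo[) (c * expR (- (c * x)))%:E = 1)%E.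
  rewrite integral_mkcond -[RHS](integral_exponential_pdf c0).
  apply: eq_integral => x _; rewrite /exponential_pdf !patchE mulNr.
  by case: ifP.
rewrite -integral_itv_obnd_cbnd; last by apply: measurable_funTS; meas.
under eq_integral do rewrite EFinM.
rewrite ge0_integralZl_EFin; [|by []|by move=> x _; rewrite lee_fin expR_ge0|by apply: measurable_funTS; meas|exact: ltW].
  move=> /(congr1 (fun z => (c^-1)%:E * z)%E).
  by rewrite muleA -EFinM mulVf ?gt_eqF// mul1e mule1.

Qed.

Lemma integral_powR01 (a e : R) : 0 < a -> 0 < e < 1 ->
  (\int[mu]_(x in `[e, 1%R]) (x `^ (a - 1))%:E = ((1 - e `^ a) / a)%:E)%E.
Proof.
move=> a0 /andP[e0 e1].
rewrite (@continuous_FTC2 _ (fun x => x `^ (a - 1)) (fun x => x `^ a / a))//.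
- by rewrite powR1 -EFinB -mulrBl.
- apply: continuous_in_subspaceT => x; rewrite inE/= in_itv/= => /andP[ex _].
  apply: differentiable_continuous; apply/derivable1_diffP/derivable_powR.
  by rewrite in_itv/= andbT (lt_le_trans e0).
- have cP x : 0 < x -> {for x, continuous (fun x : R => x `^ a / a)}.
    move=> x0; apply: differentiable_continuous; apply/derivable1_diffP.
    apply: derivableM => //; apply: derivable_powR.
    by rewrite in_itv/= andbT.
  split.
  + move=> x; rewrite in_itv/= => /andP[ex _]; apply: derivableM => //.
    by apply: derivable_powR; rewrite in_itv/= andbT (lt_trans e0).
  + by apply: cvg_at_right_filter; exact: cP.
  + by apply: cvg_at_left_filter; exact: cP.
- move=> x; rewrite in_itv/= => /andP[ex _].
  have xp : x \in `]0, +oo[ by rewrite in_itv/= andbT (lt_trans e0).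
  rewrite derive1E deriveM//; last exact: derivable_powR.
  rewrite derive_cst scaler0 add0r -derive1E powR_derive1//.
  by rewrite /GRing.scale/= mulrA mulVf ?gt_eqF// mul1r.
Qed.

End gamma.

(** * The Gamma and Beta integrals *)

Section gamma.
Context (R : realType).
Notation mu := (@lebesgue_measure R).
Local Notation Ipos := (`]0%R, +oo[%classic).

Lemma integral_powR01_le (a : R) : 0 < a ->
  (\int[mu]_(x in `]0%R, 1%R]) (x `^ (a - 1))%:E <= (a^-1)%:E)%E.
Proof.
move=> a0; pose F n := `[n.+2%:R^-1 : R, 1]%classic.
have FU : \bigcup_n F n = `]0, 1]%classic.
  apply/seteqP; split=> [x [n _]|x] /=; rewrite /F/= !in_itv/=.
    by move=> /andP[nx ->]; rewrite (lt_le_trans _ nx).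
  move=> /andP[x0 x1]; exists (Num.trunc x^-1) => //=; rewrite in_itv/= x1 andbT.
  rewrite -[leRHS]invrK lef_pV2 ?posrE ?invr_gt0//.
  rewrite ltW//; apply: lt_trans (truncnS_gt _) _; by rewrite ltr_nat.
have ndF : nondecreasing_seq F.
  apply/nondecreasing_seqP => n; rewrite subsetEset /F => x /=; rewrite !in_itv/=.
  move=> /andP[nx ->]; rewrite andbT; apply: le_trans nx.
  by rewrite lef_pV2 ?posrE// ler_nat.
have mF n : measurable (F n) by exact: measurable_itv.
have mf n : measurable_fun (F n) (fun x => (x `^ (a - 1))%:E).
  by apply: measurable_funTS; meas.
have f0 n x : F n x -> (0 <= (x `^ (a - 1))%:E)%E by rewrite lee_fin powR_ge0.
have cvgF : (\int[mu]_(x in F i) (x `^ (a - 1))%:E @[i --> \oo] -->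
    \int[mu]_(x in `]0%R, 1%R]) (x `^ (a - 1))%:E)%E.
  by rewrite -FU; exact: ge0_nondecreasing_set_cvg_integral.
rewrite -(cvg_lim _ cvgF)//.
apply: lime_le.
  apply: ereal_nondecreasing_is_cvgn.
  exact: ge0_nondecreasing_set_nondecreasing_integral.
apply: nearW => n; rewrite /F integral_powR01//.
  rewrite lee_fin -[leRHS]mul1r ler_pM2r ?invr_gt0// lerBlDr lerDl powR_ge0//.
by rewrite invr_gt0 ltr0n/= invf_lt1// ltr1n.
Qed.

Lemma gamma_integrand_ge0 (a x : R) : 0 <= x `^ (a - 1) * expR (- x).
Proof. by rewrite mulr_ge0 ?powR_ge0 ?expR_ge0. Qed.

Lemma gamma_integral_lty (a : R) : 0 < a ->
  (\int[mu]_(x in Ipos) (x `^ (a - 1) * expR (- x))%:E < +oo)%E.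
Proof.
move=> a0; have [M M0 MP] := @powR_expR_bounded R a (2^-1) (ltW a0) ltac:(by []).
pose f1 := (fun x : R => (x `^ (a - 1))%:E) \_ `]0, 1].
pose f2 := fun x : R => (M * expR (- (2^-1 * x)))%:E.
have f10 x : (0 <= f1 x)%E by apply: erestrict_ge0 => ? _; rewrite lee_fin powR_ge0.
have f20 x : (0 <= f2 x)%E by rewrite lee_fin mulr_ge0 ?expR_ge0 ?ltW.
have mf1 : measurable_fun setT f1.
  by apply/(measurable_restrictT _ (measurable_itv _)); apply: measurable_funTS; meas.
have mf2 : measurable_fun setT f2 by rewrite /f2; meas.
apply: (@le_lt_trans _ _ (\int[mu]_(x in Ipos) (f1 x + f2 x))%E).
  apply: le_integral_any => x; first by rewrite lee_fin gamma_integrand_ge0.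
  rewrite /= in_itv/= andbT => x0; rewrite /f1 patchE; case: ifPn => [x01|].
    rewrite -[leLHS]adde0 leeD// lee_fin -[leRHS]mulr1 ler_wpM2l ?powR_ge0//.
    by rewrite -expR0 ler_expR oppr_le0 ltW.
  rewrite notin_setE/= in_itv/= x0/= => /negP; rewrite -ltNge => x1.
  rewrite add0e lee_fin (@le_trans _ _ (x `^ a * expR (- x)))//.
    by rewrite ler_wpM2r ?expR_ge0// ler_powR ?ltW// ltrBlDr ltrDl.
  have -> : expR (- x) = expR (- (2^-1 * x)) * expR (- (2^-1 * x)).
    by rewrite -expRD; congr expR; field.
  by rewrite mulrA ler_wpM2r ?expR_ge0// MP.
rewrite ge0_integralD//; [|exact: measurable_funTS..].
apply: lte_add_pinfty.
  rewrite -integral_mkcondr setIidr.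
    by apply: le_lt_trans (integral_powR01_le a0) _; rewrite ltry.
  by move=> x /=; rewrite !in_itv/= andbT => /andP[].
rewrite /f2; under eq_integral do rewrite EFinM.
rewrite ge0_integralZl_EFin ?integral_expR -?EFinM ?ltry ?ltW//.
by apply: measurable_funTS; meas.
Qed.

Lemma GammaE (a : R) : 0 < a ->
  (\int[mu]_(x in Ipos) (x `^ (a - 1) * expR (- x))%:E = (Gamma a)%:E)%E.
Proof.
move=> a0; rewrite /Gamma /Rintegral fineK// ge0_fin_numE ?gamma_integral_lty//.
by apply: integral_ge0 => x _; rewrite lee_fin gamma_integrand_ge0.
Qed.

Lemma Gamma_gt0 (a : R) : 0 < a -> 0 < Gamma a.
Proof.
move=> a0; rewrite -lte_fin -GammaE//; apply: integral_gt0 => //.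
- by apply: measurable_funTS; meas.
- by move=> x /=; rewrite in_itv/= andbT => x0; rewrite lte_fin mulr_gt0 ?powR_gt0 ?expR_gt0.
- exact: lebesgue_pos_itvoy.
Qed.

Lemma integral_powR_expR (a c : R) : 0 < a -> 0 < c ->
  (\int[mu]_(x in Ipos) (x `^ (a - 1) * expR (- (c * x)))%:E =
   (Gamma a * c `^ (- a))%:E)%E.
Proof.
move=> a0 c0.
pose f x : \bar R := (c `^ (1 - a) * (x `^ (a - 1) * expR (- x)))%:E.
transitivity (\int[mu]_(x in Ipos) f (c * x)%R)%E.
  apply: eq_integral => x; rewrite inE/= in_itv/= andbT => x0; rewrite /f; congr EFin.
  rewrite mulrA powRM ?ltW// mulrA -powRDp//.
  by rewrite addrA subrK subrr powRr0 mul1r.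
have c10 : 0 <= c `^ (1 - a) by rewrite powR_ge0.
rewrite (@ge0_integral_scale _ c f)//; last first.
- by move=> x; rewrite lee_fin mulr_ge0 ?gamma_integrand_ge0.
- by rewrite /f; meas.
rewrite /f; under eq_integral do rewrite EFinM.
rewrite ge0_integralZl_EFin//; last first.
- by apply: measurable_funTS; meas.
- by move=> x _; rewrite lee_fin gamma_integrand_ge0.
rewrite GammaE// -!EFinM mulrA mulrC; congr (_ * _)%:E.
rewrite -{1}(powR_inv1 (ltW c0)) -powRDp//.
by congr powR; ring.
Qed.

(** Writing [(1 + x)^-(s + d)] as a Gamma integral and exchanging the order of
    integration leaves a product of two Gamma integrals. *)
Lemma integral_beta (s d : R) : 0 < s -> 0 < d ->
  (\int[mu]_(x in Ipos) (x `^ (s - 1) * (1 + x) `^ (- (s + d)))%:E =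
   (Gamma s * Gamma d / Gamma (s + d))%:E)%E.
Proof.
move=> s0 d0; have sd0 : 0 < s + d by rewrite addr_gt0.
have G0 := Gamma_gt0 sd0.
pose K (x k : R) := ((x `^ (s - 1) * expR (- (k * x))) * (k `^ (s + d - 1) * expR (- k)))%:E.
have K0 x k : (0 <= K x k)%E.
  by rewrite lee_fin mulr_ge0 ?gamma_integrand_ge0// mulr_ge0 ?powR_ge0 ?expR_ge0.
have mK : measurable_fun setT (fun z : measurableTypeR R * measurableTypeR R => K z.1 z.2) by rewrite /K; meas.
have mKx x : measurable_fun setT (K x) by rewrite /K; meas.
have mKk k : measurable_fun setT (K^~ k) by rewrite /K; meas.
have h1 : (\int[mu]_(x in Ipos) \int[mu]_(k in Ipos) K x k =
  (Gamma (s + d))%:E * \int[mu]_(x in Ipos) (x `^ (s - 1) * (1 + x) `^ (- (s + d)))%:E)%E.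
  rewrite -ge0_integralZl_EFin ?(ltW G0)//; first last.
  - by apply: measurable_funTS; meas.
  - by move=> x _; rewrite lee_fin mulr_ge0 ?powR_ge0.
  apply: eq_integral => x; rewrite inE/= in_itv/= andbT => x0.
  rewrite -EFinM mulrCA mulrC EFinM -integral_powR_expR ?addr_gt0//.
  rewrite muleC -ge0_integralZl_EFin ?powR_ge0//; first last.
  - by apply: measurable_funTS; meas.
  - by move=> k _; rewrite lee_fin mulr_ge0 ?powR_ge0 ?expR_ge0.
  apply: eq_integral => k _; rewrite /K -EFinM -!mulrA; congr (_ * _)%:E.
  by rewrite mulrCA -expRD; congr (_ * expR _); ring.
have h2 : (\int[mu]_(x in Ipos) \int[mu]_(k in Ipos) K x k =
   (Gamma s * Gamma d)%:E)%E.
  rewrite (tonelli_in _ _ _ _ mK)// EFinM -(GammaE d0).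
  rewrite -ge0_integralZl_EFin ?(ltW (Gamma_gt0 s0))//; first last.
  - by apply: measurable_funTS; meas.
  - by move=> k _; rewrite lee_fin gamma_integrand_ge0.
  apply: eq_integral => k; rewrite inE/= in_itv/= andbT => k0.
  rewrite /K; under eq_integral do rewrite mulrC EFinM.
  rewrite ge0_integralZl_EFin//; first last.
  - by rewrite mulr_ge0 ?powR_ge0 ?expR_ge0.
  - by apply: measurable_funTS; meas.
  - by move=> x _; rewrite lee_fin mulr_ge0 ?powR_ge0 ?expR_ge0.
  rewrite integral_powR_expR// -!EFinM mulrCA; congr (_ * _)%:E.
  rewrite mulrAC -powRDp//; congr (_ `^ _ * _); ring.
move: h2; rewrite h1 => /(congr1 (fun z => (Gamma (s + d))^-1%:E * z)%E).
rewrite muleA -EFinM mulVf ?gt_eqF// mul1e => ->.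
by rewrite -EFinM mulrC.
Qed.

End gamma.

Local Opaque Gamma.

(** * Convex functions whose minimum is at the left end *)

Section convex_values.
Context (R : realType) (b : R) (phi : R -> R).
Hypothesis b0 : 0 < b.
Hypothesis cvx : forall t x y, 0 <= t <= 1 -> 0 <= x < b -> 0 <= y < b ->
  phi (t * x + (1 - t) * y) <= t * phi x + (1 - t) * phi y.
Hypothesis min0 : forall x, 0 <= x < b -> phi 0 <= phi x.

(** Between its values at 0 and at [y], a convex function lies below the
    chord, and the left end of the chord is not above its right end. *)
Lemma convex_min_nondecreasing x y : 0 <= x -> x <= y -> y < b -> phi x <= phi y.
Proof.
move=> x0 xy yb; have [<-//|xyn] := eqVneq x y.
have y0 : 0 < y by rewrite (le_lt_trans x0)// lt_neqAle xyn.
have yi : 0 <= y < b by rewrite ltW.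
have t01 : 0 <= 1 - x / y <= 1.
  by rewrite subr_ge0 ler_pdivrMr// mul1r xy/= lerBlDr lerDl divr_ge0// ltW.
have := cvx t01 _ yi (x := 0); rewrite lexx b0 => /(_ isT).
rewrite mulr0 add0r opprB addrCA subrr addr0 divfK ?gt_eqF// => /le_trans; apply.
have : (1 - x / y) * phi 0 <= (1 - x / y) * phi y.
  by rewrite ler_wpM2l ?min0//; case/andP: t01.
by move: (x / y) => z; lra.
Qed.

Lemma convex_min_increasing x y : 0 <= x -> x < y -> y < b -> phi 0 < phi y ->
  phi x < phi y.
Proof.
move=> x0 xy yb py.
have y0 : 0 < y by rewrite (le_lt_trans x0).
have yi : 0 <= y < b by rewrite ltW.
have t0 : 0 < 1 - x / y by rewrite subr_gt0 ltr_pdivrMr// mul1r.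
have t01 : 0 <= 1 - x / y <= 1.
  by rewrite ltW//= lerBlDr lerDl divr_ge0// ltW.
have := cvx t01 _ yi (x := 0); rewrite lexx b0 => /(_ isT).
rewrite mulr0 add0r opprB addrCA subrr addr0 divfK ?gt_eqF// => /le_lt_trans; apply.
have : (1 - x / y) * phi 0 < (1 - x / y) * phi y by rewrite ltr_pM2l.
by move: (x / y) => z; lra.
Qed.

(** An intermediate value theorem: convexity rules out both ways a monotone
    function can jump over the value [k]. *)
Lemma convex_min_surj k : phi 0 <= k -> (exists2 y, 0 <= y < b & k < phi y) ->
  exists2 x, 0 <= x < b & phi x = k.
Proof.
move=> k0 [y1 /andP[y10 y1b] ky1].
pose S := [set x | 0 <= x <= y1 /\ phi x <= k].
have S0 : S 0 by split; rewrite ?lexx.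
have ubS : ubound S y1 by move=> x [/andP[]].
have supS : has_sup S by split; [exists 0|exists y1].
have xs0 : 0 <= sup S by apply: sup_upper_bound.
have xsy : sup S <= y1 by apply: ge_sup => //; exists 0.
have xsi : 0 <= sup S < b by rewrite xs0 (le_lt_trans xsy).
have y1i : 0 <= y1 < b by rewrite y10.
exists (sup S) => //; apply/eqP; rewrite eq_le !leNgt; apply/andP; split; apply/negP => h.
- have xsp : 0 < sup S.
    rewrite lt_neqAle xs0 andbT; apply/eqP => e; move: h; rewrite -e; lra.
  have Sx x : 0 <= x -> x < sup S -> phi x <= k.
    move=> x0 /(sup_gt (ex_intro _ _ S0)) [z [/andP[z0 zy] zk] xz].
    by apply: le_trans zk; apply: convex_min_nondecreasing => //; [exact: ltW|lra].
  have [y2 y12 y2b] : exists2 y2, y1 < y2 & y2 < b by exists ((y1 + b) / 2); lra.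
  have y2p : 0 < y2 by lra.
  have ky2 : k < phi y2.
    by apply: lt_le_trans ky1 _; apply: convex_min_nondecreasing => //; exact: ltW.
  have y2i : 0 <= y2 < b by lra.
  pose t := Num.min (2^-1) (Num.min (sup S / (2 * y2)) ((phi (sup S) - k) / (2 * (phi y2 - k)))).
  have t0 : 0 < t by rewrite !lt_min invr_gt0 ltr0n/= !divr_gt0//; lra.
  have t2 : t <= 2^-1 by rewrite ge_min lexx.
  have ty : t * y2 < sup S.
    apply: (@le_lt_trans _ _ (sup S / (2 * y2) * y2)).
      by rewrite ler_pM2r// !ge_min lexx orbT.
    by rewrite invfM mulrA divfK ?gt_eqF//; lra.
  have tk : t * (phi y2 - k) < phi (sup S) - k.
    have yk : 0 < phi y2 - k by lra.
    apply: (@le_lt_trans _ _ ((phi (sup S) - k) / (2 * (phi y2 - k)) * (phi y2 - k))).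
      by rewrite ler_pM2r// !ge_min lexx !orbT.
    by rewrite invfM mulrA divfK ?gt_eqF//; lra.
  have t1 : 0 < 1 - t by lra.
  (* [sup S] is the barycentre of [y2] and [x] with weights [t] and [1 - t]. *)
  pose x := (sup S - t * y2) / (1 - t).
  have x0 : 0 <= x by rewrite divr_ge0 ?ltW//; lra.
  have xE : (1 - t) * x = sup S - t * y2 by rewrite /x mulrC divfK ?gt_eqF.
  have xlt : x < sup S.
    rewrite -(ltr_pM2l t1) xE; have : t * sup S < t * y2 by rewrite ltr_pM2l//; lra.
    lra.
  have t01 : 0 <= t <= 1 by lra.
  have xi : 0 <= x < b by lra.
  have := cvx t01 y2i xi; rewrite xE addrC subrK.
  have := Sx _ x0 xlt; rewrite -(ler_pM2l t1); lra.
- have syn : sup S < y1.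
    by rewrite lt_neqAle xsy andbT; apply/eqP => e; move: h; rewrite e; lra.
  have yk : 0 < phi y1 - phi (sup S) by lra.
  pose t := (k - phi (sup S)) / (phi y1 - phi (sup S)).
  have t0 : 0 < t by rewrite divr_gt0//; lra.
  have t1 : t < 1 by rewrite ltr_pdivrMr// mul1r; lra.
  have tE : t * (phi y1 - phi (sup S)) = k - phi (sup S) by rewrite divfK ?gt_eqF.
  have t01 : 0 <= t <= 1 by lra.
  have := cvx t01 y1i xsi => px.
  have : S (t * y1 + (1 - t) * sup S).
    split; last by nra.
    by apply/andP; split; nra.
  by move=> /(sup_upper_bound supS); nra.
Qed.
End convex_values.

(** * Monotonicity and surjectivity of Upsilon *)

Lemma expR_convex (R : realType) (t x y : R) : 0 <= t <= 1 ->
  expR (t * x + (1 - t) * y) <= t * expR x + (1 - t) * expR y.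
Proof.
move=> /andP[t0 t1].
by have := convex_expR (Itv01 t0 t1) x y; rewrite !convRE.
Qed.

(** The weighted arithmetic-geometric inequality, normalised so that it
    becomes an equality at [A = a], [B = b]; integrating it then loses nothing,
    which is how Hoelder's inequality is proved. *)
Lemma weighted_expR_le (R : realType) (t A B a b : R) : 0 <= t <= 1 ->
  expR (t * A + (1 - t) * B) <=
  expR (t * a + (1 - t) * b) * t / expR a * expR A +
  expR (t * a + (1 - t) * b) * (1 - t) / expR b * expR B.
Proof.
move=> t01; set C := t * a + _.
have -> : t * A + (1 - t) * B = C + (t * (A - a) + (1 - t) * (B - b)) by rewrite /C; ring.
rewrite expRD -!mulrA -mulrDr ler_pM2l ?expR_gt0//.
apply: le_trans (expR_convex _ _ t01) _.
by rewrite !expRD !expRN ![expR _ * (expR _)^-1]mulrC.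
Qed.

Section beta_function.
Context (R : realType) (s : R).
Hypothesis s0 : 0 < s.
Notation mu := (@lebesgue_measure R).
Local Notation Ipos := (`]0%R, +oo[%classic).

(** The Beta function B(s, x), as a function of its second argument. *)
Definition beta_quot (x : R) : R := Gamma s * Gamma x / Gamma (s + x).

Let k (x rho : R) : R := rho `^ (s - 1) * (1 + rho) `^ (- (s + x)).

Let k_ge0 x rho : 0 <= k x rho.
Proof. by rewrite mulr_ge0 ?powR_ge0. Qed.

Let mk x : measurable_fun setT (fun rho : measurableTypeR R => (k x rho)%:E).
Proof. by rewrite /k; meas. Qed.

Let beta_quotE x : 0 < x -> (\int[mu]_(rho in Ipos) (k x rho)%:E = (beta_quot x)%:E)%E.
Proof. by move=> x0; rewrite /k integral_beta. Qed.

Lemma beta_quot_gt0 x : 0 < x -> 0 < beta_quot x.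
Proof. by move=> x0; rewrite divr_gt0 ?mulr_gt0 ?Gamma_gt0 ?addr_gt0. Qed.

Lemma beta_quot_nonincreasing x y : 0 < x -> x <= y -> beta_quot y <= beta_quot x.
Proof.
move=> x0 xy; have y0 := lt_le_trans x0 xy.
suff : (\int[mu]_(rho in Ipos) (k y rho)%:E <= \int[mu]_(rho in Ipos) (k x rho)%:E)%E.
  by rewrite (beta_quotE y0) (beta_quotE x0) lee_fin.
apply: le_integral_any => rho; first by rewrite lee_fin.
rewrite /= in_itv/= andbT => r0; rewrite lee_fin ler_wpM2l ?powR_ge0//.
by rewrite ler_powR ?lerN2 ?lerD2l//; lra.
Qed.

(** Log-convexity: the integrand is log-linear in [x], and the weighted
    arithmetic-geometric inequality is integrated after normalisation. *)
Lemma ln_beta_quot_convex t x y : 0 <= t <= 1 -> 0 < x -> 0 < y ->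
  ln (beta_quot (t * x + (1 - t) * y)) <=
  t * ln (beta_quot x) + (1 - t) * ln (beta_quot y).
Proof.
move=> t01 x0 y0; have /andP[t0 t1] := t01.
have z0 : 0 < t * x + (1 - t) * y.
  have [->|tn] := eqVneq t 0; first by rewrite mul0r add0r subr0 mul1r.
  have : 0 < t * x by rewrite mulr_gt0// lt_neqAle eq_sym tn.
  have : 0 <= (1 - t) * y by rewrite mulr_ge0 ?subr_ge0// ltW.
  lra.
set z := t * x + (1 - t) * y in z0 *.
have [lx Ex] : {l | beta_quot x = expR l}.
  by exists (ln (beta_quot x)); rewrite lnK// posrE beta_quot_gt0.
have [ly Ey] : {l | beta_quot y = expR l}.
  by exists (ln (beta_quot y)); rewrite lnK// posrE beta_quot_gt0.
rewrite Ex Ey !expRK; set C := _ + _.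
rewrite -ler_expR lnK ?posrE ?beta_quot_gt0//.
have kz rho : 0 < rho ->
    k z rho <= expR C * t / expR lx * k x rho + expR C * (1 - t) / expR ly * k y rho.
  move=> r0; have r1 : 0 < 1 + rho by rewrite addr_gt0.
  have kE w : k w rho = expR ((s - 1) * ln rho - (s + w) * ln (1 + rho)).
    by rewrite /k !powR_expln// -expRD mulNr.
  rewrite !kE; apply: le_trans (weighted_expR_le _ _ _ _ t01).
  by rewrite le_eqVlt; apply/orP; left; apply/eqP; congr expR; rewrite /z; ring.
have tC : 0 <= expR C * t / expR lx by rewrite !mulr_ge0 ?expR_ge0 ?invr_ge0.
have tC' : 0 <= expR C * (1 - t) / expR ly.
  by rewrite !mulr_ge0 ?expR_ge0 ?invr_ge0 ?subr_ge0.
have : (\int[mu]_(rho in Ipos) (k z rho)%:E <= \int[mu]_(rho in Ipos)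
   ((expR C * t / expR lx)%:E * (k x rho)%:E +
    (expR C * (1 - t) / expR ly)%:E * (k y rho)%:E))%E.
  apply: le_integral_any => rho; first by rewrite lee_fin.
  by rewrite /= in_itv/= andbT -!EFinM -EFinD lee_fin; exact: kz.
rewrite ge0_integralD//; first last.
- by apply: measurable_funTS; rewrite /k; meas.
- by move=> rho _; rewrite mule_ge0 ?lee_fin.
- by apply: measurable_funTS; rewrite /k; meas.
- by move=> rho _; rewrite mule_ge0 ?lee_fin.
rewrite !ge0_integralZl_EFin//; [|by move=> *; rewrite lee_fin|exact: measurable_funTS
  |by move=> *; rewrite lee_fin|exact: measurable_funTS].
rewrite (beta_quotE z0) (beta_quotE x0) (beta_quotE y0) Ex Ey -!EFinM -EFinD lee_fin.
by rewrite !divfK ?gt_eqF ?expR_gt0// -mulrDr addrC subrK mulr1.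
Qed.

(** Near 0 the Gamma function is at least a multiple of 1/x, while
    [Gamma (s + x)] stays bounded. *)
Lemma beta_quot_unbounded (x0 K : R) : 0 < x0 ->
  exists2 x, 0 < x < x0 & K < beta_quot x.
Proof.
move=> x00.
pose G := Gamma s + Gamma (s + 1).
have s10 : 0 < s + 1 by rewrite addr_gt0.
have G0 : 0 < G by rewrite addr_gt0 ?Gamma_gt0.
have Gs (x : R) : 0 < x -> x <= 1 -> Gamma (s + x) <= G.
  move=> xp x1; have sx0 : 0 < s + x by rewrite addr_gt0.
  suff : (\int[mu]_(r in Ipos) (r `^ (s + x - 1) * expR (- r))%:E <=
      \int[mu]_(r in Ipos) (r `^ (s - 1) * expR (- r))%:E +
      \int[mu]_(r in Ipos) (r `^ (s + 1 - 1) * expR (- r))%:E)%E.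
    by rewrite (GammaE sx0) (GammaE s0) (GammaE s10) -EFinD lee_fin.
  rewrite -ge0_integralD//; first last.
  - by apply: measurable_funTS; meas.
  - by move=> rho _; rewrite lee_fin gamma_integrand_ge0.
  - by apply: measurable_funTS; meas.
  - by move=> rho _; rewrite lee_fin gamma_integrand_ge0.
  apply: le_integral_any => r; first by rewrite lee_fin gamma_integrand_ge0.
  rewrite /= in_itv/= andbT => r0; rewrite -EFinD lee_fin -mulrDl ler_wpM2r ?expR_ge0//.
  have [r1|r1] := leP r 1.
    rewrite ler_wpDr ?powR_ge0// ger_powR ?r0//; lra.
  by rewrite ler_wpDl ?powR_ge0// ler_powR ?(ltW r1)//; lra.
have Gx (x : R) : 0 < x -> expR (- 1) / (2 * x) <= Gamma x.
  move=> xp; rewrite -lee_fin -(GammaE xp).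
  (* Chosen so that [e `^ x] is 1 / 2. *)
  pose e : R := 2^-1 `^ (x^-1).
  have e01 : 0 < e < 1.
    have h2 : 0 < (2^-1 : R) < 1 by lra.
    have x'0 : 0 < x^-1 by rewrite invr_gt0.
    rewrite /e powR_expln ?invr_gt0// expR_gt0 -[ltRHS]expR0 ltr_expR.
    by rewrite pmulr_rlt0// ln_lt0.
  have -> : expR (- 1) / (2 * x) = expR (- 1) * ((1 - e `^ x) / x).
    by rewrite /e -powRrM mulVf ?gt_eqF// powRr1//; field; rewrite gt_eqF.
  rewrite EFinM -integral_powR01// -ge0_integralZl_EFin ?expR_ge0//; first last.
  - by apply: measurable_funTS; meas.
  - by move=> ? _; rewrite lee_fin powR_ge0.
  apply: (@le_trans _ _ (\int[mu]_(r in `[e, 1%R]) (r `^ (x - 1) * expR (- r))%:E)%E).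
    apply: le_integral_any => r.
      by rewrite -EFinM lee_fin mulr_ge0 ?powR_ge0 ?expR_ge0.
    rewrite /= in_itv/= => /andP[_ r1]; rewrite -EFinM lee_fin mulrC.
    by rewrite ler_wpM2l ?powR_ge0// ler_expR lerN2.
  apply: ge0_subset_integral => //.
  - by apply: measurable_funTS; meas.
  - by move=> r _; rewrite lee_fin gamma_integrand_ge0.
  - by move=> r /=; rewrite !in_itv/= andbT => /andP[er _]; case/andP: e01; lra.
pose A := Gamma s * expR (- 1) / (2 * G).
have A0 : 0 < A by rewrite !(divr_gt0, mulr_gt0) ?Gamma_gt0 ?expR_gt0.
pose K1 := Num.max K 1.
have K10 : 0 < K1 by rewrite lt_max ltr01 orbT.
pose x := Num.min (x0 / 2) (Num.min 1 (A / (2 * K1))).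
have xp : 0 < x.
  have h1 : 0 < x0 / 2 by rewrite divr_gt0.
  have h2 : 0 < A / (2 * K1) by rewrite divr_gt0// mulr_gt0.
  by rewrite /x !lt_min h1 h2 ltr01.
have x1 : x <= 1 by rewrite !ge_min lexx /= orbT.
have xA : x <= A / (2 * K1) by rewrite !ge_min lexx !orbT.
exists x.
  rewrite xp/=; have : x <= x0 / 2 by rewrite !ge_min lexx.
  lra.
apply: (@le_lt_trans _ _ K1); first by rewrite le_max lexx.
apply: (@lt_le_trans _ _ (A / x)).
  rewrite ltr_pdivlMr//; move: xA; rewrite ler_pdivlMr ?mulr_gt0//; nra.
have -> : A / x = Gamma s * (expR (-1) / (2 * x)) / G.
  by rewrite /A; field; rewrite !gt_eqF.
have sx0 : 0 < s + x by rewrite addr_gt0.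
have Gsx := Gamma_gt0 sx0.
apply: (@le_trans _ _ (Gamma s * Gamma x / G)).
  apply: ler_wpM2r; first by rewrite invr_ge0 ltW.
  by apply: ler_wpM2l; [exact: ltW (Gamma_gt0 s0)|exact: Gx].
rewrite /beta_quot ler_pM2l ?mulr_gt0 ?Gamma_gt0//.
by rewrite lef_pV2 ?posrE// Gs.
Qed.

End beta_function.

(** The arguments in the numerator are [s + y] and [s + x], so the quotient
    groups into two inverse Beta functions. *)
Lemma upsilon_quotient (R : realFieldType) (G : R -> R) (c n s al : R) :
  let x := (n - 2 * s - 2 * al) / 4 in let y := (n - 2 * s + 2 * al) / 4 in
  G s != 0 -> G x != 0 -> G y != 0 -> G (s + x) != 0 -> G (s + y) != 0 ->
  c * ((G ((n + 2 * s + 2 * al) / 4) * G ((n + 2 * s - 2 * al) / 4)) / (G x * G y)) =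
  c * G s ^+ 2 * ((G s * G x / G (s + x))^-1 * (G s * G y / G (s + y))^-1).
Proof.
move=> x y.
have -> : (n + 2 * s + 2 * al) / 4 = s + y by rewrite /y; field.
have -> : (n + 2 * s - 2 * al) / 4 = s + x by rewrite /x; field.
move: (G s) (G x) (G y) (G (s + x)) (G (s + y)) => g1 g2 g3 g4 g5 h1 h2 h3 h4 h5.
by field; rewrite h1 h2 h3 h4 h5.
Qed.

Section symmetric_sum.
Context (R : realType) (c : R) (l : R -> R).
Hypothesis l_convex : forall t x y, 0 <= t <= 1 -> 0 < x -> 0 < y ->
  l (t * x + (1 - t) * y) <= t * l x + (1 - t) * l y.

(** The form of [- ln Upsilon] up to a constant, [l] being the logarithm of
    the Beta function. *)
Definition symmetric_sum (al : R) : R := l (c - al / 2) + l (c + al / 2).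

Lemma symmetric_sum_convex t x y : 0 <= t <= 1 -> 0 <= x < 2 * c -> 0 <= y < 2 * c ->
  symmetric_sum (t * x + (1 - t) * y) <= t * symmetric_sum x + (1 - t) * symmetric_sum y.
Proof.
move=> t01 xi yi; rewrite /symmetric_sum.
have x1 : 0 < c - x / 2 by lra.
have x2 : 0 < c + x / 2 by lra.
have y1 : 0 < c - y / 2 by lra.
have y2 : 0 < c + y / 2 by lra.
have := l_convex t01 x1 y1; have := l_convex t01 x2 y2.
have -> : t * (c - x / 2) + (1 - t) * (c - y / 2) = c - (t * x + (1 - t) * y) / 2 by field.
have -> : t * (c + x / 2) + (1 - t) * (c + y / 2) = c + (t * x + (1 - t) * y) / 2 by field.
lra.
Qed.

Lemma symmetric_sum_min0 x : 0 <= x < 2 * c -> symmetric_sum 0 <= symmetric_sum x.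
Proof.
move=> xi; rewrite /symmetric_sum mul0r subr0 addr0.
have x1 : 0 < c - x / 2 by lra.
have x2 : 0 < c + x / 2 by lra.
have t01 : 0 <= (2^-1 : R) <= 1 by lra.
have := l_convex t01 x1 x2.
have -> : 2^-1 * (c - x / 2) + (1 - 2^-1) * (c + x / 2) = c by field.
lra.
Qed.
End symmetric_sum.

Section upsilon.
Context (R : realType) (N : nat) (s : R).
Hypotheses (s0 : 0 < s) (Ns : 2 * s < N%:R).

Let c : R := (N%:R - 2 * s) / 4.
Let l (x : R) : R := ln (beta_quot s x).
Let phi := symmetric_sum c l.
Let K : R := 2 `^ (2 * s) * Gamma s ^+ 2.

Let c0 : 0 < c. Proof. by rewrite divr_gt0// subr_gt0. Qed.
Let b0 : 0 < 2 * c. Proof. by rewrite mulr_gt0. Qed.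
Let K0 : 0 < K. Proof. by rewrite mulr_gt0 ?powR_gt0 ?exprn_gt0 ?Gamma_gt0. Qed.
Let bE : (N%:R - 2 * s) / 2 = 2 * c. Proof. by rewrite /c; field. Qed.

Let l_convex t x y : 0 <= t <= 1 -> 0 < x -> 0 < y ->
  l (t * x + (1 - t) * y) <= t * l x + (1 - t) * l y.
Proof. exact: ln_beta_quot_convex. Qed.

Let xpos al : 0 <= al < 2 * c -> 0 < c - al / 2. Proof. by move=> ?; lra. Qed.
Let ypos al : 0 <= al < 2 * c -> 0 < c + al / 2. Proof. by have := c0; move=> ? ?; lra. Qed.

Lemma Upsilon0 : Upsilon N s 0 = hardy_const N s.
Proof. by rewrite /Upsilon /hardy_const !mulr0 !addr0 !subr0 !expr2. Qed.

Let expNl x : 0 < x -> expR (- l x) = (beta_quot s x)^-1.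
Proof. by move=> x0; rewrite expRN lnK// posrE beta_quot_gt0. Qed.

Let UpsilonE al : 0 <= al < 2 * c -> Upsilon N s al = K * expR (- phi al).
Proof.
move=> ali; have x0 := xpos ali; have y0 := ypos ali.
have nz (z : R) : 0 < z -> Gamma z != 0 by move=> /Gamma_gt0/lt0r_neq0.
pose X := (N%:R - 2 * s - 2 * al) / 4; pose Y := (N%:R - 2 * s + 2 * al) / 4.
have XE : X = c - al / 2 by rewrite /X /c; field.
have YE : Y = c + al / 2 by rewrite /Y /c; field.
have X0 : 0 < X by rewrite XE.
have Y0 : 0 < Y by rewrite YE.
have h : Upsilon N s al = K * ((beta_quot s X)^-1 * (beta_quot s Y)^-1).
  exact: (@upsilon_quotient R (@Gamma R) (2 `^ (2 * s)) N%:R s al (nz _ s0) (nz _ X0) (nz _ Y0)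
    (nz _ (addr_gt0 s0 X0)) (nz _ (addr_gt0 s0 Y0))).
rewrite h -(expNl X0) -(expNl Y0) XE YE.
by rewrite -expRD -opprD.
Qed.

Let ltK u v : (K * expR (- u) < K * expR (- v)) = (v < u).
Proof. by rewrite (ltr_pM2l K0) ltr_expR ltrN2. Qed.

Let Ult u v : 0 <= u < 2 * c -> 0 <= v < 2 * c ->
  (Upsilon N s u < Upsilon N s v) = (phi v < phi u).
Proof. by move=> hu hv; rewrite (UpsilonE hu) (UpsilonE hv); exact: ltK. Qed.

Local Opaque Upsilon hardy_const.

Lemma Upsilon_nonincreasing (x y : R) : 0 <= x -> x <= y -> y < (N%:R - 2 * s) / 2 ->
  Upsilon N s y <= Upsilon N s x.
Proof.
rewrite bE => x0 xy yb.
have xi : 0 <= x < 2 * c by rewrite x0 (le_lt_trans xy).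
have yi : 0 <= y < 2 * c by rewrite (le_trans x0).
rewrite (UpsilonE xi) (UpsilonE yi) (ler_pM2l K0) ler_expR lerN2.
exact: (convex_min_nondecreasing b0 (symmetric_sum_convex l_convex)
  (symmetric_sum_min0 l_convex)).
Qed.

Lemma Upsilon_decreasing (x y : R) : 0 <= x -> x < y -> y < (N%:R - 2 * s) / 2 ->
  Upsilon N s y < hardy_const N s -> Upsilon N s y < Upsilon N s x.
Proof.
rewrite bE -Upsilon0 => x0 xy yb.
have xi : 0 <= x < 2 * c by rewrite x0 (lt_trans xy).
have yi : 0 <= y < 2 * c by rewrite (le_trans x0 (ltW xy)).
have oi : 0 <= (0 : R) < 2 * c by rewrite lexx.
rewrite (Ult yi oi) => h; rewrite (Ult yi xi); move: h.
exact: (convex_min_increasing b0 (symmetric_sum_convex l_convex)).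
Qed.

Lemma Upsilon_surj (lambda : R) : 0 < lambda < hardy_const N s ->
  exists2 al, 0 <= al < (N%:R - 2 * s) / 2 & Upsilon N s al = lambda.
Proof.
have oi : 0 <= (0 : R) < 2 * c by rewrite lexx.
rewrite -Upsilon0 (UpsilonE oi) bE => /andP[l0 lL].
have lK : 0 < lambda / K by exact: divr_gt0 l0 K0.
have k0 : phi 0 <= - ln (lambda / K).
  rewrite lerNr -ler_expR (lnK (lK : lambda / K \in Num.pos)).
  by rewrite (ler_pdivrMr _ _ K0) mulrC; exact: ltW lL.
have [|al ali pal] := convex_min_surj b0 (symmetric_sum_convex l_convex)
    (symmetric_sum_min0 l_convex) k0; last first.
  exists al => //; rewrite (UpsilonE ali) /phi pal opprK.
  by rewrite (lnK (lK : lambda / K \in Num.pos)) mulrC divfK// (lt0r_neq0 K0).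
(* [phi] is unbounded at the right end: there the first Beta value blows up,
   while the second one stays above its value at [2 * c]. *)
pose B0 := l (2 * c).
have [x /andP[xp xc] xK] := beta_quot_unbounded s0 (expR (- ln (lambda / K) - B0)) c0.
pose al := 2 * (c - x).
have ali : 0 <= al < 2 * c by rewrite /al; lra.
exists al => //; rewrite /symmetric_sum.
have -> : c - al / 2 = x by rewrite /al; field.
have y0 := ypos ali.
have yB : B0 <= l (c + al / 2).
  rewrite /B0 /l ler_ln ?posrE ?beta_quot_gt0//.
  by apply: beta_quot_nonincreasing => //; move: ali; lra.
have : - ln (lambda / K) - B0 < l x.
  by rewrite -ltr_expR /l (lnK (_ : beta_quot s x \in Num.pos))// posrE beta_quot_gt0.
by move: (l x) (l _) yB => *; lra.
Qed.

End upsilon.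

(** * Gaussians on the Euclidean space *)

Section gaussian.
Context (R : realType).
Notation mu := (@lebesgue_measure R).

(** Completing the square turns the integrand into a multiple of a normal
    density. *)
Lemma gaussian_convolution1 (a b x : R) : 0 < a -> 0 < b ->
  (\int[mu]_y (expR (- (a * y ^+ 2)) * expR (- (b * (x - y) ^+ 2)))%:E =
   ((pi / (a + b)) `^ (2^-1) * expR (- (a * b / (a + b) * x ^+ 2)))%:E)%E.
Proof.
move=> a0 b0; have ab : 0 < a + b by lra.
have pab : 0 < pi / (a + b) by rewrite divr_gt0 ?pi_gt0.
pose sg : R := Num.sqrt ((2 * (a + b))^-1).
have sg2 : sg ^+ 2 = (2 * (a + b))^-1 by rewrite sqr_sqrtr// invr_ge0; lra.
have sg0 : sg != 0 by rewrite gt_eqF// sqrtr_gt0 invr_gt0; lra.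
pose m := b * x / (a + b).
pose C := (pi / (a + b)) `^ (2^-1) * expR (- (a * b / (a + b) * x ^+ 2)).
have C0 : 0 <= C by rewrite mulr_ge0 ?powR_ge0 ?expR_ge0.
transitivity (\int[mu]_y (C%:E * (normal_pdf m sg y)%:E))%E.
  apply: eq_integral => y _; rewrite -EFinM normal_pdfE//; congr EFin.
  rewrite /normal_peak /normal_fun sg2 /C.
  have -> : ((2 * (a + b))^-1 * pi *+ 2) = pi / (a + b) by rewrite -mulr_natr; field; rewrite gt_eqF.
  rewrite powR12_sqrt ?(ltW pab)// mulrACA divff ?gt_eqF ?sqrtr_gt0// mul1r.
  rewrite -!expRD; congr expR; rewrite /m -mulr_natr; field.
  by rewrite gt_eqF.
rewrite ge0_integralZl_EFin ?integral_normal_pdf ?mule1//.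
- by move=> y _; rewrite lee_fin normal_pdf_ge0.
- by apply/measurable_EFinP; exact: measurable_normal_pdf.
Qed.

Lemma integral_tuple_lebesgueS n (F : euclid R n.+1 -> \bar R) :
  measurable_fun setT F -> (forall v, 0 <= F v)%E ->
  (\int[tuple_lebesgue n.+1]_v F v =
   \int[mu]_a \int[tuple_lebesgue n]_w F (tuple_cons (a, w)))%E.
Proof.
move=> mF F0.
transitivity (\int[mu \x tuple_lebesgue n]_(z in (@tuple_cons R n) @^-1` setT)
    (F \o @tuple_cons R n) z)%E.
  rewrite -ge0_integral_pushforward//; last exact: measurable_tuple_cons.
rewrite preimage_setT fubini_tonelli1//.
- apply: measurableT_comp => //; exact: measurable_tuple_cons.
- by move=> z; exact: F0.
Qed.

Lemma enorm_sqr n (x : euclid R n) : enorm x ^+ 2 = \sum_(i < n) (tnth x i : R) ^+ 2.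
Proof. by rewrite sqr_sqrtr// sumr_ge0// => i _; rewrite sqr_ge0. Qed.

Lemma enorm_ge0 n (x : euclid R n) : 0 <= enorm x.
Proof. exact: sqrtr_ge0. Qed.

Lemma enorm_cons n (a : R) (w : euclid R n) :
  enorm (tuple_cons (a, w)) ^+ 2 = a ^+ 2 + enorm w ^+ 2.
Proof.
rewrite !enorm_sqr big_ord_recl; congr (_ + _).
by apply: eq_bigr => i _; rewrite (tnth_nth 0) [in RHS](tnth_nth 0).
Qed.

Lemma tuple_cons_thead n (x : euclid R n.+1) :
  x = tuple_cons (thead x, [tuple of behead x]).
Proof. by rewrite [LHS]tuple_eta; apply: val_inj. Qed.

Lemma esub_cons n (a b : R) (v w : euclid R n) :
  esub (tuple_cons (a, v)) (tuple_cons (b, w)) = tuple_cons ((a - b)%R, esub v w).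
Proof.
apply: eq_from_tnth => i; rewrite tnth_mktuple.
case: (unliftP ord0 i) => [j|] ->; last by [].
by rewrite !tnthS tnth_mktuple.
Qed.

End gaussian.

Section gaussian_n.
Context (R : realType).

Lemma gaussian_convolution n (a b : R) (x : euclid R n) : 0 < a -> 0 < b ->
  (\int[tuple_lebesgue n]_y
     (expR (- (a * enorm y ^+ 2)) * expR (- (b * enorm (esub x y) ^+ 2)))%:E =
   ((pi / (a + b)) `^ (n%:R / 2) * expR (- (a * b / (a + b) * enorm x ^+ 2)))%:E)%E.
Proof.
move=> a0 b0; have ab : 0 < a + b by lra.
have pab : 0 < pi / (a + b) by rewrite divr_gt0 ?pi_gt0.
elim: n x => [|n IH] x.
  rewrite mul0r powRr0 mul1r /= integral_dirac//.
    by rewrite diracT mul1e !enorm_sqr !big_ord0 !mulr0 oppr0 expR0 mul1r.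
  by meas.
rewrite integral_tuple_lebesgueS; last 2 first.
- by meas.
- by move=> v; rewrite lee_fin mulr_ge0 ?expR_ge0.
rewrite [x]tuple_cons_thead; set x0 := thead x; set x' := [tuple of behead x].
pose C := (pi / (a + b)) `^ (n%:R / 2) * expR (- (a * b / (a + b) * enorm x' ^+ 2)).
transitivity (\int[@lebesgue_measure R]_y
   (C%:E * (expR (- (a * y ^+ 2)) * expR (- (b * (x0 - y) ^+ 2)))%:E))%E.
  apply: eq_integral => y _.
  rewrite muleC -IH -ge0_integralZl_EFin//; last by meas.
  apply: eq_integral => w _; rewrite esub_cons !enorm_cons -EFinM; congr EFin.
  by rewrite -!expRD; congr expR; ring.
rewrite ge0_integralZl_EFin//; last 2 first.
- by meas.
- by rewrite mulr_ge0 ?expR_ge0 ?powR_ge0.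
rewrite gaussian_convolution1// -EFinM enorm_cons /C; congr EFin.
rewrite mulrACA -powRDp// -expRD; congr (_ `^ _ * expR _).
  by rewrite -natr1; field.
by ring.
Qed.

End gaussian_n.

(** * The Riesz potential of a power, as an iterated integral *)

Section riesz.
Context (R : realType).
Notation mu := (@lebesgue_measure R).
Local Notation Ipos := (`]0%R, +oo[%classic).

(** With [nu = N / 2] and [r = |x|^2], the factor
    [(1 + 4 h rho)^-nu exp (- h r / (1 + 4 h rho))] is the value at x of the
    heat flow at time [rho] started from the Gaussian exp (- h |x|^2). Integrating
    in [h] against [h^(th + s - 1)] superposes these Gaussians to a power, and
    integrating in [rho] against [rho^(s - 1)] inverts the fractional Laplacian. *)
Definition riesz_kernel (s th nu r h rho : R) : R :=
  h `^ (th + s - 1) *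
  (rho `^ (s - 1) * (1 + 4 * h * rho) `^ (- nu) * expR (- (h * r / (1 + 4 * h * rho)))).

Lemma riesz_kernel_ge0 s th nu r h rho : 0 <= riesz_kernel s th nu r h rho.
Proof. by rewrite !mulr_ge0 ?powR_ge0 ?expR_ge0. Qed.

(** The substitution [u = 4 h rho] separates the variables: the integral
    in [h] becomes a Gamma integral and the one in [u] a Beta integral. *)
Lemma integral_riesz_kernel (s th d r : R) : 0 < s -> 0 < th -> 0 < d -> 0 < r ->
  (\int[mu]_(h in Ipos) \int[mu]_(rho in Ipos) (riesz_kernel s th (th + s + d) r h rho)%:E =
   (4 `^ (- s) * Gamma th * (Gamma s * Gamma d / Gamma (s + d)) * r `^ (- th))%:E)%E.
Proof.
move=> s0 th0 d0 r0.
pose g (h u : R) : R := 4 `^ (- s) *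
  ((u `^ (s - 1) * (1 + u) `^ (- (th + s + d))) * (h `^ (th - 1) * expR (- (r / (1 + u) * h)))).
have g0 h u : 0 <= g h u by rewrite !mulr_ge0 ?powR_ge0 ?expR_ge0.
have mg : measurable_fun setT (fun z : measurableTypeR R * measurableTypeR R => (g z.1 z.2)%:E).
  by rewrite /g; meas.
have step h : 0 < h -> (\int[mu]_(rho in Ipos) (riesz_kernel s th (th + s + d) r h rho)%:E =
    \int[mu]_(u in Ipos) (g h u)%:E)%E.
  move=> h0; have h4 : 0 < 4 * h by lra.
  pose f u : \bar R := (4 * h * g h u)%:E.
  transitivity (\int[mu]_(rho in Ipos) f (4 * h * rho)%R)%E.
    apply: eq_integral => rho; rewrite inE/= in_itv/= andbT => rho0.
    rewrite /f /riesz_kernel /g; congr EFin.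
    have l4 : ln (4 * h * rho) = ln 4 + ln h + ln rho by rewrite !lnM ?posrE ?mulr_gt0.
    have u0 : 0 < 1 + 4 * h * rho by rewrite addr_gt0 ?mulr_gt0.
    have E4 : (4 : R) = expR (ln 4) by rewrite lnK// posrE.
    have Eh : h = expR (ln h) by rewrite lnK// posrE.
    rewrite !powR_expln ?mulr_gt0// [X in _ = X * h * _]E4 [X in _ = _ * X * _]Eh.
    rewrite -!expRD l4; congr expR; field; rewrite gt_eqF//.
  rewrite (@ge0_integral_scale _ _ f)//; last 2 first.
  - by rewrite /f /g; meas.
  - by move=> u; rewrite lee_fin mulr_ge0// ltW.
  rewrite /f; under eq_integral do rewrite EFinM.
  rewrite ge0_integralZl_EFin ?(ltW h4)//; first last.
  - by apply: measurable_funTS; rewrite /g; meas.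
  - by move=> u _; rewrite lee_fin.
  by rewrite muleA -EFinM mulVf ?gt_eqF// mul1e.
transitivity (\int[mu]_(h in Ipos) \int[mu]_(u in Ipos) (g h u)%:E)%E.
  by apply: eq_integral => h; rewrite inE/= in_itv/= andbT => /step.
rewrite (tonelli_in _ _ _ _ mg)//.
pose C := 4 `^ (- s) * Gamma th * r `^ (- th).
have C0 : 0 <= C by rewrite !mulr_ge0 ?powR_ge0 ?(ltW (Gamma_gt0 _)).
transitivity (\int[mu]_(u in Ipos) (C%:E * (u `^ (s - 1) * (1 + u) `^ (- (s + d)))%:E))%E.
  apply: eq_integral => u; rewrite inE/= in_itv/= andbT => u0.
  have u1 : 0 < 1 + u by lra.
  have ru : 0 < r / (1 + u) by rewrite divr_gt0.
  rewrite /g; under eq_integral do rewrite mulrA EFinM.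
  rewrite ge0_integralZl_EFin//; first last.
  - by rewrite !mulr_ge0 ?powR_ge0.
  - by apply: measurable_funTS; meas.
  - by move=> h _; rewrite lee_fin !mulr_ge0 ?powR_ge0 ?expR_ge0.
  rewrite integral_powR_expR// -!EFinM /C; congr EFin.
  have -> : (r / (1 + u)) `^ (- th) = r `^ (- th) * (1 + u) `^ th.
    rewrite !powR_expln// ln_div ?posrE// -expRD; congr expR; ring.
  have -> : (1 + u) `^ (- (s + d)) = (1 + u) `^ (- (th + s + d)) * (1 + u) `^ th.
    by rewrite -powRDp//; congr powR; ring.
  by ring.
rewrite ge0_integralZl_EFin//; first last.
- by apply: measurable_funTS; meas.
- by move=> u _; rewrite lee_fin mulr_ge0 ?powR_ge0.
rewrite (integral_beta s0 d0) -EFinM /C; congr EFin.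
by move: (Gamma th) (Gamma s) (Gamma d) (Gamma (s + d)) => g1 g2 g3 g4; ring.
Qed.

End riesz.

Section substitution.
Context (R : realType).
Notation mu := (@lebesgue_measure R).
Local Notation Ipos := (`]0%R, +oo[%classic).

(** The integrands may be singular at the left end. The closed subintervals are
    handled by the change of variables for continuous functions, and the left
    end is reached by a monotone limit. *)
Lemma substitution_le (t T : R) (F F' G : R -> R) : 0 < t -> t < T ->
  (forall x, 0 < x < T -> 0 < F x) ->
  (forall x y, 0 < x -> x < y -> y < T -> F x < F y) ->
  (forall x, 0 < x < T -> is_derive x 1 F (F' x)) ->
  (forall x, 0 < x < T -> {for x, continuous F'}) ->
  (forall x, 0 < x < T -> 0 <= F' x) ->
  (forall x, 0 < x -> {for x, continuous G}) ->
  (forall x, 0 <= G x) -> measurable_fun setT G ->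
  measurable_fun setT (fun x => G (F x) * F' x) ->
  (\int[mu]_(x in `]0%R, t[) (G (F x) * F' x)%:E <= \int[mu]_(x in Ipos) (G x)%:E)%E.
Proof.
move=> t0 tT F0 Finc dF cF' F'0 cG G0 mG mGF.
have dE x : 0 < x < T -> (derive1 F) x = F' x.
  by move=> /dF dFx; rewrite derive1E; apply: derive_val.
have derF x : 0 < x < T -> derivable F x 1 by move=> /dF[].
have cF x : 0 < x < T -> {for x, continuous F}.
  by move=> /derF dFx; apply: differentiable_continuous; apply/derivable1_diffP.
have cdF x : 0 < x < T -> {for x, continuous (derive1 F)}.
  move=> xT; rewrite /prop_for /continuous_at (dE _ xT).
  apply: cvg_trans (cF' _ xT); apply: near_eq_cvg.
  have : \forall y \near x, y \in `]0, T[ by apply: near_in_itvoo; rewrite in_itv.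
  by apply: filterS => y; rewrite in_itv/= => /dE ->.
pose a n : R := t / n.+2%:R.
have a0 n : 0 < a n by rewrite divr_gt0.
have at_ n : a n < t by rewrite /a ltr_pdivrMr// ltr_pMr// ltr1n.
have aT n x : a n <= x -> x <= t -> 0 < x < T.
  by move=> ax xt; rewrite (lt_le_trans (a0 n))//= (le_lt_trans xt).
have step n : (\int[mu]_(x in `[a n, t]) (G (F x) * F' x)%:E <= \int[mu]_(x in Ipos) (G x)%:E)%E.
  have -> : (\int[mu]_(x in `[a n, t]) (G (F x) * F' x)%:E =
     \int[mu]_(x in `[a n, t]) (((G \o F) * (derive1 F)) x)%:E)%E.
    apply: eq_integral => x; rewrite inE/= in_itv/= => /andP[ax xt].
    by rewrite [in RHS]/GRing.mul/= dE//; exact: (aT n).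
  rewrite -integration_by_substitution_increasing; first last.
  - apply: continuous_in_subspaceT => y; rewrite inE/= in_itv/= => /andP[Fy _].
    apply: cG; apply: lt_le_trans Fy; apply: F0; apply: (aT n) => //; exact: ltW.
  - split.
    + move=> x; rewrite in_itv/= => /andP[ax xt]; apply: derF; apply: (aT n); exact: ltW.
    + by apply: cvg_at_right_filter; apply: cF; apply: (aT n) => //; exact: ltW.
    + by apply: cvg_at_left_filter; apply: cF; apply: (aT n) => //; exact: ltW.
  - apply/cvg_ex; exists ((derive1 F) t); apply: cvg_at_left_filter; apply: cdF.
    by apply: (aT n) => //; exact: ltW.
  - apply/cvg_ex; exists ((derive1 F) (a n)); apply: cvg_at_right_filter; apply: cdF.
    by apply: (aT n) => //; exact: ltW.
  - by move=> x; rewrite in_itv/= => /andP[ax xt]; apply: cdF; apply: (aT n); exact: ltW.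
  - move=> x y; rewrite !in_itv/= => /andP[ax xt] /andP[ay yt] xy; apply: Finc => //.
      exact: lt_le_trans ax.
    exact: le_lt_trans tT.
  - exact: ltW.
  apply: ge0_subset_integral => //.
  - by apply: measurable_funTS; meas.
  - by move=> x _; rewrite lee_fin.
  - move=> x /=; rewrite !in_itv/= andbT => /andP[Fx _]; apply: lt_le_trans Fx.
    by apply: F0; apply: (aT n) => //; exact: ltW.
pose D n := `[a n, t]%classic.
have DU : \bigcup_n D n = `]0, t]%classic.
  apply/seteqP; split=> [x [n _]|x] /=; rewrite /D/= !in_itv/=.
    by move=> /andP[nx ->]; rewrite (lt_le_trans _ nx).
  move=> /andP[x0 xt]; exists (Num.trunc (t / x)) => //=; rewrite in_itv/= xt andbT /a.
  rewrite ler_pdivrMr// mulrC -ler_pdivrMr//.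
  by rewrite ltW//; apply: lt_trans (truncnS_gt _) _; rewrite ltr_nat.
have ndD : nondecreasing_seq D.
  apply/nondecreasing_seqP => n; rewrite subsetEset /D => x /=; rewrite !in_itv/=.
  move=> /andP[nx ->]; rewrite andbT; apply: le_trans nx.
  by rewrite /a ler_pM2l// lef_pV2 ?posrE// ler_nat.
have mD n : measurable (D n) by exact: measurable_itv.
have mf n : measurable_fun (D n) (fun x => (G (F x) * F' x)%:E).
  by apply: measurable_funTS; apply: measurable_fun_EFin.
have f0 n x : D n x -> (0 <= (G (F x) * F' x)%:E)%E.
  rewrite /D/= in_itv/= lee_fin => /andP[ax xt]; rewrite mulr_ge0// F'0//.
  exact: aT ax xt.
have cvgD : (\int[mu]_(x in D i) (G (F x) * F' x)%:E @[i --> \oo] -->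
    \int[mu]_(x in `]0%R, t]) (G (F x) * F' x)%:E)%E.
  by rewrite -DU; exact: ge0_nondecreasing_set_cvg_integral.
apply: (@le_trans _ _ (\int[mu]_(x in `]0%R, t]) (G (F x) * F' x)%:E)%E).
  apply: ge0_subset_integral => //.
  - by apply: measurable_funTS; apply: measurable_fun_EFin.
  - move=> x /=; rewrite in_itv/= lee_fin => /andP[x0 xt].
    by rewrite mulr_ge0// F'0// x0 (le_lt_trans xt).
  - by move=> x /=; rewrite !in_itv/= => /andP[-> /ltW].
rewrite -(cvg_lim _ cvgD)//; apply: lime_le.
  apply: ereal_nondecreasing_is_cvgn.
  exact: ge0_nondecreasing_set_nondecreasing_integral.
by apply: nearW => n; exact: step.
Qed.
End substitution.

(** * A time change absorbing the dependence on time *)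

Section time_change.
Context (R : realType) (L sg : R).
Hypotheses (L0 : 0 < L) (sg01 : 0 < sg <= 1).

(** The heat flow over a time [tau] of a Gaussian times
    exp (- sg |x|^2 / (4 (L - tau))) amounts to the heat flow of a bare Gaussian,
    of rescaled parameter, over this changed time. *)
Definition time_change (tau : R) : R := (1 - sg) * tau - sg * L + sg * L ^+ 2 * (L - tau)^-1.
Definition time_change' (tau : R) : R := 1 - sg + sg * L ^+ 2 * ((L - tau) ^+ 2)^-1.

(** The parameter of the Gaussians is rescaled by the square of this factor,
    and time by its inverse. *)
Definition contraction (tau : R) : R := (L - tau) / (L - tau + sg * tau).

Let den (tau : R) : 0 < tau < L -> 0 < L - tau + sg * tau.
Proof.
move=> /andP[t0 tL]; have /andP[sg0 _] := sg01.
by have := mulr_gt0 sg0 t0; lra.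
Qed.

Lemma contraction_gt0 (tau : R) : 0 < tau < L -> 0 < contraction tau.
Proof. by move=> h; rewrite divr_gt0 ?den//; lra. Qed.

Lemma time_changeE (tau : R) : 0 < tau < L -> time_change tau = tau / contraction tau.
Proof.
move=> h; have := den h; have : 0 < L - tau by lra.
move=> h1 h2; rewrite /time_change /contraction; field.
by rewrite !gt_eqF.
Qed.

Lemma time_change_gt0 (tau : R) : 0 < tau < L -> 0 < time_change tau.
Proof. by move=> h; rewrite time_changeE// divr_gt0 ?contraction_gt0//; case/andP: h. Qed.

Lemma time_change'_ge0 (tau : R) : 0 <= time_change' tau.
Proof.
have /andP[sg0 sg1] := sg01.
have : 0 <= sg * L ^+ 2 * ((L - tau) ^+ 2)^-1.
  by rewrite !mulr_ge0 ?invr_ge0 ?sqr_ge0// ltW.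
by rewrite /time_change'; lra.
Qed.

Lemma time_change_increasing (x y : R) : 0 < x -> x < y -> y < L ->
  time_change x < time_change y.
Proof.
move=> x0 xy yL; rewrite /time_change; have /andP[sg0 sg1] := sg01.
have Ly : 0 < L - y by rewrite subr_gt0.
have Lx : 0 < L - x by rewrite subr_gt0 (lt_trans xy).
have : (L - x)^-1 < (L - y)^-1 by rewrite ltf_pV2 ?posrE// ltrD2l ltrN2.
rewrite -(@ltr_pM2l _ (sg * L ^+ 2)) ?mulr_gt0 ?exprn_gt0//.
have : (1 - sg) * x <= (1 - sg) * y by rewrite ler_wpM2l; lra.
lra.
Qed.

Lemma is_derive_time_change (tau : R) : 0 < tau < L ->
  is_derive tau 1 time_change (time_change' tau).
Proof.
move=> h; have Lt : L - tau != 0 by rewrite gt_eqF//; lra.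
have dV : is_derive tau 1 (fun x : R => (L - x)^-1) (((L - tau) ^+ 2)^-1).
  have d1 : is_derive tau 1 (fun x : R => L - x) (-1).
    by apply: is_derive_eq; rewrite add0r mul1r.
  have := @is_deriveV R (fun x : R => L - x) tau (-1) 1 Lt d1; set D := (X in is_derive _ _ _ X).
  by have -> : D = ((L - tau) ^+ 2)^-1 by rewrite /D /GRing.scale/=; field.
rewrite /time_change; apply: is_derive_eq.
by rewrite /time_change' /GRing.scale/=; ring.
Qed.

Lemma continuous_time_change' (tau : R) : 0 < tau < L -> {for tau, continuous time_change'}.
Proof.
move=> h; have Lt : (L - tau) ^+ 2 != 0 by rewrite sqrf_eq0 gt_eqF//; lra.
rewrite /time_change'; apply: cvgD; first exact: cvg_cst.
apply: cvgM; first exact: cvg_cst.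
have cL : (fun x : R => L - x) x @[x --> tau] --> L - tau.
  by apply: cvgB; [exact: cvg_cst|exact: cvg_id].
apply: cvgV => //; exact: (cvgM cL cL).
Qed.

(** The weight left after the change of variables is controlled by the
    Jacobian: with [v = 1 - tau / L], the contraction factor lies between [v]
    and [v `^ sg] by concavity of the logarithm, and its inverse square is
    below the Jacobian by convexity of the square. *)
Lemma time_change_weight (s a e tau : R) : 0 < tau < L ->
  0 <= a + (e + s + 1) -> 0 <= a + sg * (e + s + 1) ->
  tau `^ (s - 1) * (L - tau) `^ a * contraction tau `^ e <=
  L `^ a * (time_change tau `^ (s - 1) * time_change' tau).
Proof.
move=> h ak ask; have h0 : 0 < tau by lra.
have /andP[sg0 sg1] := sg01; have L0' := L0.
have Lt : 0 < L - tau by lra.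
have m0 := contraction_gt0 h; set m := contraction tau in m0 *.
have dn := den h.
pose v := (L - tau) / L; have v0 : 0 < v by rewrite divr_gt0.
have v1 : v < 1 by rewrite ltr_pdivrMr// mul1r; lra.
have lnv0 : ln v < 0 by rewrite ln_lt0// v0.
have sv1 : 0 <= (1 - sg) * v by apply: mulr_ge0; [lra|exact: ltW].
have sv0 : 0 < sg + (1 - sg) * v by lra.
have mE : m = v / (sg + (1 - sg) * v).
  have eL : sg * L + (1 - sg) * (L - tau) = L - tau + sg * tau by ring.
  by rewrite /m /contraction /v; field; rewrite eL !gt_eqF.
have lnm : ln m = ln v - ln (sg + (1 - sg) * v) by rewrite mE ln_div.
have lnm1 : ln v <= ln m.
  have : sg + (1 - sg) * v <= 1 by nra.
  by move=> /ln_le0; lra.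
have lnm2 : ln m <= sg * ln v.
  have : (1 - sg) * ln v <= ln (sg + (1 - sg) * v).
    have t01 : 0 <= 1 - sg <= 1 by lra.
    have := expR_convex (ln v) 0 t01; rewrite mulr0 addr0 expR0 mulr1 lnK ?posrE//.
    have -> : 1 - (1 - sg) = sg by ring.
    by move=> h2; rewrite -ler_expR lnK ?posrE//; lra.
  lra.
have vm : a * ln v + (e + s + 1) * ln m <= 0.
  have [k0|k0] := leP 0 (e + s + 1); nra.
have mV2 : (m ^+ 2)^-1 <= time_change' tau.
  have -> : time_change' tau = 1 - sg + sg * (v^-1) ^+ 2.
    by rewrite /time_change' /v; field; rewrite !gt_eqF.
  have -> : (m ^+ 2)^-1 = (sg * v^-1 + (1 - sg)) ^+ 2.
    by rewrite mE; field; rewrite !gt_eqF.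
  have : 0 <= sg * (1 - sg) * (v^-1 - 1) ^+ 2 by rewrite mulr_ge0 ?sqr_ge0//; nra.
  by move: (v^-1) => X; lra.
have rho0 := time_change_gt0 h.
apply: (@le_trans _ _ (L `^ a * (time_change tau `^ (s - 1) * (m ^+ 2)^-1))); last first.
  by rewrite ler_wpM2l ?powR_ge0// ler_wpM2l ?powR_ge0.
rewrite time_changeE// -/m -(powR_invn 2 (ltW m0)) !powR_expln ?divr_gt0//.
rewrite -!expRD ler_expR ln_div//.
have -> : ln (L - tau) = ln v + ln L by rewrite -lnM ?posrE// /v divfK ?gt_eqF.
lra.
Qed.

End time_change.

(** * One time slice of J applied to a profile *)

Section profile.
Context (R : realType) (N : nat).
Notation mu := (@lebesgue_measure R).
Local Notation Ipos := (`]0%R, +oo[%classic).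

(** Up to a factor these functions are invariant under the parabolic rescaling
    of x and of the shifted time 1 + t. *)
Definition profile (a m sg : R) (z : spacetime R N) : R :=
  if 0 < (z.2 : R) then
    (1 + (z.2 : R)) `^ a * enorm z.1 `^ (- m) *
    expR (- (sg * enorm z.1 ^+ 2 / (4 * (1 + (z.2 : R)))))
  else 0.

Lemma profile_ge0 a m sg z : 0 <= profile a m sg z.
Proof. by rewrite /profile; case: ifPn => // _; rewrite !mulr_ge0 ?powR_ge0 ?expR_ge0. Qed.

Lemma measurable_ltr_ite d (T : measurableType d) (g h : T -> R) :
  measurable_fun setT g -> measurable_fun setT h ->
  measurable_fun setT (fun x => if 0 < g x then h x else 0).
Proof.
move=> mg mh; apply: measurable_fun_if => //.
- exact: measurable_fun_ltr.
- exact: measurable_funTS.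
Qed.

Lemma measurable_profile a m sg : measurable_fun setT (profile a m sg).
Proof. by rewrite /profile; apply: measurable_ltr_ite; meas. Qed.

(** Equality for [r > 0]. The inequality also covers [r = 0], where the
    left-hand side is 0 by the convention on negative powers of 0. *)
Lemma powR_enorm_gamma_le (b r : R) : 0 < b -> 0 <= r ->
  ((r `^ (- (2 * b)))%:E <=
   \int[mu]_(h in Ipos) ((Gamma b)^-1 * (h `^ (b - 1) * expR (- (h * r ^+ 2))))%:E)%E.
Proof.
move=> b0; rewrite le_eqVlt => /predU1P[<-|r0].
  rewrite powR0 ?oppr_eq0 ?mulf_neq0 ?gt_eqF//.
  apply: integral_ge0 => h _; rewrite lee_fin !mulr_ge0 ?powR_ge0 ?expR_ge0//.
  by rewrite invr_ge0; exact: ltW (Gamma_gt0 b0).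
have r20 : 0 < r ^+ 2 by rewrite exprn_gt0.
under eq_integral do rewrite EFinM (mulrC _ (r ^+ 2)).
rewrite ge0_integralZl_EFin//; first last.
- by rewrite invr_ge0; exact: ltW (Gamma_gt0 b0).
- by apply: measurable_funTS; meas.
- by move=> h _; rewrite lee_fin !mulr_ge0 ?powR_ge0 ?expR_ge0.
rewrite (integral_powR_expR b0 r20) -EFinM lee_fin mulrA mulVf ?mul1r; last first.
  exact: lt0r_neq0 (Gamma_gt0 b0).
by rewrite -(powR_mulrn 2 (ltW r0)) -powRrM mulrN.
Qed.

End profile.

Section kernel_algebra.
Context (R : realFieldType) (sg L tau h : R).
Hypotheses (sg01 : 0 < sg <= 1) (t0 : 0 < tau) (tL : tau < L) (h0 : 0 < h).
Let D := sg / (4 * (L - tau)).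
Let A := h + D.
Let B := (4 * tau)^-1.
Let m := (L - tau) / (L - tau + sg * tau).

Lemma gaussian_prefactor (c : R) :
  c / (B + A) = c * 4 * tau * m / (1 + 4 * (m ^+ 2 * h) * (tau / m)).
Proof.
have Lt : 0 < L - tau by rewrite subr_gt0.
have st : 0 < sg * tau by rewrite mulr_gt0//; case/andP: sg01.
have d : 0 < L - tau + sg * tau by rewrite addr_gt0.
have e1 : 0 < 4 * tau * h * (L - tau) by rewrite !mulr_gt0.
rewrite /A /B /D /m; field; rewrite !gt_eqF//; nra.
Qed.

(** The product [B * A / (B + A)] is the exponent left by the convolution
    of Gaussians of parameters [B] (the heat kernel) and [A] (the function). It
    splits into the part which the profile carries and the part of a bare
    Gaussian of rescaled parameter [m ^+ 2 * h], taken at time [tau / m]. *)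
Lemma gaussian_exponent :
  B * A / (B + A) = sg / (4 * (L - tau + sg * tau)) +
    m ^+ 2 * h / (1 + 4 * (m ^+ 2 * h) * (tau / m)).
Proof.
have Lt : 0 < L - tau by rewrite subr_gt0.
have st : 0 < sg * tau by rewrite mulr_gt0//; case/andP: sg01.
have d : 0 < L - tau + sg * tau by rewrite addr_gt0.
have e1 : 0 < 4 * tau * h * (L - tau) by rewrite !mulr_gt0.
rewrite /A /B /D /m; field; rewrite !gt_eqF//; nra.
Qed.

Lemma gaussian_exponent_ge : sg / (4 * L) <= sg / (4 * (L - tau + sg * tau)).
Proof.
have Lt : 0 < L - tau by rewrite subr_gt0.
have /andP[sg0 sg1] := sg01.
have st : 0 < sg * tau by rewrite mulr_gt0.
have st1 : sg * tau <= tau by rewrite ler_piMl// ltW.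
have d : 0 < L - tau + sg * tau by rewrite addr_gt0.
rewrite ler_pM2l// lef_pV2 ?posrE ?mulr_gt0// ?(lt_trans t0 tL)//.
by rewrite ler_pM2l//; lra.
Qed.
End kernel_algebra.

Section slice.
Context (R : realType) (N : nat) (s m a sg : R).
Notation mu := (@lebesgue_measure R).
Local Notation Ipos := (`]0%R, +oo[%classic).
Hypotheses (s0 : 0 < s) (m0 : 0 < m) (sg01 : 0 < sg <= 1).
Let nu : R := N%:R / 2.
Let th : R := m / 2.
Let b : R := th + s.
(* [e] is the exponent of the contraction factor which the Gaussian
   convolution and the homogeneity of the power leave behind. *)
Let e : R := nu - 2 * b.
Hypotheses (ae : 0 <= a + (e + s + 1)) (ase : 0 <= a + sg * (e + s + 1)).

Let b0 : 0 < b. Proof. by rewrite addr_gt0// divr_gt0. Qed.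
Let Gb0 : 0 < Gamma b. Proof. exact: Gamma_gt0. Qed.

(** The power of the norm is replaced by a superposition of Gaussians in
    [h], the integrals are exchanged, and each convolution is explicit. *)
Lemma slice_gaussian (L tau : R) (x : euclid R N) : 0 < tau < L ->
  (\int[tuple_lebesgue N]_y
      (expR (- (enorm y ^+ 2 / (4 * tau))) / tau `^ (nu + 1 - s) *
       ((L - tau) `^ a * enorm (esub x y) `^ (- (m + 2 * s)) *
        expR (- (sg * enorm (esub x y) ^+ 2 / (4 * (L - tau))))))%:E <=
   \int[mu]_(h in Ipos) ((Gamma b)^-1 * tau `^ (s - 1 - nu) * (L - tau) `^ a *
      h `^ (b - 1) * ((pi / ((4 * tau)^-1 + (h + sg / (4 * (L - tau))))) `^ nu *
      expR (- ((4 * tau)^-1 * (h + sg / (4 * (L - tau))) /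
        ((4 * tau)^-1 + (h + sg / (4 * (L - tau)))) * enorm x ^+ 2))))%:E)%E.
Proof.
move=> /andP[t0 tL]; have Lt : 0 < L - tau by rewrite subr_gt0.
have /andP[sg0 sg1] := sg01.
pose B : R := (4 * tau)^-1; pose D := sg / (4 * (L - tau)).
have B0 : 0 < B by rewrite invr_gt0 mulr_gt0.
have D0 : 0 < D by rewrite divr_gt0// mulr_gt0.
pose c := (Gamma b)^-1 * tau `^ (s - 1 - nu) * (L - tau) `^ a.
have c0 : 0 <= c by rewrite !mulr_ge0 ?powR_ge0// invr_ge0; exact: ltW Gb0.
pose K (y : euclid R N) (h : measurableTypeR R) : R := c * h `^ (b - 1) *
  (expR (- (B * enorm y ^+ 2)) * expR (- ((h + D) * enorm (esub x y) ^+ 2))).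
have K0 y h : 0 <= K y h.
  exact: mulr_ge0 (mulr_ge0 c0 (powR_ge0 _ _)) (mulr_ge0 (expR_ge0 _) (expR_ge0 _)).
have mK : measurable_fun setT (fun z : euclid R N * measurableTypeR R => (K z.1 z.2)%:E).
  by rewrite /K; meas.
apply: (@le_trans _ _ (\int[tuple_lebesgue N]_y \int[mu]_(h in Ipos) (K y h)%:E)%E).
  apply: le_integral_any => y _; first by rewrite lee_fin !mulr_ge0 ?invr_ge0 ?powR_ge0 ?expR_ge0.
  set r := enorm (esub x y); have r0 : 0 <= r by exact: enorm_ge0.
  pose k := tau `^ (s - 1 - nu) * (L - tau) `^ a * (expR (- (B * enorm y ^+ 2)) * expR (- (D * r ^+ 2))).
  have k0 : 0 <= k by rewrite !mulr_ge0 ?powR_ge0 ?expR_ge0.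
  have -> : (expR (- (enorm y ^+ 2 / (4 * tau))) / tau `^ (nu + 1 - s) *
       ((L - tau) `^ a * r `^ (- (m + 2 * s)) * expR (- (sg * r ^+ 2 / (4 * (L - tau)))))) =
      k * r `^ (- (2 * b)).
    have -> : m + 2 * s = 2 * b by rewrite /b /th; field.
    rewrite /k /B /D; have -> : s - 1 - nu = - (nu + 1 - s) by ring.
    rewrite !powRN; have -> : sg * r ^+ 2 / (4 * (L - tau)) = sg / (4 * (L - tau)) * r ^+ 2 by ring.
    rewrite [enorm y ^+ 2 / _]mulrC; ring.
  rewrite EFinM.
  apply: (@le_trans _ _ (k%:E *
     \int[mu]_(h in Ipos) ((Gamma b)^-1 * (h `^ (b - 1) * expR (- (h * r ^+ 2))))%:E)%E).
    by rewrite lee_wpmul2l// powR_enorm_gamma_le.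
  rewrite -ge0_integralZl_EFin//; first last.
  - by apply: measurable_funTS; meas.
  - by move=> h _; rewrite lee_fin !mulr_ge0 ?powR_ge0 ?expR_ge0// invr_ge0; exact: ltW Gb0.
  apply: le_integral_any => h _.
    by rewrite -EFinM lee_fin !mulr_ge0 ?powR_ge0 ?expR_ge0// invr_ge0; exact: ltW Gb0.
  rewrite -EFinM /K /k /c mulrDl opprD expRD -/r lee_fin.
  by rewrite le_eqVlt; apply/orP; left; apply/eqP; ring.
rewrite (tonelli_in (tuple_lebesgue N) mu measurableT (measurable_itv _) mK); last first.
  by move=> y h; rewrite lee_fin.
apply: le_integral_any => h.
  by move=> _; apply: integral_ge0 => y _; rewrite lee_fin.
rewrite /= in_itv/= andbT => h0.
have hD : 0 < h + D by rewrite addr_gt0.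
rewrite /K; under eq_integral do rewrite EFinM.
rewrite ge0_integralZl_EFin//; first last.
- exact: mulr_ge0 c0 (powR_ge0 _ _).
- by meas.
by rewrite (gaussian_convolution _ B0 hD) -EFinM.
Qed.

Let C : R := (Gamma b)^-1 * (4 * pi) `^ nu.
Let C0 : 0 <= C.
Proof. by rewrite mulr_ge0 ?powR_ge0// invr_ge0; exact: ltW Gb0. Qed.

(** Rescaling [h] by the square of the contraction factor brings the
    exponent and the prefactor to the form of [riesz_kernel] at the changed
    time; the remaining powers of [tau], [L - tau] and the contraction factor
    are those of [time_change_weight]. *)
Lemma slice_riesz (L tau : R) (x : euclid R N) : 0 < tau < L ->
  (\int[mu]_(h in Ipos) ((Gamma b)^-1 * tau `^ (s - 1 - nu) * (L - tau) `^ a *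
      h `^ (b - 1) * ((pi / ((4 * tau)^-1 + (h + sg / (4 * (L - tau))))) `^ nu *
      expR (- ((4 * tau)^-1 * (h + sg / (4 * (L - tau))) /
        ((4 * tau)^-1 + (h + sg / (4 * (L - tau)))) * enorm x ^+ 2))))%:E <=
   \int[mu]_(h in Ipos) (C * L `^ a * expR (- (sg * enorm x ^+ 2 / (4 * L))) *
      (riesz_kernel s th nu (enorm x ^+ 2) h (time_change L sg tau) *
       time_change' L sg tau))%:E)%E.
Proof.
move=> tL'; have /andP[t0 tL] := tL'; have Lt : 0 < L - tau by rewrite subr_gt0.
have L0 : 0 < L by exact: lt_trans tL.
have k0 := contraction_gt0 sg01 tL'.
have kE := time_changeE sg01 tL'.
have rho0 := time_change_gt0 sg01 tL'.
have wt := time_change_weight L0 sg01 tL' ae ase.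
have rho'0 := time_change'_ge0 L0 sg01 tau.
set k := contraction L sg tau in k0 kE wt *.
set rho := time_change L sg tau in kE rho0 wt *.
set rho' := time_change' L sg tau in wt rho'0 *.
have kdef : (L - tau) / (L - tau + sg * tau) = k by [].
clearbody k rho rho'.
set r := enorm x; set E := expR (- (sg * r ^+ 2 / (4 * L))).
have E0 : 0 <= E by exact: expR_ge0.
pose M := C * (tau `^ (s - 1) * (L - tau) `^ a * k `^ e) * k ^+ 2 * E.
have M0 : 0 <= M.
  apply: mulr_ge0 => //; apply: mulr_ge0; last exact: sqr_ge0.
  by apply: mulr_ge0 => //; rewrite !mulr_ge0 ?powR_ge0.
pose g h : R := h `^ (b - 1) * ((1 + 4 * h * rho) `^ (- nu) *
   expR (- (h * r ^+ 2 / (1 + 4 * h * rho)))).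
have g0 h : 0 <= g h by rewrite !mulr_ge0 ?powR_ge0 ?expR_ge0.
pose f h : \bar R := (M * g h)%:E.
have k20 : 0 < k ^+ 2 by rewrite exprn_gt0.
apply: (@le_trans _ _ (\int[mu]_(h in Ipos) f (k ^+ 2 * h)%R)%E).
  apply: le_integral_any => h.
    move=> _; rewrite lee_fin !mulr_ge0 ?powR_ge0 ?expR_ge0// invr_ge0; exact: ltW Gb0.
  rewrite /= in_itv/= andbT => h0.
  have kh0 : 0 < k ^+ 2 * h by rewrite mulr_gt0.
  rewrite (gaussian_prefactor sg01 t0 tL h0) (gaussian_exponent sg01 t0 tL h0).
  rewrite kdef -kE.
  set q0 := sg / (4 * (L - tau + sg * tau)).
  have q0ge : sg / (4 * L) <= q0 by exact: gaussian_exponent_ge.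
  have w0 : 0 < 1 + 4 * (k ^+ 2 * h) * rho by rewrite addr_gt0// mulr_gt0// mulr_gt0.
  rewrite /f /g lee_fin.
  set w := 1 + _ in w0 *.
  have -> : (pi * 4 * tau * k / w) `^ nu =
      (4 * pi) `^ nu * tau `^ nu * k `^ nu * w `^ (- nu).
    rewrite powRM ?invr_ge0 ?ltW// ?mulr_gt0 ?pi_gt0//.
    rewrite powRM ?(ltW k0)// ?mulr_ge0 ?pi_ge0 ?ltW//.
    rewrite powRM ?(ltW t0)// ?mulr_ge0 ?pi_ge0//.
    by rewrite [pi * 4]mulrC powRN -(powR_inv1 (ltW w0)) -powRrM mulN1r powRN.
  have -> : (k ^+ 2 * h) `^ (b - 1) = k `^ (2 * (b - 1)) * h `^ (b - 1).
    by rewrite powRM ?(ltW k20) ?(ltW h0)// -(powR_mulrn 2 (ltW k0)) -powRrM.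
  have -> : - ((q0 + k ^+ 2 * h / w) * r ^+ 2) = - (q0 * r ^+ 2) + - (k ^+ 2 * h * r ^+ 2 / w).
    by ring.
  rewrite expRD.
  have EE : expR (- (q0 * r ^+ 2)) <= E.
    rewrite ler_expR lerN2 [leLHS]mulrAC; apply: ler_wpM2r q0ge; exact: sqr_ge0.
  set Q := expR (- (k ^+ 2 * h * r ^+ 2 / w)).
  have Q0 : 0 <= Q by exact: expR_ge0.
  have -> : tau `^ (s - 1 - nu) = tau `^ (s - 1) * tau `^ (- nu) by rewrite -powRDp.
  have tt : tau `^ (- nu) * tau `^ nu = 1 by rewrite -powRDp// addNr powRr0.
  have kk : k `^ e * k ^+ 2 * k `^ (2 * (b - 1)) = k `^ nu.
    by rewrite -(powR_mulrn 2 (ltW k0)) -!powRDp//; congr powR; rewrite /e; ring.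
  rewrite /M /C.
  pose P := (Gamma b)^-1 * tau `^ (s - 1) * (L - tau) `^ a * h `^ (b - 1) *
    (4 * pi) `^ nu * k `^ nu * w `^ (- nu) * Q.
  have P0 : 0 <= P.
    rewrite /P !mulr_ge0 ?powR_ge0// invr_ge0; exact: ltW Gb0.
  rewrite [leLHS](_ : _ = P * expR (- (q0 * r ^+ 2)) * (tau `^ (- nu) * tau `^ nu)); last first.
    by rewrite /P; ring.
  rewrite [leRHS](_ : _ = P * E); last by rewrite /P -kk; ring.
  by rewrite tt mulr1; apply: ler_wpM2l.
rewrite (@ge0_integral_scale _ (k ^+ 2) f)//; last 2 first.
- by rewrite /f /g; meas.
- by move=> h; rewrite lee_fin mulr_ge0.
rewrite -ge0_integralZl_EFin//; first last.
- by rewrite invr_ge0 ltW.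
- by apply: measurable_funTS; rewrite /f /g; meas.
- by move=> h _; rewrite lee_fin mulr_ge0.
apply: le_integral_any => h.
  by move=> _; rewrite -EFinM lee_fin mulr_ge0 ?invr_ge0 ?(ltW k20)// mulr_ge0.
rewrite /= in_itv/= andbT => h0; rewrite -EFinM lee_fin /M.
rewrite [leLHS](_ : _ = C * E * g h * (tau `^ (s - 1) * (L - tau) `^ a * k `^ e)); last first.
  by field; rewrite gt_eqF.
rewrite [leRHS](_ : _ = C * E * g h * (L `^ a * (rho `^ (s - 1) * rho'))); last first.
  by rewrite /riesz_kernel /g -/b; ring.
by apply: ler_wpM2l wt; rewrite mulr_ge0// mulr_ge0.
Qed.

End slice.

(** * J applied to a profile *)

Section riesz_continuity.
Context (R : realType).

Lemma continuous_powR_gt0 (a x : R) : 0 < x -> {for x, continuous (fun y : R => y `^ a)}.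
Proof.
move=> x0; apply: differentiable_continuous; apply/derivable1_diffP.
by apply: derivable_powR; rewrite in_itv/= andbT.
Qed.

Lemma continuous_riesz_kernel (s th nu r h x : R) : 0 < h -> 0 < x ->
  {for x, continuous (riesz_kernel s th nu r h)}.
Proof.
move=> h0 x0; have w0 : 0 < 1 + 4 * h * x by rewrite addr_gt0// mulr_gt0// mulr_gt0.
have cw : (1 + 4 * h * y) @[y --> x] --> 1 + 4 * h * x.
  by apply: cvgD; [exact: cvg_cst|apply: cvgMr; exact: cvg_id].
have cA : y `^ (s - 1) @[y --> x] --> x `^ (s - 1) by exact: continuous_powR_gt0.
have cB : (1 + 4 * h * y) `^ (- nu) @[y --> x] --> (1 + 4 * h * x) `^ (- nu).
  apply: (@cvg_comp _ _ _ (fun y : R => 1 + 4 * h * y) (fun y : R => y `^ (- nu)) _ _ _ cw).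
  exact: continuous_powR_gt0.
have cC : (- (h * r / (1 + 4 * h * y))) @[y --> x] --> - (h * r / (1 + 4 * h * x)).
  by apply: cvgN; apply: cvgM; [exact: cvg_cst|apply: cvgV => //; rewrite gt_eqF].
have cD : expR (- (h * r / (1 + 4 * h * y))) @[y --> x] --> expR (- (h * r / (1 + 4 * h * x))).
  apply: (@cvg_comp _ _ _ (fun y : R => - (h * r / (1 + 4 * h * y))) (@expR R) _ _ _ cC).
  exact: continuous_expR.
exact: cvgM (cvg_cst _) (cvgM (cvgM cA cB) cD).
Qed.

End riesz_continuity.

Section J_profile.
Context (R : realType) (N : nat) (s m a sg : R).
Notation mu := (@lebesgue_measure R).
Local Notation Ipos := (`]0%R, +oo[%classic).
Hypotheses (s0 : 0 < s) (m0 : 0 < m) (mN : m + 2 * s < N%:R) (sg01 : 0 < sg <= 1).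
Hypotheses (ak : 0 <= a + (N%:R / 2 - m - s + 1))
  (ask : 0 <= a + sg * (N%:R / 2 - m - s + 1)).
Let nu : R := N%:R / 2.
Let th : R := m / 2.
Let d : R := nu - (th + s).

(** The constant of the Riesz potential of a power of the norm, in the form in
    which the Gamma and Beta integrals produce it. *)
Definition riesz_const : R :=
  4 `^ (- s) * Gamma th * Gamma d / (Gamma (th + s) * Gamma (s + d)).

Let th0 : 0 < th. Proof. by rewrite divr_gt0. Qed.
Let d0 : 0 < d. Proof. by have := mN; rewrite /d /nu /th; lra. Qed.
Let b0 : 0 < th + s. Proof. by rewrite addr_gt0. Qed.

Let slice_le (L tau : R) (x : euclid R N) : 0 < tau < L ->
  (\int[tuple_lebesgue N]_y
      (expR (- (enorm y ^+ 2 / (4 * tau))) / tau `^ (nu + 1 - s) *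
       ((L - tau) `^ a * enorm (esub x y) `^ (- (m + 2 * s)) *
        expR (- (sg * enorm (esub x y) ^+ 2 / (4 * (L - tau))))))%:E <=
   \int[mu]_(h in Ipos)
     ((Gamma (th + s))^-1 * (4 * pi) `^ nu * L `^ a * expR (- (sg * enorm x ^+ 2 / (4 * L))) *
      (riesz_kernel s th nu (enorm x ^+ 2) h (time_change L sg tau) *
       time_change' L sg tau))%:E)%E.
Proof.
move=> tL.
have kE : N%:R / 2 - 2 * (m / 2 + s) + s + 1 = N%:R / 2 - m - s + 1 :> R by field.
have h1 : 0 <= a + (N%:R / 2 - 2 * (m / 2 + s) + s + 1) by rewrite kE.
have h2 : 0 <= a + sg * (N%:R / 2 - 2 * (m / 2 + s) + s + 1) by rewrite kE.
exact: (le_trans (slice_gaussian a s0 m0 sg01 x tL) (slice_riesz s0 m0 sg01 h1 h2 x tL)).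
Qed.

(** The time slices are bounded by [slice_riesz]; exchanging the
    integrals over [tau] and [h] and substituting the changed time leaves the
    integral of [riesz_kernel], which depends on x through a power only. *)
Lemma J_profile_le (x : euclid R N) (t : R) : 0 < enorm x ->
  (J s (profile a (m + 2 * s) sg) (x, t) <= (riesz_const * profile a m sg (x, t))%:E)%E.
Proof.
move=> x0; rewrite /J /=.
have kap0 : 0 <= riesz_const.
  have g1 := Gamma_gt0 th0; have g2 := Gamma_gt0 d0; have g3 := Gamma_gt0 b0.
  have g4 := Gamma_gt0 (addr_gt0 s0 d0).
  exact: divr_ge0 (mulr_ge0 (mulr_ge0 (powR_ge0 _ _) (ltW g1)) (ltW g2)) (ltW (mulr_gt0 g3 g4)).
have Gs0 := Gamma_gt0 s0; have Gb0 := Gamma_gt0 b0.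
have p40 : 0 < (4 * pi : R) `^ nu by rewrite powR_gt0// mulr_gt0 ?pi_gt0.
have [t0|t0] := leP t 0.
  rewrite integral0_eq => [|tau].
    by rewrite mule0 lee_fin; exact: mulr_ge0 kap0 (profile_ge0 _ _ _ _).
  rewrite /= in_itv/= andbT => tau0; rewrite integral0_eq// => y _.
  by rewrite /profile/= ifF ?mulr0//; apply/negbTE; rewrite -leNgt; lra.
pose L := 1 + t; have L0 : 0 < L by rewrite addr_gt0.
have tL : t < L by rewrite /L ltrDr.
pose r := enorm x ^+ 2; have r0 : 0 < r by rewrite exprn_gt0.
pose E := expR (- (sg * r / (4 * L))).
pose c := (Gamma (th + s))^-1 * (4 * pi) `^ nu * L `^ a * E.
have c0 : 0 <= c.
  by rewrite /c !mulr_ge0 ?powR_ge0 ?expR_ge0// invr_ge0; exact: ltW Gb0.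
pose K (tau h : measurableTypeR R) : R := c * (riesz_kernel s th nu r h (time_change L sg tau) *
   time_change' L sg tau).
have K0 tau h : 0 <= K tau h.
  exact: mulr_ge0 c0 (mulr_ge0 (riesz_kernel_ge0 _ _ _ _ _ _) (time_change'_ge0 L0 sg01 _)).
have mK : measurable_fun setT (fun z : measurableTypeR R * measurableTypeR R => (K z.1 z.2)%:E).
  by rewrite /K /riesz_kernel /time_change /time_change'; meas.
have step : (\int[mu]_(tau in Ipos) \int[tuple_lebesgue N]_y
    (expR (- (enorm y ^+ 2 / (4 * tau))) / tau `^ (nu + 1 - s) *
      profile a (m + 2 * s) sg (esub x y, t - tau))%:E <=
   \int[mu]_(tau in `]0%R, t[) \int[mu]_(h in Ipos) (K tau h)%:E)%E.
  rewrite [leRHS]integral_mkcond [leLHS]integral_mkcond; apply: le_integral_any => tau _.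
    apply: erestrict_ge0 => u _; apply: integral_ge0 => y _.
    by rewrite lee_fin !mulr_ge0 ?expR_ge0 ?invr_ge0 ?powR_ge0 ?profile_ge0.
  rewrite !patchE; case: ifPn; last first.
    by move=> _; case: ifPn => // _; apply: integral_ge0 => h _; rewrite lee_fin.
  rewrite inE/= in_itv/= andbT => tau0; case: ifPn; last first.
    rewrite notin_setE/= in_itv/= tau0/= => /negP; rewrite -leNgt => tt.
    rewrite integral0_eq// => y _.
    by rewrite /profile/= ifF ?mulr0//; apply/negbTE; rewrite -leNgt; lra.
  rewrite inE/= in_itv/= tau0/= => tt.
  have tauL : 0 < tau < L by rewrite tau0 (lt_trans tt).
  apply: le_trans (slice_le x tauL).
  apply: le_integral_any => y _.
    by rewrite lee_fin !mulr_ge0 ?expR_ge0 ?invr_ge0 ?powR_ge0 ?profile_ge0.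
  rewrite lee_fin /profile/= ifT ?subr_gt0//.
  by have -> : 1 + (t - tau) = L - tau by rewrite /L; ring.
have key : (\int[mu]_(tau in `]0%R, t[) \int[mu]_(h in Ipos) (K tau h)%:E <=
   (c * (4 `^ (- s) * Gamma th * (Gamma s * Gamma d / Gamma (s + d)) * r `^ (- th)))%:E)%E.
  rewrite (tonelli_in mu mu (measurable_itv _) (measurable_itv _) mK); last first.
    by move=> tau h; rewrite lee_fin.
  rewrite EFinM -(integral_riesz_kernel s0 th0 d0 r0).
  have -> : th + s + d = nu by rewrite /d addrC subrK.
  have mrk : measurable_fun setT (fun z : measurableTypeR R * measurableTypeR R =>
      (riesz_kernel s th nu r z.1 z.2)%:E) by rewrite /riesz_kernel; meas.
  rewrite -ge0_integralZl_EFin//; first last.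
  - apply: measurable_funTS; apply: (measurable_integral_in mu (measurable_itv _) mrk).
    by move=> h rho; rewrite lee_fin riesz_kernel_ge0.
  - by move=> h _; apply: integral_ge0 => rho _; rewrite lee_fin riesz_kernel_ge0.
  apply: le_integral_any => h; first by move=> _; apply: integral_ge0 => tau _; rewrite lee_fin.
  rewrite /= in_itv/= andbT => h0.
  rewrite /K; under eq_integral do rewrite EFinM.
  have mrkh : measurable_fun setT (fun rho : measurableTypeR R => riesz_kernel s th nu r h rho).
    by rewrite /riesz_kernel; meas.
  have mtc : measurable_fun setT (fun tau : measurableTypeR R =>
      riesz_kernel s th nu r h (time_change L sg tau) * time_change' L sg tau).
    by rewrite /riesz_kernel /time_change /time_change'; meas.
  rewrite ge0_integralZl_EFin//; first last.
  - by apply: measurable_funTS; apply: measurable_fun_EFin.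
  - move=> tau _; rewrite lee_fin.
    exact: mulr_ge0 (riesz_kernel_ge0 _ _ _ _ _ _) (time_change'_ge0 L0 sg01 _).
  rewrite lee_wpmul2l ?lee_fin//.
  exact: (substitution_le t0 tL (@time_change_gt0 _ _ _ sg01)
    (@time_change_increasing _ _ _ L0 sg01) (@is_derive_time_change _ _ _)
    (@continuous_time_change' _ _ _) (fun tau _ => time_change'_ge0 L0 sg01 tau)
    (fun rho => @continuous_riesz_kernel _ s th nu r h rho h0)
    (fun rho => riesz_kernel_ge0 s th nu r h rho) mrkh mtc).
have cJ0 : 0 <= (Gamma s * (4 * pi) `^ nu)^-1.
  by rewrite invr_ge0; exact: ltW (mulr_gt0 Gs0 p40).
apply: (@le_trans _ _ (((Gamma s * (4 * pi) `^ nu)^-1)%:E *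
  (c * (4 `^ (- s) * Gamma th * (Gamma s * Gamma d / Gamma (s + d)) * r `^ (- th)))%:E)%E).
  by apply: lee_wpmul2l; [rewrite lee_fin|exact: le_trans step key].
rewrite -EFinM lee_fin /profile/= t0 -/L -/r -/E.
have -> : enorm x `^ (- m) = r `^ (- th).
  by rewrite /r -(powR_mulrn 2 (enorm_ge0 x)) -powRrM; congr powR; rewrite /th; field.
rewrite /c /riesz_const le_eqVlt; apply/orP; left; apply/eqP.
have Gsd : Gamma (s + d) != 0 by apply: lt0r_neq0; exact: Gamma_gt0 (addr_gt0 s0 d0).
move: (lt0r_neq0 Gs0) (lt0r_neq0 Gb0) (lt0r_neq0 p40) Gsd.
move: (Gamma s) (Gamma (th + s)) ((4 * pi) `^ nu) (Gamma (s + d)) (Gamma th) (Gamma d) => g1 g2 g3 g4 g5 g6 h1 h2 h3 h4.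
by field; rewrite h1 h2 h3 h4.
Qed.

End J_profile.

(** * Reflections and null sets *)

Section reflection.
Context (R : realType).
Notation mu := (@lebesgue_measure R).
Local Open Scope ereal_scope.

(** One-dimensional reflections, one coordinate at a time. *)
Lemma integral_esub n (x : euclid R n) (F : euclid R n -> \bar R) :
  measurable_fun setT F -> (forall v, 0 <= F v) ->
  \int[tuple_lebesgue n]_y F (esub x y) = \int[tuple_lebesgue n]_y F y.
Proof.
elim: n x F => [|n IH] x F mF F0.
  by apply: eq_integral => y _; congr F; apply: eq_from_tnth => -[].
have mFe : measurable_fun setT (fun v => F (esub x v)).
  by apply: (measurableT_comp mF); meas.
rewrite (integral_tuple_lebesgueS mFe); last by move=> v; exact: F0.
rewrite (integral_tuple_lebesgueS mF F0) [x]tuple_cons_thead.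
set x0 := thead x; set x' := [tuple of behead x].
pose G a := \int[tuple_lebesgue n]_w F (tuple_cons (a, w)).
have mFc : measurable_fun setT (fun z : measurableTypeR R * euclid R n => F (tuple_cons (z.1, z.2))).
  rewrite (_ : (fun _ => _) = F \o @tuple_cons R n); last by apply/funext => -[].
  by apply: measurableT_comp => //; exact: measurable_tuple_cons.
have mG : measurable_fun setT G.
  by apply: (measurable_integral_in _ measurableT mFc) => a w; exact: F0.
transitivity (\int[mu]_a G (x0 - a)%R).
  apply: eq_integral => a _; rewrite /G -[RHS](IH x').
  - by apply: eq_integral => w _; rewrite esub_cons.
  - exact: (measurableT_comp mFc (measurable_fun_pair (measurable_cst (x0 - a)%R) (@measurable_id _ _ _))).
  - by move=> v; exact: F0.
rewrite ge0_integral_shift// => a.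
by apply: integral_ge0 => w _; exact: F0.
Qed.

(** If the whole space were null, Gaussians would have integral 0. *)
Lemma tuple_lebesgue_gt0 n : 0 < tuple_lebesgue n (@setT (euclid R n)).
Proof.
rewrite lt_neqAle measure_ge0 andbT; apply/eqP => /esym m0.
pose g (y : euclid R n) := (expR (- (1 * enorm y ^+ 2)) *
  expR (- (1 * enorm (esub [tuple 0%R | i < n] y) ^+ 2)))%:E.
have := @gaussian_convolution R n 1 1 [tuple 0%R | i < n] ltr01 ltr01.
rewrite -/(g _) (ae_eq_integral_any (g := cst 0)).
- rewrite integral0 => /esym/eqP; rewrite eqe gt_eqF//.
  by rewrite mulr_gt0 ?expR_gt0// powR_gt0// divr_gt0 ?pi_gt0.
- by move=> y _; rewrite lee_fin mulr_ge0 ?expR_ge0.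
- by [].
- by exists setT; split => //; exact: measurableT.
Qed.

End reflection.

Section null_sets.
Context (R : realType).
Notation mu := (@lebesgue_measure R).
Local Open Scope ereal_scope.

Lemma enorm_eq0_null n : (0 < n)%N ->
  tuple_lebesgue n [set x : euclid R n | enorm x = 0%R] = 0.
Proof.
case: n => // n _; set A := [set x | _].
have mA : measurable A.
  rewrite /A (_ : [set x | _] = (fun x : euclid R n.+1 => enorm x) @^-1` [set 0%R])//.
  rewrite -[X in measurable X]setTI; apply: measurable_enorm => //; exact: measurable_set1.
have i0 v : 0 <= (\1_A v : R)%:E by rewrite lee_fin.
have mi : measurable_fun setT (fun v => (\1_A v : R)%:E).
  by apply/measurable_EFinP; exact: measurable_indic.
have iA : \int[tuple_lebesgue n.+1]_v (\1_A v : R)%:E = tuple_lebesgue n.+1 A.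
  by rewrite integral_indic// setIT.
rewrite -iA (integral_tuple_lebesgueS mi i0).
rewrite (ae_eq_integral_any (g := cst 0)) ?integral0//.
- by move=> a _; apply: integral_ge0.
- exists [set 0%R]; split; first exact: measurable_set1.
    exact: lebesgue_measure_set1.
  move=> a; apply: contra_notP => /= an0 _; apply: integral0_eq => w _.
  rewrite indicE memNset// /A/= => e; apply: an0.
  have := enorm_cons a w; rewrite e expr0n/= => /esym/eqP.
  by rewrite paddr_eq0 ?sqr_ge0// sqrf_eq0 => /andP[/eqP].
Qed.

Lemma ae_enorm_gt0 n : (0 < n)%N ->
  {ae spacetime_lebesgue n, forall z : spacetime R n, (0 < enorm z.1)%R}.
Proof.
move=> n0; pose A := [set x : euclid R n | enorm x = 0%R].
have mA : measurable A.
  rewrite /A (_ : [set x | _] = (fun x : euclid R n => enorm x) @^-1` [set 0%R])//.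
  rewrite -[X in measurable X]setTI; apply: measurable_enorm => //; exact: measurable_set1.
exists (A `*` setT); split.
- exact: measurableX.
- have -> : spacetime_lebesgue n (A `*` setT) = tuple_lebesgue n A * mu setT.
    exact: product_measure1E.
  by rewrite enorm_eq0_null// mul0e.
- move=> z /=; rewrite lt_neqAle enorm_ge0 andbT => /negP; rewrite negbK => /eqP/esym.
  by [].
Qed.

(** The slice at time [tau] of the reflected null set is the reflection of the
    slice at [t - tau]; both reflections preserve Lebesgue measure. *)
Lemma reflect_null n (M : set (spacetime R n)) (x : euclid R n) (t : R) :
  measurable M -> spacetime_lebesgue n M = 0 ->
  {ae mu, forall tau : measurableTypeR R,
    {ae tuple_lebesgue n, forall y, ~ M (esub x y, (t - tau)%R)}}.
Proof.
move=> mM M0.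
pose F (z : spacetime R n) : \bar R := (\1_M z)%:E.
have F0 z : 0 <= F z by rewrite lee_fin.
have mF : measurable_fun setT F by apply/measurable_EFinP; exact: measurable_indic.
pose G (tau : measurableTypeR R) := \int[tuple_lebesgue n]_y F (y, tau).
have G0 tau : 0 <= G tau by apply: integral_ge0.
have mG : measurable_fun setT G by exact: (measurable_fun_fubini_tonelli_G F mF).
have intG : \int[mu]_tau G tau = 0.
  transitivity (\int[spacetime_lebesgue n]_z F z).
    by rewrite /spacetime_lebesgue/= fubini_tonelli2.
  by rewrite /F integral_indic// setIT.
have intG' : \int[mu]_tau G (t - tau)%R = 0 by rewrite ge0_integral_shift.
have mGt : measurable_fun setT (fun tau : measurableTypeR R => G (t - tau)%R).
  by apply: (measurableT_comp mG); meas.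
have := integral_eq0_ae measurableT mGt (fun tau _ => G0 (t - tau)%R) intG'.
apply: filterS => tau /(_ Logic.I) Gt.
have mFt : measurable_fun setT (fun y : euclid R n => F (esub x y, (t - tau)%R)).
  apply: (measurableT_comp mF); apply: measurable_fun_pair => //; meas.
have : \int[tuple_lebesgue n]_y F (esub x y, (t - tau)%R) = 0.
  rewrite (integral_esub x (F := fun y => F (y, (t - tau)%R)))//.
  by apply: (measurableT_comp mF); apply: measurable_fun_pair.
move=> /(integral_eq0_ae measurableT mFt (fun y _ => F0 _)).
apply: filterS => y /(_ Logic.I) /eqP; rewrite eqe indicE => + My.
by rewrite mem_set// oner_eq0.
Qed.

End null_sets.

(** * The integral operator J *)

Section J_lemmas.
Context (R : realType) (N : nat) (s : R).
Hypothesis s0 : 0 < s.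
Notation mu := (@lebesgue_measure R).
Local Notation Ipos := (`]0%R, +oo[%classic).
Notation ker y tau := (expR (- (enorm y ^+ 2 / (4 * tau))) / tau `^ (N%:R / 2 + 1 - s)).
Implicit Types g : spacetime R N -> R.

Let ker_ge0 (y : euclid R N) (tau : R) : 0 <= ker y tau.
Proof. exact: divr_ge0 (expR_ge0 _) (powR_ge0 _ _). Qed.

Definition J_const : R := (Gamma s * (4 * pi) `^ (N%:R / 2))^-1.

Lemma J_const_gt0 : 0 < J_const.
Proof.
rewrite invr_gt0; apply: mulr_gt0; first exact: Gamma_gt0.
by apply: powR_gt0; rewrite mulr_gt0// pi_gt0.
Qed.

Lemma J_le g1 g2 z : (forall z', 0 <= g1 z') -> (forall z', g1 z' <= g2 z') ->
  (J s g1 z <= J s g2 z)%E.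
Proof.
move=> g10 g12; apply: lee_wpmul2l; first by rewrite lee_fin; exact: ltW J_const_gt0.
apply: le_integral_any => tau _.
  by apply: integral_ge0 => y _; rewrite lee_fin; exact: mulr_ge0.
apply: le_integral_any => y _; first by rewrite lee_fin; exact: mulr_ge0.
by rewrite lee_fin; exact: ler_wpM2l.
Qed.

Lemma J_ge0 g z : (forall z', 0 <= g z') -> (0 <= J s g z)%E.
Proof.
move=> g0; apply: mule_ge0; first by rewrite lee_fin; exact: ltW J_const_gt0.
apply: integral_ge0 => tau _; apply: integral_ge0 => y _.
by rewrite lee_fin; exact: mulr_ge0.
Qed.

(** A function enters J through its time slices, reflected at [z]; those of
    a null set are null for almost all times. *)
Lemma J_ae_eq g1 g2 z : (forall z', 0 <= g1 z') -> (forall z', 0 <= g2 z') ->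
  {ae spacetime_lebesgue N, forall z', g1 z' = g2 z'} -> J s g1 z = J s g2 z.
Proof.
move=> g10 g20 [M [mM M0 gM]]; congr (_ * _)%E.
apply: ae_eq_integral_any => [tau _|tau _|].
- by apply: integral_ge0 => y _; rewrite lee_fin; exact: mulr_ge0.
- by apply: integral_ge0 => y _; rewrite lee_fin; exact: mulr_ge0.
apply: filterS (reflect_null z.1 z.2 mM M0) => tau nM _.
apply: ae_eq_integral_any => [y _|y _|].
- by rewrite lee_fin; exact: mulr_ge0.
- by rewrite lee_fin; exact: mulr_ge0.
apply: filterS nM => y nM _; congr (_ * _)%:E.
by apply: contrapT => g12; apply/nM/gM.
Qed.

Let integrand_measurable g : measurable_fun setT g ->
  measurable_fun setT (fun u : (spacetime R N * measurableTypeR R) * euclid R N =>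
    (ker u.2 u.1.2 * g (esub u.1.1.1 u.2, (u.1.1.2 : R) - (u.1.2 : R)))%:E).
Proof.
move=> mg; apply: measurable_fun_EFin; apply: measurable_fun_mul; first by meas.
apply: (measurableT_comp mg); apply: measurable_fun_pair.
  by apply: measurable_fun_esub; meas.
by apply: measurable_fun_add; meas.
Qed.

Lemma measurable_J g : measurable_fun setT g -> (forall z, 0 <= g z) ->
  measurable_fun setT (fun z => J s g z).
Proof.
move=> mg g0; rewrite /J; apply: emeasurable_funM; first exact: measurable_cst.
apply: (measurable_integral_in (T1 := spacetime R N) mu (measurable_itv `]0%R, +oo[)
  (f := fun z tau => \int[tuple_lebesgue N]_y
    (ker y tau * g (esub z.1 y, (z.2 : R) - (tau : R)))%:E)%E).
- apply: (measurable_integral_in (T1 := (spacetime R N * measurableTypeR R)%type)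
    (tuple_lebesgue N) measurableT (f := fun zt y =>
    (ker y zt.2 * g (esub zt.1.1 y, (zt.1.2 : R) - (zt.2 : R)))%:E)%E).
    exact: integrand_measurable.
  by move=> zt y; rewrite lee_fin; exact: mulr_ge0.
- move=> z tau; apply: integral_ge0 => y _; rewrite lee_fin; exact: mulr_ge0.
Qed.

Let measurable_slice g (z : spacetime R N) (tau : R) : measurable_fun setT g ->
  measurable_fun setT (fun y : euclid R N =>
    (ker y tau * g (esub z.1 y, (z.2 : R) - tau))%:E).
Proof.
move=> mg; apply: measurable_fun_EFin; apply: measurable_fun_mul; first by meas.
apply: (measurableT_comp mg); apply: measurable_fun_pair; last exact: measurable_cst.
by apply: measurable_fun_esub; meas.
Qed.

Let measurable_inner g (z : spacetime R N) : measurable_fun setT g -> (forall z, 0 <= g z) ->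
  measurable_fun setT (fun tau : measurableTypeR R => \int[tuple_lebesgue N]_y
    (ker y tau * g (esub z.1 y, (z.2 : R) - (tau : R)))%:E)%E.
Proof.
move=> mg g0; apply: (measurable_integral_in (T1 := measurableTypeR R)
    (tuple_lebesgue N) measurableT (f := fun tau y =>
    (ker y tau * g (esub z.1 y, (z.2 : R) - (tau : R)))%:E)%E).
  apply: measurable_fun_EFin; apply: measurable_fun_mul; first by meas.
  apply: (measurableT_comp mg); apply: measurable_fun_pair.
    by apply: measurable_fun_esub; meas.
  by apply: measurable_fun_add; meas.
by move=> tau y; rewrite lee_fin; exact: mulr_ge0.
Qed.

(** Monotone convergence, in the space integral and then in the time
    integral. *)
Lemma J_cvg (g_ : nat -> spacetime R N -> R) g z :
  (forall n, measurable_fun setT (g_ n)) -> (forall n z', 0 <= g_ n z') ->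
  (forall z', nondecreasing_seq (g_ ^~ z')) ->
  (forall z', g_ n z' @[n --> \oo] --> g z') ->
  (J s (g_ n) z @[n --> \oo] --> J s g z)%E.
Proof.
move=> mg g0 ndg cvg_g; apply: cvgeZl => //.
pose I n (tau : measurableTypeR R) : \bar R := (\int[tuple_lebesgue N]_y
    (ker y tau * g_ n (esub z.1 y, (z.2 : R) - (tau : R)))%:E)%E.
have cvgI tau : I n tau @[n --> \oo] --> (\int[tuple_lebesgue N]_y
    (ker y tau * g (esub z.1 y, (z.2 : R) - (tau : R)))%:E)%E.
  have e (y : euclid R N) : (ker y tau * g_ n (esub z.1 y, (z.2 : R) - (tau : R)))%:E @[n --> \oo] -->
     (ker y tau * g (esub z.1 y, (z.2 : R) - (tau : R)))%:E.
    by apply: cvg_EFin; [exact: nearW|apply: cvgMr; exact: cvg_g].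
  under [X in _ --> X]eq_integral do rewrite -(cvg_lim _ (e _))//.
  apply: cvg_monotone_convergence => //.
  - by move=> n; exact: measurable_slice.
  - by move=> n y _; rewrite lee_fin; exact: mulr_ge0.
  - by move=> y _ i j ij; rewrite lee_fin; apply: ler_wpM2l => //; exact: ndg.
have -> : (\int[mu]_(tau in Ipos) \int[tuple_lebesgue N]_y
    (ker y tau * g (esub z.1 y, (z.2 : R) - (tau : R)))%:E)%E =
  (\int[mu]_(tau in Ipos) limn (I ^~ tau))%E.
  by apply: eq_integral => tau _; rewrite (cvg_lim _ (cvgI tau)).
apply: cvg_monotone_convergence => //.
- by move=> n; apply: measurable_funTS; exact: measurable_inner.
- by move=> n tau _; apply: integral_ge0 => y _; rewrite lee_fin; exact: mulr_ge0.
- move=> tau _ i j ij; apply: le_integral_any => y _.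
    by rewrite lee_fin; exact: mulr_ge0.
  by rewrite lee_fin; apply: ler_wpM2l => //; exact: ndg.
Qed.

(** The kernel is positive, so all the reflected slices of [g] at times
    before that of [z] have integral 0. *)
Lemma J_eq0 g z : measurable_fun setT g -> (forall z', 0 <= g z') -> J s g z = 0%E ->
  {ae spacetime_lebesgue N, forall z', (z'.2 : R) < (z.2 : R) -> g z' = 0}.
Proof.
move=> mg g0 Jg0; case: z Jg0 => x t; rewrite /J => /eqP.
rewrite mule_eq0 => /orP[|/eqP/=].
  by rewrite eqe => /eqP e; have := J_const_gt0; rewrite /J_const e ltxx.
have mgE : measurable_fun setT (fun z' : spacetime R N => (g z')%:E) by exact: measurable_fun_EFin.
pose G (u : measurableTypeR R) : \bar R := (\int[tuple_lebesgue N]_y (g (y, u))%:E)%E.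
have mG : measurable_fun setT G by exact: (measurable_fun_fubini_tonelli_G _ mgE).
have G0 u : (0 <= G u)%E by apply: integral_ge0 => y _; rewrite lee_fin.
pose I (tau : measurableTypeR R) : \bar R := (\int[tuple_lebesgue N]_y
    (ker y tau * g (esub (x, t).1 y, ((x, t).2 : R) - (tau : R)))%:E)%E.
have I0 tau : Ipos tau -> (0 <= I tau)%E.
  by move=> _; apply: integral_ge0 => y _; rewrite lee_fin; exact: mulr_ge0.
have mI : measurable_fun (Ipos : set (measurableTypeR R)) I.
  by apply: measurable_funTS; exact: (measurable_inner (x, t) mg g0).
move=> intI0; have intI : (\int[mu]_(tau in Ipos) I tau = 0)%E by exact: intI0.
have H : {ae mu, forall tau : measurableTypeR R, Ipos tau -> G (t - (tau : R)) = 0%E}.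
  have H' := @integral_eq0_ae _ _ _ mu _ _ (measurable_itv _) mI I0 intI.
  apply: filterS H' => tau Ht tau0.
  have := integral_eq0_ae measurableT (measurable_slice (x, t) tau mg)
    (fun y _ => mulr_ge0 (ker_ge0 y tau) (g0 _)) (Ht tau0) => gy0.
  rewrite /G -(integral_esub x (F := fun y => (g (y, t - (tau : R)))%:E)).
  - rewrite (ae_eq_integral_any (g := cst 0%E)) ?integral0//.
      by move=> y _; rewrite lee_fin.
    apply: filterS gy0 => y /(_ Logic.I) /eqP + _; rewrite eqe mulf_eq0 => /orP[|/eqP->//].
    rewrite gt_eqF// divr_gt0 ?expR_gt0 ?powR_gt0//.
    by move: tau0; rewrite /= in_itv/= andbT.
  - by apply: (measurableT_comp mgE); apply: measurable_fun_pair.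
  - by move=> y; rewrite lee_fin.
pose D := [set u : measurableTypeR R | u < t].
have mD : measurable D.
  have -> : D = `]-oo, t[%classic by apply/seteqP; split => u; rewrite /= in_itv.
  exact: measurable_itv.
have GD0 u : (0 <= (G \_ D) u)%E by apply: erestrict_ge0.
have mGD : measurable_fun setT (G \_ D).
  by apply/(measurable_restrictT _ mD); exact: measurable_funTS.
have intGD : (\int[mu]_u (G \_ D) u = 0)%E.
  rewrite -(ge0_integral_shift t mGD GD0).
  rewrite (ae_eq_integral_any (g := cst 0%E)) ?integral0//.
  apply: filterS H => tau Ht _; rewrite patchE; case: ifPn => //.
  rewrite inE /D/= ltrBlDr ltrDl => tau0; apply: Ht.
  by rewrite /= in_itv/= andbT.
pose gD : spacetime R N -> \bar R := (fun z' => (g z')%:E) \_ (setT `*` D).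
have mXD : measurable ([set: euclid R N] `*` D) by exact: measurableX.
have mgD : measurable_fun setT gD.
  by apply/(measurable_restrictT _ mXD); exact: measurable_funTS.
have gD0 z' : (0 <= gD z')%E by apply: erestrict_ge0 => ? _; rewrite lee_fin.
have : (\int[spacetime_lebesgue N]_z' gD z' = 0)%E.
  transitivity (\int[mu]_u (G \_ D) u)%E; last exact: intGD.
  apply: (eq_trans (fubini_tonelli2 gD mgD gD0)).
  apply: eq_integral => u _; rewrite /fubini_G patchE; case: ifPn => uD.
    by apply: eq_integral => y _; rewrite /gD patchE ifT// inE; split => //=; rewrite -inE.
  apply: integral0_eq => y _; rewrite /gD patchE ifF//.
  by apply/negP; rewrite inE => -[_ /=]; rewrite -inE (negbTE uD).
move=> /(integral_eq0_ae measurableT mgD (fun z' _ => gD0 z')).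
apply: filterS => z' /(_ Logic.I); rewrite /gD patchE => + zt.
by rewrite ifT ?inE//; case.
Qed.

Lemma J_scale k g z : 0 <= k -> measurable_fun setT g -> (forall z', 0 <= g z') ->
  J s (fun z' => k * g z') z = (k%:E * J s g z)%E.
Proof.
move=> k0 mg g0; rewrite /J muleCA; congr (_ * _)%E.
rewrite -ge0_integralZl_EFin//; first last.
- by apply: measurable_funTS; exact: measurable_inner.
- by move=> tau _; apply: integral_ge0 => y _; rewrite lee_fin; exact: mulr_ge0.
apply: eq_integral => tau _; rewrite -ge0_integralZl_EFin//; first last.
- exact: measurable_slice.
- by move=> y _; rewrite lee_fin; exact: mulr_ge0.
by apply: eq_integral => y _; rewrite -EFinM mulrCA.
Qed.

End J_lemmas.

(** * Integrability of the profiles *)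

Section integrability.
Context (R : realType) (N : nat).
Notation mu := (@lebesgue_measure R).
Local Notation Ipos := (`]0%R, +oo[%classic).

(** Writing the power as a superposition of Gaussians reduces the
    finiteness to that of a Beta integral, which converges for [m < N]. *)
Lemma integral_powR_gaussian_lty (m c : R) : 0 < m -> m < N%:R -> 0 < c <= 1 ->
  (\int[tuple_lebesgue N]_y (enorm y `^ (- m) * expR (- (c * enorm y ^+ 2)))%:E < +oo)%E.
Proof.
move=> m0 mN /andP[c0 c1]; pose b := m / 2; pose nu : R := N%:R / 2.
have b0 : 0 < b by rewrite divr_gt0.
have nb : 0 < nu - b by rewrite /nu /b; lra.
have Gb0 := Gamma_gt0 b0.
pose K (y : euclid R N) (h : measurableTypeR R) : R := (Gamma b)^-1 * h `^ (b - 1) *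
  (expR (- (c * enorm y ^+ 2)) * expR (- (h * enorm y ^+ 2))).
have GV0 : 0 <= (Gamma b)^-1 by rewrite invr_ge0; exact: ltW Gb0.
have K0 y h : 0 <= K y h.
  exact: mulr_ge0 (mulr_ge0 GV0 (powR_ge0 _ _)) (mulr_ge0 (expR_ge0 _) (expR_ge0 _)).
have mK : measurable_fun setT (fun z : euclid R N * measurableTypeR R => (K z.1 z.2)%:E).
  by rewrite /K; meas.
apply: (@le_lt_trans _ _ (\int[tuple_lebesgue N]_y \int[mu]_(h in Ipos) (K y h)%:E)%E).
  apply: le_integral_any => y _; first by rewrite lee_fin mulr_ge0 ?powR_ge0 ?expR_ge0.
  set E := expR _; have E0 : 0 <= E by exact: expR_ge0.
  have -> : - m = - (2 * b) by rewrite /b; field.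
  rewrite mulrC EFinM.
  apply: (@le_trans _ _ (E%:E * \int[mu]_(h in Ipos)
      ((Gamma b)^-1 * (h `^ (b - 1) * expR (- (h * enorm y ^+ 2))))%:E)%E).
    by apply: lee_wpmul2l; [rewrite lee_fin|apply: powR_enorm_gamma_le => //; exact: enorm_ge0].
  rewrite -ge0_integralZl_EFin//; first last.
  - by apply: measurable_funTS; meas.
  - move=> h _; rewrite lee_fin.
    exact: mulr_ge0 GV0 (mulr_ge0 (powR_ge0 _ _) (expR_ge0 _)).
  apply: le_integral_any => h _.
    rewrite -EFinM lee_fin.
    exact: mulr_ge0 E0 (mulr_ge0 GV0 (mulr_ge0 (powR_ge0 _ _) (expR_ge0 _))).
  rewrite -EFinM lee_fin /K -/E le_eqVlt; apply/orP; left; apply/eqP; ring.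
rewrite (tonelli_in (tuple_lebesgue N) mu measurableT (measurable_itv _) mK); last first.
  by move=> y h; rewrite lee_fin.
pose C := (Gamma b)^-1 * (pi / c) `^ nu.
have C0 : 0 <= C by exact: mulr_ge0 GV0 (powR_ge0 _ _).
apply: (@le_lt_trans _ _ (\int[mu]_(h in Ipos)
  (C%:E * (h `^ (b - 1) * (1 + h) `^ (- (b + (nu - b))))%:E))%E); last first.
  rewrite ge0_integralZl_EFin//; first last.
  - by apply: measurable_funTS; meas.
  - by move=> h _; rewrite lee_fin mulr_ge0 ?powR_ge0.
  by rewrite (integral_beta b0 nb) -EFinM ltry.
apply: le_integral_any => h.
  by move=> _; apply: integral_ge0 => y _; rewrite lee_fin.
rewrite /= in_itv/= andbT => h0.
rewrite /K; under eq_integral do rewrite EFinM.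
pose o : euclid R N := [tuple 0 | i < N].
have oE (y : euclid R N) : enorm (esub o y) ^+ 2 = enorm y ^+ 2.
  rewrite !enorm_sqr; apply: eq_bigr => i _.
  by rewrite !tnth_mktuple sub0r sqrrN.
rewrite ge0_integralZl_EFin//; first last.
- exact: mulr_ge0 GV0 (powR_ge0 _ _).
- by meas.
under eq_integral do rewrite -oE.
rewrite (_ : (\int[tuple_lebesgue N]_y _)%E = ((pi / (c + h)) `^ nu)%:E); last first.
  transitivity (\int[tuple_lebesgue N]_y
     (expR (- (c * enorm y ^+ 2)) * expR (- (h * enorm (esub o y) ^+ 2)))%:E)%E.
    by apply: eq_integral => y _; rewrite oE.
  rewrite (gaussian_convolution _ c0 h0).
  have -> : enorm o ^+ 2 = 0.
    by rewrite enorm_sqr big1// => i _; rewrite tnth_mktuple expr0n.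
  by rewrite mulr0 oppr0 expR0 mulr1.
have bn : b + (nu - b) = nu by ring.
rewrite -!EFinM lee_fin /C bn.
have ch : 0 < c + h by rewrite addr_gt0.
have h1 : 0 < 1 + h by rewrite addr_gt0.
have p0 := pi_gt0 R.
apply: (@le_trans _ _ ((Gamma b)^-1 * h `^ (b - 1) * ((pi / c) `^ nu * (1 + h) `^ (- nu)))); last first.
  rewrite le_eqVlt; apply/orP; left; apply/eqP; ring.
apply: ler_wpM2l; first exact: mulr_ge0 GV0 (powR_ge0 _ _).
have nu0 : 0 <= nu by rewrite divr_ge0.
have -> : (pi / c) `^ nu * (1 + h) `^ (- nu) = (pi / c / (1 + h)) `^ nu.
  rewrite [RHS]powRM ?invr_ge0 ?(ltW h1) ?divr_ge0 ?(ltW p0) ?(ltW c0)//.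
  by rewrite -(powR_inv1 (ltW h1)) -powRrM mulN1r.
apply: ge0_ler_powR => //; rewrite ?nnegrE ?divr_ge0 ?(ltW p0) ?(ltW c0) ?(ltW h1) ?(ltW ch)//.
rewrite -mulrA ler_pM2l// -invfM lef_pV2 ?posrE ?mulr_gt0//.
by rewrite mulrDr mulr1 lerD2l ler_piMl// ltW.
Qed.

(** For bounded times the factor [(1 + t)^a] is bounded and the Gaussian
    is at most a fixed one, so that the time interval ]0, T[ separates. *)
Lemma profile_integrable (a m sg T : R) : 0 < m -> m < N%:R -> 0 < sg <= 1 ->
  (\int[spacetime_lebesgue N]_(z in [set z : spacetime R N | ((z.2 : R) < T)%R])
     (profile a m sg z)%:E < +oo)%E.
Proof.
move=> m0 mN /andP[sg0 sg1].
pose T' := Num.max T 1; have T'1 : 1 <= T' by rewrite le_max lexx orbT.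
have T'0 : 0 < T' by apply: lt_le_trans T'1.
pose A := (1 + T') `^ `|a|.
pose c := sg / (4 * (1 + T')).
have T40 : 0 < 4 * (1 + T') by rewrite mulr_gt0// addr_gt0.
have c01 : 0 < c <= 1.
  by rewrite divr_gt0//= ler_pdivrMr// mul1r; lra.
pose H := (\int[tuple_lebesgue N]_y (enorm y `^ (- m) * expR (- (c * enorm y ^+ 2)))%:E)%E.
have H0 : (0 <= H)%E by apply: integral_ge0 => y _; rewrite lee_fin mulr_ge0 ?powR_ge0 ?expR_ge0.
have Hfin : H \is a fin_num by rewrite ge0_fin_numE// integral_powR_gaussian_lty.
pose D : set (spacetime R N) := [set z | (z.2 : R) < T].
pose h (z : spacetime R N) : \bar R :=
  ((if 0 < (z.2 : R) then \1_`]0, T'[ (z.2 : R) else 0) *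
   (A * (enorm z.1 `^ (- m) * expR (- (c * enorm z.1 ^+ 2)))))%:E.
have h0 z : (0 <= h z)%E.
  rewrite lee_fin mulr_ge0//; first by case: ifP.
  by rewrite mulr_ge0 ?powR_ge0// mulr_ge0 ?powR_ge0 ?expR_ge0.
have mh : measurable_fun setT h.
  rewrite /h; apply: measurable_fun_EFin; apply: measurable_fun_mul; last by meas.
  apply: measurable_ltr_ite; first by meas.
  have mi : measurable_fun setT (\1_`]0, T'[ : measurableTypeR R -> R).
    by exact: measurable_indic.
  exact: (measurableT_comp mi (@measurable_snd _ _ _ _)).
rewrite integral_mkcond.
apply: (@le_lt_trans _ _ (\int[spacetime_lebesgue N]_z h z)%E).
  apply: le_integral_any => z _.
    by apply: erestrict_ge0 => ? _; rewrite lee_fin profile_ge0.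
  rewrite patchE; case: ifPn => [zD|_]; last exact: h0.
  rewrite /h /profile lee_fin; case: ifPn => t0; last by rewrite mul0r.
  have tT : (z.2 : R) < T' by move: zD; rewrite inE/= /D/= => /lt_le_trans; apply; rewrite le_max lexx.
  rewrite indicE mem_set ?mul1r; last by rewrite /= in_itv/= t0.
  rewrite -mulrA; set t := (z.2 : R) in t0 tT *.
  have t1 : 0 < 1 + t by rewrite addr_gt0.
  apply: ler_pM; rewrite ?powR_ge0//.
  - by rewrite mulr_ge0 ?powR_ge0 ?expR_ge0.
  - apply: (@le_trans _ _ ((1 + t) `^ `|a|)).
      by apply: ler_powR; [rewrite lerDl ltW|exact: ler_norm].
    by apply: ge0_ler_powR; rewrite ?nnegrE ?lerD2l ?(ltW tT) ?(ltW t1) ?addr_ge0 ?(ltW T'0).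
  - apply: ler_wpM2l; first exact: powR_ge0.
    have -> : sg * enorm z.1 ^+ 2 / (4 * (1 + t)) = sg / (4 * (1 + t)) * enorm z.1 ^+ 2 by ring.
    rewrite ler_expR lerN2; apply: ler_wpM2r; first exact: sqr_ge0.
    apply: ler_wpM2l; first exact: ltW.
    rewrite lef_pV2 ?posrE ?mulr_gt0//; move: tT; lra.
apply: (@le_lt_trans _ _ (\int[mu]_t ((A%:E * H) * (\1_`]0, T'[ t)%:E))%E).
  apply: (@le_trans _ _ (\int[mu]_t fubini_G (tuple_lebesgue N) h t)%E).
    by rewrite le_eqVlt; apply/orP; left; apply/eqP; exact: (fubini_tonelli2 h mh h0).
  apply: le_integral_any => t _; first by apply: integral_ge0 => y _; exact: h0.
  rewrite /fubini_G /h/=.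
  have [t0|t0] := ltP 0 t; last first.
    rewrite integral0_eq => [|y _]; last by rewrite mul0r.
    by rewrite mule_ge0// mule_ge0// lee_fin powR_ge0.
  under eq_integral do rewrite EFinM.
  rewrite ge0_integralZl_EFin//; first last.
  - by meas.
  - by move=> y _; rewrite lee_fin !mulr_ge0 ?powR_ge0 ?expR_ge0.
  under eq_integral do rewrite EFinM.
  have my : measurable_fun setT (fun y : euclid R N =>
    (enorm y `^ (- m) * expR (- (c * enorm y ^+ 2)))%:E) by meas.
  have y0 (y : euclid R N) : setT y -> (0 <= (enorm y `^ (- m) * expR (- (c * enorm y ^+ 2)))%:E)%E.
    by move=> _; rewrite lee_fin mulr_ge0 ?powR_ge0 ?expR_ge0.
  rewrite (ge0_integralZl_EFin _ measurableT y0 my (powR_ge0 _ _)).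
  by rewrite -/H muleC.
rewrite -(fineK Hfin) -EFinM.
rewrite ge0_integralZl_EFin//; first last.
- by rewrite mulr_ge0 ?powR_ge0// fine_ge0.
- by apply/measurable_EFinP; exact: measurable_indic.
rewrite integral_indic// setIT.
have mT : mu (`]0%R, T'[%classic : set R) = T'%:E.
  by rewrite lebesgue_measure_itv/= lte_fin T'0 -EFinB subr0.
apply: (@le_lt_trans _ _ ((A * fine H)%:E * T'%:E)%E); last by rewrite -EFinM ltry.
by rewrite -mT.
Qed.

End integrability.

(** * The exponent attached to a Hardy constant *)

Section hardy_parameters.
Context (R : realType) (N : nat) (s : R).
Hypotheses (s0 : 0 < s) (Ns : 2 * s < N%:R).

(** The four Gamma values of the two constants are the same. *)
Lemma Upsilon_riesz_const (al : R) : 0 <= al < (N%:R - 2 * s) / 2 ->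
  Upsilon N s al * riesz_const N s ((N%:R - 2 * s) / 2 - al) = 1.
Proof.
move=> /andP[al0 alb]; rewrite /Upsilon /riesz_const.
set m := (N%:R - 2 * s) / 2 - al.
have -> : (N%:R - 2 * s - 2 * al) / 4 = m / 2 by rewrite /m; field.
have -> : (N%:R + 2 * s - 2 * al) / 4 = m / 2 + s by rewrite /m; field.
have -> : (N%:R - 2 * s + 2 * al) / 4 = N%:R / 2 - (m / 2 + s) by rewrite /m; field.
have -> : (N%:R + 2 * s + 2 * al) / 4 = s + (N%:R / 2 - (m / 2 + s)) by rewrite /m; field.
have m0 : 0 < m / 2 by rewrite /m; lra.
have ms0 : 0 < m / 2 + s by exact: addr_gt0.
have d0 : 0 < N%:R / 2 - (m / 2 + s) by have := s0; rewrite /m; lra.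
have sd0 := addr_gt0 s0 d0.
have -> : 4 `^ (- s) = (2 `^ (2 * s) : R)^-1.
  have -> : 4 = (2 `^ 2 : R) by rewrite powR_mulrn//; ring.
  by rewrite -powRrM mulrN powRN.
have p2 : 2 `^ (2 * s) != 0 :> R by rewrite gt_eqF// powR_gt0.
move: p2 (lt0r_neq0 (Gamma_gt0 m0)) (lt0r_neq0 (Gamma_gt0 ms0))
  (lt0r_neq0 (Gamma_gt0 d0)) (lt0r_neq0 (Gamma_gt0 sd0)).
move: (2 `^ (2 * s)) (Gamma (m / 2)) (Gamma (m / 2 + s)) (Gamma (N%:R / 2 - (m / 2 + s)))
  (Gamma (s + (N%:R / 2 - (m / 2 + s)))) => g1 g2 g3 g4 g5 h1 h2 h3 h4 h5.
by field; rewrite h1 h2 h3 h4 h5.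
Qed.

Lemma hardy_mu_spec (lambda : R) : 0 < lambda < hardy_const N s ->
  0 < hardy_mu N s lambda < (N%:R - 2 * s) / 2 /\
  Upsilon N s ((N%:R - 2 * s) / 2 - hardy_mu N s lambda) = lambda.
Proof.
move=> ll; have [l0 lL] := andP ll.
have [al alb Ual] := Upsilon_surj s0 Ns ll.
rewrite /hardy_mu; set b := (N%:R - 2 * s) / 2 in alb *.
have sj : set_surj `[0, b[ [set lambda] (Upsilon N s).
  by move=> _ ->; exists al => //=; rewrite in_itv.
have [/andP[m0 mb] Um] : 0 <= pinv `[0, b[ (Upsilon N s) lambda < b /\
    Upsilon N s (pinv `[0, b[ (Upsilon N s) lambda) = lambda.
  split; last by apply: (surjpK _ sj); rewrite inE.
  have := surjpinv_image_sub (dflt := fun=> point) sj (imageP _ (erefl lambda)).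
  by rewrite /= in_itv.
move: m0 mb Um; set x := pinv _ _ _ => m0 xb Ux.
rewrite subKr; split=> //; apply/andP; split; first by rewrite subr_gt0.
rewrite gtrBl lt_neqAle m0 andbT; apply/eqP => x0.
by move: lL; rewrite -Ux -x0 Upsilon0 ltxx.
Qed.

(** [Upsilon] does not increase, so a larger [hardy_mu N s l1] would give
    [l1] a value of at least [Upsilon] at [m2]. *)
Lemma le_hardy_mu (l1 m2 : R) : 0 < l1 < hardy_const N s ->
  0 < m2 < (N%:R - 2 * s) / 2 -> l1 < Upsilon N s ((N%:R - 2 * s) / 2 - m2) ->
  hardy_mu N s l1 <= m2.
Proof.
move=> l1i /andP[m20 m2b] l1U; have [/andP[m10 m1b] U1] := hardy_mu_spec l1i.
rewrite leNgt; apply/negP => m21; move: l1U; rewrite -U1 ltNge => /negP; apply.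
apply: Upsilon_nonincreasing => //; lra.
Qed.

End hardy_parameters.

(** * Pointwise comparison of profiles *)

Section pointwise.
Context (R : realType) (N : nat) (s p : R).
Hypotheses (s0 : 0 < s) (p1 : 1 < p).

(** If the exponents of time and space are changed in the parabolic
    ratio 1 : 2, the quotient of two profiles depends on [r ^+ 2 / L] only. *)
Lemma parabolic_profile_quot (L r a m e c1 c2 : R) : 0 < L -> 0 < r ->
  L `^ (a - e) * r `^ (- (m - 2 * e)) * expR (- (c1 * r ^+ 2 / (4 * L))) =
  (r ^+ 2 / L) `^ e * expR (- ((c1 - c2) / 4 * (r ^+ 2 / L))) *
  (L `^ a * r `^ (- m) * expR (- (c2 * r ^+ 2 / (4 * L)))).
Proof.
move=> L0 r0; have X0 : 0 < r ^+ 2 / L by rewrite divr_gt0// exprn_gt0.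
rewrite !powR_expln// -!expRD; congr expR.
have -> : ln (r ^+ 2 / L) = 2 * ln r - ln L.
  by rewrite ln_div ?posrE ?exprn_gt0// lnXn// mulr_natl.
by field; rewrite gt_eqF.
Qed.

Lemma profile_gt0E (a m sg : R) (z : spacetime R N) : 0 < (z.2 : R) ->
  profile a m sg z = (1 + (z.2 : R)) `^ a * enorm z.1 `^ (- m) *
    expR (- (sg * enorm z.1 ^+ 2 / (4 * (1 + (z.2 : R))))).
Proof. by rewrite /profile => ->. Qed.

Lemma profile_le0E (a m sg : R) (z : spacetime R N) : (z.2 : R) <= 0 ->
  profile a m sg z = 0.
Proof. by move=> t0; rewrite /profile ltNge t0. Qed.

(** The powers of both sides are in parabolic ratio, and
    [m * (p - 1) <= 2 * s] makes the quotient a nonnegative power of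
    |x|^2 / (1 + t) times a decaying exponential, which is bounded. *)
Lemma profile_pow_le (m sg : R) : m * (p - 1) <= 2 * s -> 0 < sg ->
  exists2 M, 0 < M & forall z : spacetime R N, 0 < enorm z.1 ->
    profile (m / 2 - s / (p - 1)) m sg z `^ p <=
    M * profile (m / 2 - s / (p - 1)) (m + 2 * s) sg z.
Proof.
move=> mp sg0; pose e := s - m * (p - 1) / 2.
have e0 : 0 <= e by rewrite /e; lra.
have q0 : 0 < p - 1 by have := p1; lra.
have c0 : 0 < (p * sg - sg) / 4.
  by rewrite divr_gt0// -[X in _ - X]mul1r -mulrBl mulr_gt0.
have [M M0 HM] := powR_expR_bounded e0 c0; exists M => // z z0.
have [t0|t0] := ltP 0 (z.2 : R); last first.
  rewrite !(profile_le0E _ _ _ t0) powR0 ?mulr0//; have := p1; lra.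
rewrite !profile_gt0E//; set L := 1 + (z.2 : R); set r := enorm z.1 in z0 *.
have L0 : 0 < L by rewrite addr_gt0.
set a := m / 2 - s / (p - 1).
have -> : (L `^ a * r `^ (- m) * expR (- (sg * r ^+ 2 / (4 * L)))) `^ p =
    L `^ (a - e) * r `^ (- (m + 2 * s - 2 * e)) * expR (- (p * sg * r ^+ 2 / (4 * L))).
  rewrite !powR_expln ?mulr_gt0 ?powR_gt0 ?expR_gt0// -!expRD expRK; congr expR.
  rewrite /e /a; field; rewrite !gt_eqF//.
rewrite (parabolic_profile_quot _ _ _ _ sg L0 z0).
apply: ler_wpM2r; first by rewrite !mulr_ge0 ?powR_ge0 ?expR_ge0.
by apply: HM; rewrite divr_gt0// exprn_gt0.
Qed.

(** The quotient is a power of |x|^2 / (1 + t) with exponent between 0 and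
    [m / 2], times an exponential that decays since [sg < 1]; bounding the power by
    [1 + X `^ (m / 2)] makes the constant uniform in [m1]. *)
Lemma profile_source_le (m sg q : R) : 0 <= m -> sg < 1 ->
  exists2 M, 0 < M & forall (m1 : R) (z : spacetime R N), 0 <= m1 <= m -> 0 < enorm z.1 ->
    profile (m1 / 2 - q) (m1 + 2 * s) 1 z <= M * profile (m / 2 - q) (m + 2 * s) sg z.
Proof.
move=> m0 sg1.
have e0 : 0 <= m / 2 by rewrite divr_ge0.
have c0 : 0 < (1 - sg) / 4 by rewrite divr_gt0// subr_gt0.
have [M M0 HM] := powR_expR_bounded e0 c0.
exists (1 + M); first by rewrite addr_gt0.
move=> m1 z /andP[m10 m1m] z0.
have [t0|t0] := ltP 0 (z.2 : R); last by rewrite !(profile_le0E _ _ _ t0) mulr0.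
rewrite !profile_gt0E//; set L := 1 + (z.2 : R); set r := enorm z.1 in z0 *.
have L0 : 0 < L by rewrite addr_gt0.
pose e := (m - m1) / 2.
have -> : m1 / 2 - q = m / 2 - q - e by rewrite /e; field.
have -> : m1 + 2 * s = m + 2 * s - 2 * e by rewrite /e; field.
rewrite (parabolic_profile_quot _ _ _ _ sg L0 z0).
apply: ler_wpM2r; first by rewrite !mulr_ge0 ?powR_ge0 ?expR_ge0.
set X := r ^+ 2 / L; have X0 : 0 < X by rewrite divr_gt0// exprn_gt0.
have Xe : X `^ e <= 1 + X `^ (m / 2).
  have [X1|/ltW X1] := leP X 1.
    apply: (@le_trans _ _ 1); last by rewrite lerDl powR_ge0.
    by rewrite -(powRr0 X); apply: ger_powR; rewrite ?X0//; rewrite /e; lra.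
  apply: (@le_trans _ _ (X `^ (m / 2))); last by rewrite lerDr.
  by apply: ler_powR => //; rewrite /e; lra.
apply: (@le_trans _ _ ((1 + X `^ (m / 2)) * expR (- ((1 - sg) / 4 * X)))).
  by apply: ler_wpM2r => //; exact: expR_ge0.
rewrite mulrDl mul1r; apply: lerD; last exact: HM.
by rewrite -[leRHS]expR0 ler_expR oppr_le0; exact: mulr_ge0 (ltW c0) (ltW X0).
Qed.

End pointwise.

(** * Monotone iteration below a supersolution *)

Lemma lee_fin_eq (R : realType) (x y : R) (a b : \bar R) :
  x%:E = a -> y%:E = b -> (a <= b)%E -> x <= y.
Proof. by move=> <- <-; rewrite lee_fin. Qed.

Section monotone_iteration.
Context (R : realType) (N : nat) (s lambda p : R) (f V : spacetime R N -> R).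
Hypotheses (s0 : 0 < s) (l0 : 0 <= lambda) (p0 : 0 < p).
Hypotheses (mf : measurable_fun setT f) (f0 : forall z, 0 <= f z) (V0 : forall z, 0 <= V z).
Hypothesis V_super : forall z, 0 < enorm z.1 ->
  (J s (heat_rhs s lambda p f V) z <= (V z)%:E)%E.
Implicit Types w : spacetime R N -> R.

Lemma heat_rhs_ge0 w z : (forall z, 0 <= w z) -> 0 <= heat_rhs s lambda p f w z.
Proof.
by move=> w0; rewrite /heat_rhs !addr_ge0 ?powR_ge0// mulr_ge0// divr_ge0 ?powR_ge0.
Qed.

Lemma heat_rhs_le w1 w2 z : 0 <= w1 z -> w1 z <= w2 z ->
  heat_rhs s lambda p f w1 z <= heat_rhs s lambda p f w2 z.
Proof.
move=> w10 w12; rewrite /heat_rhs lerD2r lerD//.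
  by apply: ler_wpM2l => //; rewrite divr_ge0 ?powR_ge0.
by apply: ge0_ler_powR; rewrite ?nnegrE ?(ltW p0)// (le_trans w10).
Qed.

Lemma measurable_heat_rhs w : measurable_fun setT w ->
  measurable_fun setT (heat_rhs s lambda p f w).
Proof.
move=> mw; rewrite /heat_rhs; apply: measurable_fun_add => //; apply: measurable_fun_add; last by meas.
by apply: measurable_fun_mul => //; apply: measurable_fun_mul; [exact: measurable_cst|apply: measurable_fun_invr; meas].
Qed.

(** At the origin of the space J need not be below [V]; the value 0 keeps the
    iterates between 0 and [V] there. *)
Definition picard w (z : spacetime R N) : R :=
  if 0 < enorm z.1 then fine (J s (heat_rhs s lambda p f w) z) else 0.

Lemma picardE w z : (forall z, 0 <= w z <= V z) -> 0 < enorm z.1 ->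
  (picard w z)%:E = J s (heat_rhs s lambda p f w) z.
Proof.
move=> wV z0; have w0 z' : 0 <= w z' by have /andP[] := wV z'.
rewrite /picard z0 fineK// ge0_fin_numE; last first.
  by apply: J_ge0 => // z'; exact: heat_rhs_ge0.
apply: le_lt_trans (ltry (V z)); apply: le_trans (V_super z0).
apply: J_le => // z'; first exact: heat_rhs_ge0.
by apply: heat_rhs_le => //; have /andP[] := wV z'.
Qed.

Lemma picard_eq0 w z : enorm z.1 <= 0 -> picard w z = 0.
Proof. by rewrite /picard ltNge => ->. Qed.

Lemma measurable_picard w : measurable_fun setT w -> (forall z, 0 <= w z) ->
  measurable_fun setT (picard w).
Proof.
move=> mw w0; rewrite /picard; apply: measurable_ltr_ite; first by meas.
apply: (measurableT_comp (fine_measurable measurableT)).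
by apply: measurable_J => //; [exact: measurable_heat_rhs|move=> z; exact: heat_rhs_ge0].
Qed.

Local Opaque picard J.

Lemma picard_le w1 w2 : (forall z, 0 <= w1 z <= V z) -> (forall z, 0 <= w2 z <= V z) ->
  (forall z, w1 z <= w2 z) -> forall z, picard w1 z <= picard w2 z.
Proof.
move=> w1V w2V w12 z; have [z0|z0] := ltP 0 (enorm z.1); last by rewrite (picard_eq0 w1 z0) (picard_eq0 w2 z0).
apply: (lee_fin_eq (picardE w1V z0) (picardE w2V z0)); apply: J_le => // z'; last by apply: heat_rhs_le => //; have /andP[] := w1V z'.
by apply: heat_rhs_ge0 => z''; have /andP[] := w1V z''.
Qed.

Lemma picard_bounds w : (forall z, 0 <= w z <= V z) -> forall z, 0 <= picard w z <= V z.
Proof.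
move=> wV z; have w0 z' : 0 <= w z' by have /andP[] := wV z'.
have [z0|z0] := ltP 0 (enorm z.1); last by rewrite (picard_eq0 w z0) lexx V0.
apply/andP; split.
  apply: (lee_fin_eq (erefl 0%:E) (picardE wV z0)).
  by apply: J_ge0 => // z'; exact: heat_rhs_ge0.
apply: (lee_fin_eq (picardE wV z0) (erefl (V z)%:E)).
apply: le_trans (V_super z0); apply: J_le => // z'; first exact: heat_rhs_ge0.
by apply: heat_rhs_le => //; have /andP[] := wV z'.
Qed.

Let w_ n : spacetime R N -> R := iter n picard (cst 0).

Let w_bounds n z : 0 <= w_ n z <= V z.
Proof.
elim: n z => [|n IH] z; first by rewrite lexx V0.
exact: picard_bounds.
Qed.

Let measurable_w n : measurable_fun setT (w_ n).
Proof.
elim: n => [|n IH]; first exact: measurable_cst.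
by apply: measurable_picard => // z; have /andP[] := w_bounds n z.
Qed.

Let w_nd z : nondecreasing_seq (w_ ^~ z).
Proof.
apply/nondecreasing_seqP => n; elim: n z => [|n IH] z; first by have /andP[] := w_bounds 1 z.
exact: (picard_le (w_bounds n) (w_bounds n.+1) IH).
Qed.

Let w z : R := limn (w_ ^~ z).

Let cvg_w z : w_ n z @[n --> \oo] --> w z.
Proof.
apply: (nondecreasing_is_cvgn (w_nd z)).
by exists (V z) => _ [n _ <-]; have /andP[] := w_bounds n z.
Qed.

Lemma powR_cvg (u : nat -> R) (l : R) : (forall n, 0 <= u n <= l) ->
  u n @[n --> \oo] --> l -> u n `^ p @[n --> \oo] --> l `^ p.
Proof.
move=> ul cu; have [l1|l1] := ltP 0 l.
  apply: (@cvg_comp _ _ _ u (fun x : R => x `^ p) _ _ _ cu).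
  exact: continuous_powR_gt0.
have -> : u = cst l.
  by apply/funext => n; have := ul n => /andP[h1 h2]; apply/eqP; rewrite eq_le h2 (le_trans l1).
by apply: cvg_near_cst; exact: nearW.
Qed.

Let is_cvg_w z : cvgn (w_ ^~ z).
Proof. by apply/cvg_ex; exists (w z); exact: cvg_w. Qed.

(** Starting from 0 the iterates increase and stay below [V], since both
    are preserved by the monotone map [picard]. In the limit of the iteration
    [J_cvg] applies. *)
Lemma picard_fixed_point : exists w : spacetime R N -> R,
  [/\ measurable_fun setT w, forall z, 0 <= w z <= V z &
      forall z, 0 < enorm z.1 -> (w z)%:E = J s (heat_rhs s lambda p f w) z].
Proof.
exists w.
have w_le n z : w_ n z <= w z.
  have h := nondecreasing_cvgn_le (w_nd z) (@is_cvg_w z).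
  exact (h n).
have wV z : 0 <= w z <= V z.
  apply/andP; split; first exact: (w_le 0).
  apply: limr_le; first exact: is_cvg_w.
  by apply: nearW => n; have /andP[] := w_bounds n z.
split=> [|//|z z0].
  by apply: (measurable_fun_cvg measurable_w) => z _; exact: cvg_w.
have c1 : (w_ n.+1 z)%:E @[n --> \oo] --> (w z)%:E.
  apply: cvg_EFin; first exact: nearW.
  have := @cvg_w z; rewrite -(cvg_shiftS (w_ ^~ z)); exact.
have c2 : J s (heat_rhs s lambda p f (w_ n)) z @[n --> \oo] --> J s (heat_rhs s lambda p f w) z.
  apply: J_cvg => //.
  - by move=> n; exact: measurable_heat_rhs.
  - by move=> n z'; apply: heat_rhs_ge0 => z''; have /andP[] := w_bounds n z''.
  - move=> z' i j ij; apply: heat_rhs_le; last exact: w_nd.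
    by have /andP[] := w_bounds i z'.
  move=> z'; rewrite /heat_rhs; apply: cvgD; last exact: cvg_cst.
  apply: cvgD; first by apply: cvgMr; exact: cvg_w.
  apply: powR_cvg; last exact: cvg_w.
  by move=> n; rewrite w_le andbT; have /andP[] := w_bounds n z'.
have e : (fun n => (w_ n.+1 z)%:E) = (fun n => J s (heat_rhs s lambda p f (w_ n)) z).
  by apply/funext => n; exact: (picardE (w_bounds n) z0).
rewrite e in c1; exact: (etrans (esym (cvg_lim _ c1)) (cvg_lim _ c2)).
Qed.

End monotone_iteration.

(** * A small multiple of the profile is a supersolution *)

Section supersolution.
Context (R : realType) (N : nat) (s lambda p : R).
Implicit Types z : spacetime R N.

Lemma profile_enorm_eq0 (a m sg : R) z : 0 < m -> enorm z.1 = 0 -> profile a m sg z = 0.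
Proof.
move=> m0 z0; rewrite /profile z0 powR0 ?oppr_eq0 ?gt_eqF//.
by rewrite mulr0 mul0r if_same.
Qed.

Lemma profile_singular (a m sg : R) z : 0 < enorm z.1 ->
  profile a m sg z / enorm z.1 `^ (2 * s) = profile a (m + 2 * s) sg z.
Proof.
move=> z0; rewrite /profile; case: ifP => _; last by rewrite mul0r.
by rewrite opprD powRDp// (powRN _ (2 * s)); ring.
Qed.

(** Each of the three terms is at most a multiple of the same profile, and the
    last hypothesis says that the coefficients add up to at most [k * C]. At the
    origin of the space all profiles vanish. *)
Lemma heat_rhs_profile_le (a m sg k C M D : R) (f : spacetime R N -> R) :
  0 < s -> 1 < p -> 0 < m -> 0 <= C ->
  (forall z, 0 < enorm z.1 ->
     profile a m sg z `^ p <= M * profile a (m + 2 * s) sg z) ->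
  (forall z, f z <= D * profile a (m + 2 * s) sg z) ->
  C `^ p * M + D <= (k - lambda) * C ->
  forall z, heat_rhs s lambda p f (fun z => C * profile a m sg z) z <=
    k * C * profile a (m + 2 * s) sg z.
Proof.
move=> s0 p1 m0 C0 WM fD CMD z; rewrite /heat_rhs.
have := enorm_ge0 z.1; rewrite le_eqVlt => /predU1P[/esym z0|z0].
  have ms0 : 0 < m + 2 * s by lra.
  have := fD z; rewrite !(profile_enorm_eq0 _ _ _ z0)// !mulr0 powR0 ?gt_eqF ?add0r//.
  by lra.
rewrite powRM ?profile_ge0//.
set W := profile a m sg z; set G := profile a (m + 2 * s) sg z.
have G0 : 0 <= G by exact: profile_ge0.
have -> : lambda / enorm z.1 `^ (2 * s) * (C * W) = lambda * C * G.
  by rewrite /G -profile_singular// /W; ring.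
apply: (@le_trans _ _ (lambda * C * G + C `^ p * (M * G) + D * G)).
  apply: lerD; last exact: fD.
  by rewrite lerD2l; apply: ler_wpM2l; [exact: powR_ge0|exact: WM].
have -> : lambda * C * G + C `^ p * (M * G) + D * G = (lambda * C + (C `^ p * M + D)) * G by ring.
by apply: ler_wpM2r => //; lra.
Qed.

(** [riesz_const] is the inverse of [Upsilon], so applying J to
    [Upsilon * C] times the source profile gives back at most [C] times the profile. *)
Lemma J_profile_super (al m sg a C : R) : 0 < s -> 2 * s < N%:R ->
  m = (N%:R - 2 * s) / 2 - al -> 0 <= al < (N%:R - 2 * s) / 2 ->
  m + 2 * s < N%:R -> 0 < sg <= 1 -> 0 <= C ->
  0 <= a + (N%:R / 2 - m - s + 1) -> 0 <= a + sg * (N%:R / 2 - m - s + 1) ->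
  forall z (g : spacetime R N -> R), 0 < enorm z.1 -> (forall z', 0 <= g z') ->
    (forall z', g z' <= Upsilon N s al * C * profile a (m + 2 * s) sg z') ->
    (J s g z <= (C * profile a m sg z)%:E)%E.
Proof.
move=> s0 Ns mE ali mN sg01 C0 ak ask z g z0 g0 gU.
have m0 : 0 < m by have := ali; rewrite mE; lra.
have U1 := Upsilon_riesz_const s0 ali; rewrite -mE in U1.
have U0 : 0 <= Upsilon N s al.
  rewrite mulr_ge0 ?powR_ge0//.
  have := s0; have := Ns; have /andP[] := ali; move=> h1 h2 h3 h4.
  apply: divr_ge0; apply: mulr_ge0; apply/ltW/Gamma_gt0; lra.
have kC0 : 0 <= Upsilon N s al * C by exact: mulr_ge0.
apply: (@le_trans _ _ ((Upsilon N s al * C)%:E * J s (profile a (m + 2 * s) sg) z)%E).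
  rewrite -(J_scale s z kC0 (measurable_profile _ _ _) (profile_ge0 _ _ _)).
  exact: J_le.
apply: (@le_trans _ _ ((Upsilon N s al * C)%:E * (riesz_const N s m * profile a m sg z)%:E)%E).
  rewrite lee_wpmul2l ?lee_fin//.
  by case: z z0 => x t x0; exact: J_profile_le.
have aux (u r c q : R) : u * r = 1 -> u * c * (r * q) = c * q.
  by move=> ur; rewrite mulrACA ur mul1r.
by rewrite -EFinM (aux _ _ _ _ U1).
Qed.

End supersolution.

Section parameters.
Context (R : realType).

(** The conclusions are strict inequalities that hold at [m0]: the second by the
    upper bound on [p], the third by the lower one. Hence they persist for [m]
    slightly larger. *)
Lemma exponent_choice (n s p m0 : R) : 0 < s -> 1 < p -> 0 < m0 < (n - 2 * s) / 2 ->
  m0 * (p - 1) < 2 * s -> 2 * s < (p - 1) * (n - m0 + 2 - 2 * s) ->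
  exists m, [/\ m0 < m < (n - 2 * s) / 2, m * (p - 1) < 2 * s &
    0 < m / 2 - s / (p - 1) + (n / 2 - m - s + 1)].
Proof.
move=> s0 p1 /andP[m00 m0b] mp pn.
have q0 : 0 < p - 1 by rewrite subr_gt0.
pose q := 2 * s / (p - 1).
have h1 : m0 < q by rewrite ltr_pdivlMr.
have h2 : q < n - m0 + 2 - 2 * s by rewrite ltr_pdivrMr// [ltRHS]mulrC.
have sq : s / (p - 1) = q / 2 by rewrite /q; field; rewrite gt_eqF.
pose e := Num.min ((n - 2 * s) / 2 - m0) (Num.min (q - m0) (n - m0 + 2 - 2 * s - q)).
have [e1 e2 e3] : [/\ e <= (n - 2 * s) / 2 - m0, e <= q - m0 & e <= n - m0 + 2 - 2 * s - q].
  by rewrite !ge_min !lexx !orbT.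
have e0 : 0 < e by rewrite !lt_min; apply/andP; split; [|apply/andP; split]; lra.
exists (m0 + e / 2); rewrite sq; split; last by lra.
- by apply/andP; split; lra.
- by rewrite -ltr_pdivlMr// -/q; lra.
Qed.

(** The conclusion holds strictly at [sg = 1], hence also for some smaller
    value. *)
Lemma contraction_choice (a k : R) : a < 0 -> 0 < a + k ->
  exists2 sg, 0 < sg < 1 & 0 <= a + sg * k.
Proof.
move=> a0 ak; have k0 : 0 < k by lra.
(* The midpoint of [- a / k], which is less than 1, and 1. *)
exists ((1 - a / k) / 2).
  have h : - a / k < 1 by rewrite ltr_pdivrMr//; lra.
  have h' : 0 < - a / k by rewrite divr_gt0//; lra.
  by rewrite mulNr in h h'; apply/andP; split; lra.
have -> : (1 - a / k) / 2 * k = (k - a) / 2 by field; rewrite gt_eqF.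
lra.
Qed.

(** As [p > 1], a small amplitude makes the nonlinear term an arbitrarily
    small fraction of the linear one. *)
Lemma amplitude_choice (p M e : R) : 1 < p -> 0 < M -> 0 < e ->
  exists2 C, 0 < C & C `^ p * M <= e * C.
Proof.
move=> p1 M0 e0; have q0 : 0 < p - 1 by rewrite subr_gt0.
have eM : 0 < e / M by exact: divr_gt0.
pose C := (e / M) `^ (p - 1)^-1; have C0 : 0 < C by exact: powR_gt0.
exists C => //.
have Cp : C `^ (p - 1) = e / M.
  by rewrite /C -powRrM mulVf ?gt_eqF// powRr1// ltW.
have -> : C `^ p = e / M * C.
  have -> : C `^ p = C `^ (p - 1 + 1) by congr powR; ring.
  by rewrite powRDp// Cp powRr1// ltW.
have -> : e / M * C * M = e * C by field; rewrite gt_eqF.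
exact: lexx.
Qed.

Lemma source_choice (l k L C M : R) : l < k -> l < L -> 0 < C -> 0 < M ->
  exists delta l1, [/\ 0 < delta, l + delta < L, l < l1 < l + delta, l1 < k &
    delta * M <= (k - l) / 2 * C].
Proof.
move=> lk lL C0 M0.
have e0 : 0 < (k - l) / 2 by lra.
have e1 : 0 < (k - l) / 2 * C / M by rewrite divr_gt0// mulr_gt0.
pose delta := Num.min ((k - l) / 2 * C / M) ((L - l) / 2).
pose eps := Num.min delta ((k - l) / 2).
have [d1 d2] : delta <= (k - l) / 2 * C / M /\ delta <= (L - l) / 2.
  by rewrite !ge_min !lexx orbT.
have [h1 h2] : eps <= delta /\ eps <= (k - l) / 2 by split; rewrite ge_min lexx ?orbT.
have d0 : 0 < delta by rewrite lt_min e1; lra.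
have eps0 : 0 < eps by rewrite lt_min d0.
exists delta, (l + eps / 2); split; rewrite -?ler_pdivlMr//; lra.
Qed.

End parameters.

(** * Function classes on space-time *)

Section function_spaces.
Context (R : realType) (N : nat).
Notation mu := (@lebesgue_measure R).
Notation nu := (spacetime_lebesgue N).
Implicit Types f g : spacetime R N -> R.

Lemma ae_time_neq0 : {ae nu, forall z : spacetime R N, (z.2 : R) != 0}.
Proof.
exists ([set: euclid R N] `*` [set (0 : measurableTypeR R)]); split.
- by apply: measurableX => //; exact: measurable_set1.
- have -> : nu ([set: euclid R N] `*` [set (0 : measurableTypeR R)]) =
      (tuple_lebesgue N [set: euclid R N] * mu [set 0%R])%E.
    by apply: product_measure1E => //; exact: measurable_set1.
  by rewrite lebesgue_measure_set1 mule0.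
- by move=> [x t] /= /negP; rewrite negbK => /eqP.
Qed.

Lemma measurable_past (T : R) :
  measurable [set z : spacetime R N | (z.2 : R) < T].
Proof.
rewrite (_ : [set z | _] = setT `*` `]-oo, T[%classic).
  by apply: measurableX => //; exact: measurable_itv.
by apply/seteqP; split => [z|z []]/=; rewrite in_itv.
Qed.

(** A Borel representative of [f] is clipped between 0 and [B]; almost
    everywhere it is already within these bounds. *)
Lemma dominated_repr f (B : spacetime R N -> R) : complete_measurable_fun nu setT f -> (forall z, 0 <= f z) ->
  measurable_fun setT B -> (forall z, 0 <= B z) ->
  (forall z : spacetime R N, (z.2 : R) <= 0 -> B z = 0) ->
  {ae nu, forall z : spacetime R N, (z.2 : R) < 0 -> f z = 0} ->
  {ae nu, forall z : spacetime R N, 0 < (z.2 : R) -> f z <= B z} ->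
  exists g, [/\ measurable_fun setT g, forall z, 0 <= g z <= B z & {ae nu, forall z, f z = g z}].
Proof.
move=> mf f0 mB B0 Bt fneg fpos; have [h mh fh] := complete_measurable_repr mf.
exists (fun z => Num.min (Num.max (h z) 0) (B z)); split.
- apply: measurable_minr => //; apply: measurable_maxr => //.
- by move=> z; rewrite le_min B0 le_max lexx orbT ge_min lexx orbT.
apply: filterS3 (filterI fh ae_time_neq0) fneg fpos => z [fhz t0] fn fp.
rewrite -fhz max_l//; apply/esym/min_l.
have [t1|t1|t1] := ltgtP (z.2 : R) 0.
- by rewrite fn.
- exact: fp.
- by rewrite t1 eqxx in t0.
Qed.

(** The set of points later than [T] has positive measure. *)
Lemma late_time_exists (T : R) (P : spacetime R N -> Prop) : {ae nu, forall z, P z} ->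
  exists2 z : spacetime R N, T < (z.2 : R) & P z.
Proof.
move=> aeP; apply: contrapT => nP.
pose A := [set: euclid R N] `*` (`]T, +oo[%classic : set (measurableTypeR R)).
have mA : measurable A by apply: measurableX => //; exact: measurable_itv.
have A0 : nu A = 0%E.
  apply: measure_negligible => //.
  apply: negligibleS aeP => z [_ /=]; rewrite in_itv/= andbT => Tz Pz.
  by apply: nP; exists z.
have : nu A = (tuple_lebesgue N [set: euclid R N] * mu `]T, +oo[%classic)%E.
  by apply: product_measure1E => //; exact: measurable_itv.
rewrite A0 (_ : mu `]T, +oo[%classic = +oo%E).
  by rewrite gt0_muley//; exact: tuple_lebesgue_gt0.
by rewrite lebesgue_measure_itv/= ltry.
Qed.

Section dominated.
Variables (a m sg k : R) (f g : spacetime R N -> R).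
Hypotheses (m0 : 0 < m) (mN : m < N%:R) (sg01 : 0 < sg <= 1) (k0 : 0 <= k).
Hypotheses (f0 : forall z, 0 <= f z) (mg : measurable_fun setT g).
Hypotheses (fg : {ae nu, forall z, f z = g z}) (gk : forall z, g z <= k * profile a m sg z).

Let finite_norm_past (T : R) (D : set (spacetime R N)) :
  (forall z, D z -> (z.2 : R) < T) -> finite_norm nu 1%:E (f \_ D).
Proof.
move=> DT; rewrite /finite_norm Lnorm1; set E := [set z : spacetime R N | (z.2 : R) < T].
apply: (@le_lt_trans _ _ (\int[nu]_z ((fun z => (k * profile a m sg z)%:E) \_ E) z)%E).
  apply: ae_le_integral_any => [z _|z _|].
  - exact: abse_ge0.
  - by apply: erestrict_ge0 => ? _; rewrite lee_fin; exact: mulr_ge0 k0 (profile_ge0 _ _ _ _).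
  apply: filterS fg => z fgz _; rewrite /= patchE; case: ifPn => zD; last first.
    by rewrite normr0; apply: erestrict_ge0 => ? _; rewrite lee_fin; exact: mulr_ge0 k0 (profile_ge0 _ _ _ _).
  rewrite patchE ifT; last by rewrite inE; apply: DT; rewrite -inE.
  by rewrite ger0_norm// lee_fin fgz.
rewrite -integral_mkcond.
under eq_integral do rewrite EFinM.
rewrite (ge0_integralZl_EFin _ _ _ _ k0).
- apply: lte_mul_pinfty => //; last exact: (profile_integrable a T m0 mN sg01).
- exact: measurable_past.
- by move=> z _; rewrite lee_fin; exact: profile_ge0.
- by apply: measurable_funTS; apply: measurable_fun_EFin; exact: measurable_profile.
Qed.

Let mf (D : set (spacetime R N)) : measurable D -> complete_measurable_fun nu D f.
Proof. by move=> mD; exact: (complete_measurable_ae_eq mD mg fg). Qed.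

Lemma in_L1_dominated (T : R) : in_Lq nu 1 [set z : spacetime R N | (z.2 : R) < T] f.
Proof.
split; last exact: (@finite_norm_past T).
by apply: mf; exact: measurable_past.
Qed.

(** A compact set is bounded in time, so it lies in a half-space where the
    profile is integrable. *)
Lemma in_L1_loc_dominated : in_Lq_loc 1 f.
Proof.
split=> [|K cK]; first exact: mf.
have cK2 : compact [set z.2 | z in K].
  apply: continuous_compact cK; apply: continuous_subspaceT => z; exact: cvg_snd.
have [M [_ HM]] := compact_bounded cK2.
apply: (@finite_norm_past (`|M| + 2)) => z Kz.
have := HM (`|M| + 1) _ z.2 _.
rewrite (le_lt_trans (ler_norm M)) ?ltrDl// => /(_ isT).
have zK : [set z0.2 | z0 in K] (z.2 : R) by exists (spacetime_rV z).
move=> /(_ zK) /(le_trans (ler_norm _)) h; apply: le_lt_trans h _; lra.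
Qed.

End dominated.
End function_spaces.

(** * The solution *)

Section solution.
Context (R : realType) (N : nat) (s lambda p k C a a1 m m1 sg delta1 : R).
Notation nu := (spacetime_lebesgue N).
Hypotheses (N0 : (0 < N)%N) (s0 : 0 < s) (l0 : 0 <= lambda) (p0 : 0 < p).
Hypotheses (m0 : 0 < m) (mN : m + 2 * s < N%:R) (sg01 : 0 < sg <= 1).
Hypotheses (k0 : 0 <= k) (C0 : 0 <= C) (d0 : 0 <= delta1).
Local Notation V := (fun z : spacetime R N => C * profile a m sg z).
Local Notation B := (fun z : spacetime R N => delta1 * profile a1 (m1 + 2 * s) 1 z).
Hypothesis heat_le : forall g : spacetime R N -> R, (forall z, 0 <= g z <= B z) ->
  forall z, heat_rhs s lambda p g V z <= k * C * profile a (m + 2 * s) sg z.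
Hypothesis super : forall z (g : spacetime R N -> R), 0 < enorm z.1 -> (forall z', 0 <= g z') ->
    (forall z', g z' <= k * C * profile a (m + 2 * s) sg z') ->
    (J s g z <= (V z)%:E)%E.

(** The iteration is run for a Borel representative of [f] that obeys the
    bound on [f] everywhere, because the supersolution estimate is pointwise.
    The passage back to [f] does not affect J. *)
Lemma small_source_solution (f : spacetime R N -> R) :
  complete_measurable_fun nu setT f -> (forall z, 0 <= f z) ->
  ~ {ae nu, forall z, f z = 0} ->
  {ae nu, forall z : spacetime R N, (z.2 : R) < 0 -> f z = 0} ->
  {ae nu, forall z : spacetime R N, 0 < (z.2 : R) -> f z <= B z} ->
  exists w : spacetime R N -> R,
    [/\ very_weak_solution s lambda p f w, ~ {ae nu, forall z, w z = 0} & in_Lq_loc 1 w].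
Proof.
move=> mf f0 fnz fneg fpos.
have mB : measurable_fun setT B by apply: measurable_fun_mul; [exact: measurable_cst|exact: measurable_profile].
have B0 z : 0 <= B z by exact: mulr_ge0 d0 (profile_ge0 _ _ _ _).
have Bt (z : spacetime R N) : (z.2 : R) <= 0 -> B z = 0.
  by move=> t0; rewrite (profile_le0E _ _ _ t0) mulr0.
have V0 z : 0 <= V z by exact: mulr_ge0 C0 (profile_ge0 _ _ _ _).
have [g [mg gB fg]] := dominated_repr mf f0 mB B0 Bt fneg fpos.
have g0 z : 0 <= g z by have /andP[] := gB z.
have V_super z : 0 < enorm z.1 -> (J s (heat_rhs s lambda p g V) z <= (V z)%:E)%E.
  move=> z0; apply: super z0 _ (heat_le gB) => z'; exact: heat_rhs_ge0.
have [w [mw wV wJ]] := picard_fixed_point s0 l0 p0 mg g0 V0 V_super.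
have w0 z : 0 <= w z by have /andP[] := wV z.
pose h := heat_rhs s lambda p g w; pose hf := heat_rhs s lambda p f w.
have h0 z : 0 <= h z by exact: heat_rhs_ge0.
have hf0 z : 0 <= hf z by exact: heat_rhs_ge0.
have mh : measurable_fun setT h by exact: measurable_heat_rhs.
have hfh : {ae nu, forall z, hf z = h z}.
  by apply: filterS fg => z fgz; rewrite /hf /h /heat_rhs fgz.
have hV z : h z <= k * C * profile a (m + 2 * s) sg z.
  apply: le_trans (heat_le gB z); apply: heat_rhs_le => //; by have /andP[] := wV z.
have kC0 : 0 <= k * C by exact: mulr_ge0.
have ms0 : 0 < m + 2 * s by rewrite addr_gt0// mulr_gt0.
have mN' : m < N%:R by apply: lt_trans mN; rewrite ltrDl mulr_gt0.
have wL : in_Lq_loc 1 w.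
  apply: (in_L1_loc_dominated m0 mN' sg01 C0 w0 mw) => [|z].
    by apply: filterE.
  have /andP[_ wVz] := wV z; exact wVz.
exists w; split=> //.
  split=> //; exists 1; first by rewrite lexx ler1n.
  split=> //.
  - by move=> T; exact: (in_L1_dominated ms0 mN sg01 kC0 hf0 mh hfh hV).
  - apply: filterS fneg => z fz t0.
    have wz : w z = 0.
      apply/eqP; rewrite eq_le w0 andbT; have /andP[_] := wV z.
      by rewrite (profile_le0E _ _ _ (ltW t0)) mulr0.
    by rewrite /heat_rhs wz fz// mulr0 powR0 ?gt_eqF// !addr0.
  - apply: filterS (ae_enorm_gt0 R N0) => z z0.
    by rewrite (wJ z z0) (J_ae_eq s z hf0 h0 hfh).
move=> wz; apply: fnz.
have h_past (n : nat) : {ae nu, forall z : spacetime R N, (z.2 : R) < n%:R -> h z = 0}.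
  have [z nz [wz0 z0]] := late_time_exists n%:R (filterI wz (ae_enorm_gt0 R N0)).
  have Jz : J s h z = 0%E by rewrite -(wJ z z0) wz0.
  have : {ae nu, forall z' : spacetime R N, (z'.2 : R) < (z.2 : R) -> h z' = 0}.
    exact: (@J_eq0 R N s s0 h z mh h0 Jz).
  apply: filterS => z' h' z'n.
  by apply: h'; exact: lt_trans nz.
apply: filterS2 fg (ae_foralln h_past) => z fgz hz.
have hz0 : h z = 0.
  apply: (hz (Num.truncn (z.2 : R)).+1); exact: truncnS_gt.
apply/eqP; rewrite eq_le f0 andbT fgz -hz0 /h /heat_rhs lerDr addr_ge0 ?powR_ge0//.
by rewrite mulr_ge0// divr_ge0 ?powR_ge0.
Qed.

End solution.

Unset Implicit Arguments.

Theorem corollary6p8 (R : realType) (N : nat) (s lambda p : R)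
  (hN : (2 <= N)%N)
  (hs : 0 < s < 1)
  (hlambda : 0 < lambda < hardy_const N s)
  (hp : 1 + 2 * s / (N%:R - hardy_mu N s lambda + 2 - 2 * s) < p
        < 1 + 2 * s / hardy_mu N s lambda) :
  exists delta : R, [/\ 0 < delta, lambda + delta < hardy_const N s &
    forall delta1 : R, 0 < delta1 < delta ->
    exists lambda1 : R, lambda < lambda1 < lambda + delta /\
      forall f : spacetime R N -> R,
        complete_measurable_fun (spacetime_lebesgue N) setT f ->
        (forall z, 0 <= f z) ->
        ~ {ae spacetime_lebesgue N, forall z, f z = 0} ->
        {ae spacetime_lebesgue N,
          forall z : spacetime R N, (z.2 : R) < 0 -> f z = 0} ->
        {ae spacetime_lebesgue N,
          forall z : spacetime R N, 0 < (z.2 : R) ->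
            f z <= delta1
                   * (1 + (z.2 : R)) `^ (hardy_mu N s lambda1 / 2 - s / (p - 1))
                   * enorm z.1 `^ (- hardy_mu N s lambda1 - 2 * s)
                   * expR (- (enorm z.1 ^+ 2 / (4 * (1 + (z.2 : R)))))} ->
        exists w : spacetime R N -> R,
          [/\ very_weak_solution s lambda p f w,
              ~ {ae spacetime_lebesgue N, forall z, w z = 0} &
              in_Lq_loc 1 w]].
Proof.
have /andP[s0 s1] := hs; have /andP[l0 lL] := hlambda.
have N2 : 2 <= N%:R :> R by rewrite ler_nat.
have Ns : 2 * s < N%:R by lra.
have [mu0 Umu] := hardy_mu_spec s0 Ns hlambda.
have [mu_gt0 mu_lt] := andP mu0.
set mu := hardy_mu N s lambda in hp mu0 Umu mu_gt0 mu_lt.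
have den0 : 0 < N%:R - mu + 2 - 2 * s by lra.
have /andP[p_lo p_hi] := hp.
have p1 : 1 < p by apply: le_lt_trans p_lo; rewrite lerDl divr_ge0// ?ltW// mulr_gt0.
have q0 : 0 < p - 1 by rewrite subr_gt0.
have hp1 : mu * (p - 1) < 2 * s by rewrite mulrC -ltr_pdivlMr//; lra.
have hp2 : 2 * s < (p - 1) * (N%:R - mu + 2 - 2 * s) by rewrite -ltr_pdivrMr//; lra.
have [m [/andP[mu_m m_lt] mp ak]] := exponent_choice s0 p1 mu0 hp1 hp2.
have m0 : 0 < m by lra.
have s20 : 0 < 2 * s by rewrite mulr_gt0.
pose al := (N%:R - 2 * s) / 2 - m.
have ali : 0 <= al < (N%:R - 2 * s) / 2 by rewrite /al; apply/andP; split; lra.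
have mE : m = (N%:R - 2 * s) / 2 - al by rewrite /al; ring.
pose k := Upsilon N s al.
have lk : lambda < k.
  rewrite -Umu; apply: Upsilon_decreasing => //; rewrite ?Umu// /al; lra.
pose q := s / (p - 1); pose a := m / 2 - q.
have mq : m < 2 * q by rewrite /q mulrA ltr_pdivlMr.
have a0 : a < 0 by rewrite /a; lra.
have ak' := ltW ak.
have [sg /andP[sg0 sg1] ask] := contraction_choice a0 ak.
have sg01 : 0 < sg <= 1 by rewrite sg0 ltW.
have mN : m + 2 * s < N%:R by lra.
have [M1 M10 HM1] := profile_pow_le N p1 (ltW mp) sg0.
have [M2 M20 HM2] := profile_source_le N s q (ltW m0) sg1.
have e0 : 0 < (k - lambda) / 2 by rewrite divr_gt0// subr_gt0.
have [C C0 HC] := amplitude_choice p1 M10 e0.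
have [delta [lambda1 [d0 dL l1 l1k dC]]] := source_choice lk lL C0 M20.
exists delta; split; [exact: d0|exact: dL|move=> delta1 /andP[d10 d1d]].
exists lambda1; split; first exact: l1.
have l1i : 0 < lambda1 < hardy_const N s.
  have /andP[l1a l1b] := l1.
  by rewrite (lt_trans l0 l1a)/=; exact: lt_trans l1b dL.
have mi : 0 < m < (N%:R - 2 * s) / 2 by apply/andP; split.
have m1m := le_hardy_mu s0 Ns l1i mi l1k.
have [/andP[m10 _] _] := hardy_mu_spec s0 Ns l1i.
set m1 := hardy_mu N s lambda1 in m1m m10 *.
have m1i : 0 <= m1 <= m by rewrite (ltW m10).
have N0 : (0 < N)%N by exact: leq_trans hN.
have k0 : 0 <= k by exact: ltW (lt_trans l0 lk).
have p0 : 0 < p by exact: lt_trans ltr01 p1.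
move=> f mf f0 fnz fneg fpos.
apply: (@small_source_solution R N s lambda p k C a (m1 / 2 - q) m m1 sg delta1) => //.
- exact: ltW.
- exact: ltW.
- exact: ltW.
- move=> g gB.
  apply: (@heat_rhs_profile_le R N s lambda p a m sg k C M1 (delta1 * M2)) => //.
  + exact: ltW.
  + move=> z; have /andP[_ gz] := gB z; apply: le_trans gz _.
    have := enorm_ge0 z.1; rewrite le_eqVlt => /predU1P[/esym z0|z0].
      rewrite (profile_enorm_eq0 _ _ (addr_gt0 m10 s20) z0).
      by rewrite (profile_enorm_eq0 _ _ (addr_gt0 m0 s20) z0) !mulr0.
    by rewrite -mulrA; apply: ler_wpM2l; [exact: ltW|exact: HM2].
  + have h : delta1 * M2 <= (k - lambda) / 2 * C.
      by apply: le_trans dC; apply: ler_wpM2r; exact: ltW.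
    have -> : (k - lambda) * C = (k - lambda) / 2 * C + (k - lambda) / 2 * C.
      by move: (k) => k'; field.
    exact: lerD.
- move=> z g z0 g0 gU.
  exact: (J_profile_super s0 Ns mE ali mN sg01 (ltW C0) ak' ask z0 g0 gU).
- apply: filterS fpos => z fz t0; apply: le_trans (fz t0) _.
  rewrite (profile_gt0E _ _ _ t0) mul1r (opprD m1 (2 * s)) !mulrA; exact: lexx.
Qed.
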